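(* Let $k$ be a commutative ring and let $A$ be a $k$-algebra. Then there is a bijective correspondence between normal gabi-algebra structures on $A$ and Hopf algebra structures on $A$. In other words, ${}_A\mathcal{M}$ is a normal-closed category with strictly closed forgetful functor ${}_A\mathcal{M}\to{}_k\mathcal{M}$ if and only if ${}_A\mathcal{M}$ is closed monoidal and the forgetful functor ${}_A\mathcal{M}\to{}_k\mathcal{M}$ is strictly closed monoidal.
   Context: Algebras are associative and unital, $\otimes=\otimes_k$, and ${}_A\mathcal{M}$, ${}_k\mathcal{M}$ are the categories of left $A$-modules and of $k$-modules. A Hopf algebra structure on $A$ is a bialgebra structure on the given algebra $A$ that admits an antipode (a two-sided convolution inverse of the identity, not required to be bijective). In the second formulation, the categorical structures on ${}_A\mathcal{M}$ are structures that are asserted to exist. A (left) gabi-algebra structure on $A$ consists of algebra maps $\varepsilon\colon A\to k$ and $\delta\colon A\to A\otimes A^{\mathrm{op}}$, $\delta(a)=a_+\otimes a_-$ (summation understood), such that for all $a\in A$: $a_+\varepsilon(a_-)=a$; $a_+a_-=\varepsilon(a)1_A$; and $a_{++}\otimes a_{-+}\otimes a_{--}a_{+-}=a_+\otimes a_-\otimes 1$, where $\delta(a_+)=a_{++}\otimes a_{+-}$ and $\delta(a_-)=a_{-+}\otimes a_{--}$. It induces a (lifted) skew-closed structure on ${}_A\mathcal{M}$: $[M,N]=\mathrm{Hom}_k(M,N)$ with $(a.f)(m)=a_+f(a_-m)$, $\mathbf{1}=k$ with action via $\varepsilon$, $i_M(f)=f(1)$, $j_M(1)=\mathrm{id}_M$,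 $\Gamma^M_{N,P}(f)=f\circ-$. The gabi-algebra is normal if this skew-closed structure is normal (defined next). A (left) skew-closed category is a category $\mathcal{C}$ with an object $\mathbf{1}$, a functor $[-,-]\colon\mathcal{C}^{\mathrm{op}}\times\mathcal{C}\to\mathcal{C}$, a natural transformation $i_X\colon[\mathbf{1},X]\to X$, a dinatural transformation $j_X\colon\mathbf{1}\to[X,X]$, and morphisms $\Gamma^X_{Y,Z}\colon[Y,Z]\to[[X,Y],[X,Z]]$ natural in $Y,Z$ and dinatural in $X$, such that: $i_{\mathbf{1}}\circ j_{\mathbf{1}}=\mathrm{id}_{\mathbf 1}$; $i_{[X,Y]}\circ[j_X,[X,Y]]\circ\Gamma^X_{X,Y}=\mathrm{id}_{[X,Y]}$; $\Gamma^X_{Y,Y}\circ j_Y=j_{[X,Y]}$; $[[\mathbf{1},X],i_Y]\circ\Gamma^{\mathbf{1}}_{X,Y}=[i_X,Y]$; and $[\Gamma^U_{V,W},[[U,V],[U,X]]]\circ\Gamma^{[U,V]}_{[U,W],[U,X]}\circ\Gamma^U_{W,X}=[[V,W],\Gamma^U_{V,X}]\circ\Gamma^V_{W,X}$. It is normal (a normal-closed category) if it is - left normal: $\mathcal{C}(X,Y)\to\mathcal{C}(\mathbf{1},[X,Y])$, $f\mapsto[f,Y]\circ j_Y$, is a natural bijection; - right normal: $i$ is a natural isomorphism; and - associative normal: for all $U,X,Y,Z$ the canonical map $\int^{V\in\mathcal{C}}\mathcal{C}(U,[V,Z])\times\mathcal{C}(X,[Y,V])\to\mathcal{C}(U,[X,[Y,Z]])$,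 given by $(f,g)\mapsto[g,[Y,Z]]\circ\Gamma^Y_{V,Z}\circ f$, is a bijection. A functor $F$ between skew-closed categories is strictly closed if $F\mathbf{1}=\mathbf{1}$ and $F[X,Y]=[FX,FY]$ (with identities as structure morphisms), $F(i_X)=i_{FX}$, $F(j_X)=j_{FX}$, $F(\Gamma^X_{Y,Z})=\Gamma^{FX}_{FY,FZ}$. The closed structure on ${}_k\mathcal{M}$ is $[M,N]=\mathrm{Hom}_k(M,N)$, $\mathbf{1}=k$, $i_M(f)=f(1)$, $j_M(1)=\mathrm{id}_M$, $\Gamma^M_{N,P}(f)=f\circ-$; its monoidal structure is $\otimes_k$. A monoidal category $(\mathcal{C},\otimes,\mathbf{1},\alpha,\lambda,\rho)$, with $\alpha_{X,Y,Z}\colon(X\otimes Y)\otimes Z\to X\otimes(Y\otimes Z)$, $\lambda_X\colon\mathbf{1}\otimes X\to X$ and $\rho_X\colon X\to X\otimes\mathbf{1}$, is closed if all functors $X\otimes-$ and $-\otimes X$ have right adjoints. The right adjoints $[X,-]$ of $-\otimes X$ (with units $\mathrm{coev}^X$) carry the corresponding normal-closed structure $(\mathbf{1},i,j,\Gamma,[-,-])$, determined by $[Y,[Z,\alpha_{X,Y,Z}]]\circ[Y,\mathrm{coev}^Z_{X\otimes Y}]\circ\mathrm{coev}^Y_X=[\mathrm{coev}^Z_Y,[Z,X\otimes(Y\otimes Z)]]\circ\Gamma^Z_{Y\otimes Z,X\otimes(Y\otimes Z)}\circ\mathrm{coev}^{Y\otimes Z}_X$, $[X,\lambda_X]\circ\mathrm{coev}^X_{\mathbf{1}}=j_X$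 and $\rho_X=i_{X\otimes\mathbf{1}}\circ\mathrm{coev}^{\mathbf{1}}_X$. A functor is strictly closed monoidal if it is strict monoidal and strictly closed with respect to these closed structures $[X,-]$ (right adjoint to $-\otimes X$). *)

(* Defs.v *)
From HB Require Import structures.
From mathcomp Require Import all_boot all_algebra.
From mathcomp Require Import boolp.

Set Implicit Arguments.
Unset Strict Implicit.
Unset Printing Implicit Defensive.

Import GRing.Theory.
Local Open Scope ring_scope.
Local Open Scope quotient_scope.

Lemma lin_ext (R : pzRingType) (M N : lmodType R) (f g : {linear M -> N}) :
  f =1 g -> f = g.
Proof.
case: f => f [[[f0 fD]] [fZ]]; case: g => g [[[g0 gD]] [gZ]] /= fg.
have {}fg : f = g by apply: funext.
case: _ / fg in g0 gD gZ *.
by rewrite (Prop_irrelevance f0 g0) (Prop_irrelevance fD gD)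
  (Prop_irrelevance fZ gZ).
Qed.

Section MkLinear.
Variables (R : pzRingType) (M N : lmodType R) (f : M -> N) (hf : linear f).
Definition mklin_fun (_ : linear f) := f.
HB.instance Definition _ :=
  GRing.isLinear.Build R M N *:%R (mklin_fun hf) hf.
Definition mklin : {linear M -> N} := mklin_fun hf.
End MkLinear.
Arguments mklin_fun {R M N f} hf /.

Section Tensor.
Variables (k : comPzRingType) (M N : lmodType k).

(* M (x) N: finite lists [:: (m_i, n_i)], read as \sum_i m_i (x) n_i, modulo the
   congruence below; (- m, n) represents the opposite of m (x) n. *)
Inductive tens_rel : seq (M * N) -> seq (M * N) -> Prop :=
| TR_refl s : tens_rel s s
| TR_sym s t : tens_rel s t -> tens_rel t s
| TR_trans s t u : tens_rel s t -> tens_rel t u -> tens_rel s u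
| TR_cat s s' t t' :
    tens_rel s s' -> tens_rel t t' -> tens_rel (s ++ t) (s' ++ t')
| TR_comm s t : tens_rel (s ++ t) (t ++ s)
| TR_zero n : tens_rel [:: (0, n)] [::]
| TR_addl m m' n : tens_rel [:: (m + m', n)] [:: (m, n); (m', n)]
| TR_addr m n n' : tens_rel [:: (m, n + n')] [:: (m, n); (m, n')]
| TR_scale c m n : tens_rel [:: (c *: m, n)] [:: (m, c *: n)].

Definition tens_relb s t := `[< tens_rel s t >].

Lemma tens_relb_refl : reflexive tens_relb.
Proof. by move=> s; apply/asboolP; apply: TR_refl. Qed.
Lemma tens_relb_sym : symmetric tens_relb.
Proof. by move=> s t; apply/asboolP/asboolP; apply: TR_sym. Qed.
Lemma tens_relb_trans : transitive tens_relb.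
Proof.
by move=> t s u /asboolP st /asboolP tu; apply/asboolP; apply: TR_trans st tu.
Qed.

Canonical tens_relb_equiv :=
  EquivRel tens_relb tens_relb_refl tens_relb_sym tens_relb_trans.

Definition tensor := {eq_quot tens_relb}%qT.
HB.instance Definition _ := Choice.on tensor.
HB.instance Definition _ := EqQuotient.on tensor.

Definition tcls (s : seq (M * N)) : tensor := (\pi_tensor s)%qT.

Lemma tclsP s t : (tcls s = tcls t) <-> tens_rel s t.
Proof.
split=> [st | st].
  have /eqP := st; rewrite /tcls (@eqquotE _ tens_relb tensor).
  by move/asboolP.
by apply/eqP; rewrite /tcls (@eqquotE _ tens_relb tensor); apply/asboolP.
Qed.

Definition trepr (t : tensor) : seq (M * N) := repr t.

Lemma treprK t : tcls (trepr t) = t.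
Proof. exact: reprK. Qed.

Lemma trepr_tcls s : tens_rel (trepr (tcls s)) s.
Proof. by apply/tclsP; rewrite treprK. Qed.

Lemma tens_rel_map (f : M -> M) :
  {morph f : x y / x + y} -> (forall c, {morph f : x / c *: x}) ->
  forall s t, tens_rel s t ->
  tens_rel [seq (f p.1, p.2) | p <- s] [seq (f p.1, p.2) | p <- t].
Proof.
move=> fD fZ s t; elim=> {s t} /=; rewrite ?map_cat.
- by move=> s; apply: TR_refl.
- by move=> s t _; apply: TR_sym.
- by move=> s t u _ st _; apply: TR_trans.
- by move=> s s' t t' _ ss _ tt; rewrite !map_cat; apply: TR_cat.
- by move=> s t; rewrite !map_cat; apply: TR_comm.
- by move=> n; rewrite -(scale0r 0) fZ scale0r; apply: TR_zero.
- by move=> m m' n; rewrite fD; apply: TR_addl.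
- by move=> m n n'; apply: TR_addr.
- by move=> c m n; rewrite fZ; apply: TR_scale.
Qed.

Definition tens_add (t u : tensor) : tensor := tcls (trepr t ++ trepr u).
Definition tens_scale (c : k) (t : tensor) : tensor :=
  tcls [seq (c *: p.1, p.2) | p <- trepr t].
Definition tens_opp (t : tensor) : tensor := tens_scale (-1) t.

Lemma tens_addE s t : tens_add (tcls s) (tcls t) = tcls (s ++ t).
Proof. by apply/tclsP/TR_cat; apply: trepr_tcls. Qed.

Lemma tens_scaleE c s :
  tens_scale c (tcls s) = tcls [seq (c *: p.1, p.2) | p <- s].
Proof.
apply/tclsP/(@tens_rel_map ( *:%R c)) => [x y|d x|].
- exact: scalerDr.
- by rewrite !scalerA mulrC.
- exact: trepr_tcls.
Qed.

Lemma tens_ind (P : tensor -> Prop) : (forall s, P (tcls s)) -> forall t, P t.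
Proof. by move=> h t; rewrite -(treprK t). Qed.

Lemma tens_addA : associative tens_add.
Proof.
elim/tens_ind=> s; elim/tens_ind=> t; elim/tens_ind=> u.
by rewrite !tens_addE catA.
Qed.
Lemma tens_addC : commutative tens_add.
Proof.
elim/tens_ind=> s; elim/tens_ind=> t.
by rewrite !tens_addE; apply/tclsP/TR_comm.
Qed.
Lemma tens_add0 : left_id (tcls [::]) tens_add.
Proof. by elim/tens_ind=> s; rewrite tens_addE. Qed.

Lemma tens_scaleDl c d t :
  tens_scale (c + d) t = tens_add (tens_scale c t) (tens_scale d t).
Proof.
elim/tens_ind: t => s; rewrite !tens_scaleE.
elim: s => [|[m n] s ih] /=; first by rewrite tens_addE.
have E x r : tcls (x :: r) = tens_add (tcls [:: x]) (tcls r).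
  by rewrite tens_addE.
rewrite E (E _ [seq (c *: p.1, p.2) | p <- s]).
rewrite (E _ [seq (d *: p.1, p.2) | p <- s]).
rewrite {}ih scalerDl.
have -> : tcls [:: (c *: m + d *: m, n)] =
  tens_add (tcls [:: (c *: m, n)]) (tcls [:: (d *: m, n)]).
  by rewrite tens_addE; apply/tclsP/TR_addl.
rewrite -!tens_addA; congr tens_add; rewrite !tens_addA; congr tens_add.
exact: tens_addC.
Qed.

Lemma tens_scale0 t : tens_scale 0 t = tcls [::].
Proof.
elim/tens_ind: t => s; rewrite tens_scaleE; elim: s => [|[m n] s ih] //=.
rewrite -cat1s -tens_addE ih scale0r.
have -> : tcls [:: (0, n)] = tcls [::] by apply/tclsP/TR_zero.
by rewrite tens_add0.
Qed.

Lemma tens_scale1 t : tens_scale 1 t = t.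
Proof.
elim/tens_ind: t => s; rewrite tens_scaleE; congr tcls.
by elim: s => [|[m n] s /= ->] //=; rewrite scale1r.
Qed.

Lemma tens_addN : left_inverse (tcls [::]) tens_opp tens_add.
Proof.
move=> t; rewrite -{2}[t]tens_scale1 /tens_opp -tens_scaleDl addNr.
exact: tens_scale0.
Qed.

HB.instance Definition _ :=
  GRing.isZmodule.Build tensor tens_addA tens_addC tens_add0 tens_addN.

Lemma tens_scaleA c d t : tens_scale c (tens_scale d t) = tens_scale (c * d) t.
Proof.
elim/tens_ind: t => s; rewrite !tens_scaleE -map_comp; congr tcls.
by apply: eq_map => -[m n] /=; rewrite scalerA.
Qed.
Lemma tens_scaleDr : right_distributive tens_scale +%R.
Proof.
move=> c; elim/tens_ind=> s; elim/tens_ind=> t.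
by rewrite [LHS](congr1 _ (tens_addE _ _)) !tens_scaleE map_cat -tens_addE.
Qed.
Lemma tens_scaleDl' t : {morph tens_scale^~ t : c d / c + d}.
Proof. by move=> c d; apply: tens_scaleDl. Qed.

HB.instance Definition _ := GRing.Zmodule_isLmodule.Build k tensor
  tens_scaleA tens_scale1 tens_scaleDr tens_scaleDl'.

Definition tens (m : M) (n : N) : tensor := tcls [:: (m, n)].

(* The value of f on a chosen representative of t; see [tlift_tcls] for
   bilinear f. *)
Definition tlift (V : nmodType) (f : M -> N -> V) (t : tensor) : V :=
  \sum_(p <- trepr t) f p.1 p.2.

Lemma tensDl m m' n : tens (m + m') n = tens m n + tens m' n.
Proof. by rewrite -[RHS]/(tens_add _ _) tens_addE; apply/tclsP/TR_addl. Qed.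
Lemma tensDr m n n' : tens m (n + n') = tens m n + tens m n'.
Proof. by rewrite -[RHS]/(tens_add _ _) tens_addE; apply/tclsP/TR_addr. Qed.
Lemma tensZl c m n : tens (c *: m) n = c *: tens m n.
Proof. by rewrite -[RHS]/(tens_scale _ _) tens_scaleE. Qed.
Lemma tensZr c m n : tens m (c *: n) = c *: tens m n.
Proof. by rewrite -tensZl; apply/esym/tclsP/TR_scale. Qed.

Lemma tcls_sum s : tcls s = \sum_(p <- s) tens p.1 p.2.
Proof.
elim: s => [|[m n] s ih]; first by rewrite big_nil.
by rewrite big_cons -ih -[RHS]/(tens_add _ _) tens_addE.
Qed.

Definition bilinear_fun (V : lmodType k) (f : M -> N -> V) :=
  (forall n, linear (f^~ n)) /\ (forall m, linear (f m)).

Section Lift.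
Variables (V : lmodType k) (f : M -> N -> V) (hf : bilinear_fun f).

Let fDl n : {morph f^~ n : x y / x + y}.
Proof. by case: hf => h _ x y; have := h n 1 x y; rewrite !scale1r. Qed.
Let fDr m : {morph f m : x y / x + y}.
Proof. by case: hf => _ h x y; have := h m 1 x y; rewrite !scale1r. Qed.
Let f0l n : f 0 n = 0.
Proof. by apply: (addrI (f 0 n)); rewrite -fDl !addr0. Qed.
Let f0r m : f m 0 = 0.
Proof. by apply: (addrI (f m 0)); rewrite -fDr !addr0. Qed.
Let fZl c m n : f (c *: m) n = c *: f m n.
Proof. by case: hf => h _; have := h n c m 0; rewrite f0l !addr0. Qed.
Let fZr c m n : f m (c *: n) = c *: f m n.
Proof. by case: hf => _ h; have := h m c n 0; rewrite f0r !addr0. Qed.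

Let sum_rel s t : tens_rel s t ->
  \sum_(p <- s) f p.1 p.2 = \sum_(p <- t) f p.1 p.2.
Proof.
elim=> {s t} //.
- by move=> s t u _ -> _ ->.
- by move=> s s' t t' _ ss _ tt; rewrite !big_cat /= ss tt.
- by move=> s t; rewrite !big_cat /= addrC.
- by move=> n; rewrite big_seq1 big_nil /= f0l.
- by move=> m m' n; rewrite !big_cons !big_nil /= !addr0 fDl.
- by move=> m n n'; rewrite !big_cons !big_nil /= !addr0 fDr.
- by move=> c m n; rewrite !big_seq1 /= fZl fZr.
Qed.

Lemma tlift_tcls s : tlift f (tcls s) = \sum_(p <- s) f p.1 p.2.
Proof. exact/sum_rel/trepr_tcls. Qed.

Lemma tlift_tens m n : tlift f (tens m n) = f m n.
Proof. by rewrite tlift_tcls big_seq1. Qed.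

Lemma tlift_linear : linear (tlift f).
Proof.
move=> c; elim/tens_ind=> s; elim/tens_ind=> t.
have -> : c *: tcls s + tcls t = tcls ([seq (c *: p.1, p.2) | p <- s] ++ t).
  by rewrite -[LHS]/(tens_add (tens_scale _ _) _) tens_scaleE tens_addE.
rewrite !tlift_tcls big_cat big_map /= scaler_sumr; congr (_ + _).
by apply: eq_bigr => p _; rewrite fZl.
Qed.

Definition tliftl : {linear tensor -> V} := mklin tlift_linear.

Lemma tliftlE m n : tliftl (tens m n) = f m n.
Proof. exact: tlift_tens. Qed.
End Lift.

Lemma tens_bilinear : bilinear_fun tens.
Proof.
by split=> [n c m m'|m c n n']; rewrite ?tensDl ?tensDr ?tensZl ?tensZr.
Qed.

Lemma tens_ext (V : lmodType k) (f g : {linear tensor -> V}) :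
  (forall m n, f (tens m n) = g (tens m n)) -> f =1 g.
Proof.
move=> fg; elim/tens_ind=> s; rewrite tcls_sum !linear_sum.
by apply: eq_bigr => p _.
Qed.

Lemma tens_sumP (t : tensor) : t = \sum_(p <- trepr t) tens p.1 p.2.
Proof. by rewrite -tcls_sum treprK. Qed.

End Tensor.
Record category := Category {
  obj :> Type;
  mor : obj -> obj -> Type;
  idm : forall X, mor X X;
  comp : forall X Y Z, mor Y Z -> mor X Y -> mor X Z;
  comp_idl : forall X Y (f : mor X Y), comp (idm Y) f = f;
  comp_idr : forall X Y (f : mor X Y), comp f (idm X) = f;
  comp_assoc : forall X Y Z W (h : mor Z W) (g : mor Y Z) (f : mor X Y),
    comp h (comp g f) = comp (comp h g) f }.

Arguments mor {c} X Y.
Arguments idm {c} X.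
Arguments comp {c X Y Z} g f.

Notation "g \c f" := (comp g f) (at level 40, left associativity).

Definition is_iso (C : category) (X Y : C) (f : mor X Y) : Prop :=
  exists g : mor Y X, g \c f = idm X /\ f \c g = idm Y.

(* The identity morphism along an equality of objects. *)
Definition eqm (C : category) (X Y : C) (e : X = Y) : mor X Y :=
  match e in _ = Z return mor X Z with erefl => idm X end.

Record functor (C D : category) := Functor {
  fobj :> C -> D;
  fmor : forall X Y, mor X Y -> mor (fobj X) (fobj Y);
  fmor_id : forall X, fmor (idm X) = idm (fobj X);
  fmor_comp : forall X Y Z (g : mor Y Z) (f : mor X Y),
    fmor (g \c f) = fmor g \c fmor f }.

Arguments fmor {C D} F {X Y} f : rename.

Record right_adjoint (C D : category) (F : functor C D) := RightAdjoint {
  radj : functor D C;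
  adj_unit : forall X, mor X (radj (F X));
  adj_counit : forall Y, mor (F (radj Y)) Y;
  adj_unit_nat : forall X X' (f : mor X X'),
    fmor radj (fmor F f) \c adj_unit X = adj_unit X' \c f;
  adj_counit_nat : forall Y Y' (g : mor Y Y'),
    adj_counit Y' \c fmor F (fmor radj g) = g \c adj_counit Y;
  adj_triangleL : forall X, adj_counit (F X) \c fmor F (adj_unit X) = idm (F X);
  adj_triangleR : forall Y,
    fmor radj (adj_counit Y) \c adj_unit (radj Y) = idm (radj Y) }.

(* A functor C^op x C -> C, written [X, Y]; [imor f g : [X, Y] -> [X', Y']]. *)
Record ihom_functor (C : category) := IhomFunctor {
  ihom :> C -> C -> C;
  imor : forall X X' Y Y' : C,
    mor X' X -> mor Y Y' -> mor (ihom X Y) (ihom X' Y');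
  imor_id : forall X Y, imor (idm X) (idm Y) = idm (ihom X Y);
  imor_comp : forall X X' X'' Y Y' Y'' (f : mor X' X) (f' : mor X'' X')
      (g : mor Y Y') (g' : mor Y' Y''),
    imor (f \c f') (g' \c g) = imor f' g' \c imor f g }.

Arguments imor {C} H {X X' Y Y'} f g : rename.

Section SkewClosed.
Variables (C : category) (one : C) (H : ihom_functor C).

Local Notation "[[ X , Y ]]" := (ihom H X Y).
Local Notation "[[ f ,- Y ]]" := (imor H f (idm Y)).
Local Notation "[[ X -, g ]]" := (imor H (idm X) g).

Record skew_closed := SkewClosed {
  sc_i : forall X, mor [[one, X]] X;
  sc_j : forall X, mor one [[X, X]];
  sc_G : forall X Y Z, mor [[Y, Z]] [[ [[X, Y]], [[X, Z]] ]];
  sc_i_nat : forall X Y (f : mor X Y),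
    sc_i Y \c [[one -, f]] = f \c sc_i X;
  sc_j_dinat : forall X Y (f : mor X Y),
    [[X -, f]] \c sc_j X = [[f ,- Y]] \c sc_j Y;
  sc_G_nat : forall X Y Y' Z Z' (f : mor Y' Y) (g : mor Z Z'),
    sc_G X Y' Z' \c imor H f g =
    imor H [[X -, f]] [[X -, g]] \c sc_G X Y Z;
  sc_G_dinat : forall X X' Y Z (f : mor X X'),
    [[ [[f ,- Y]] ,- [[X, Z]] ]] \c sc_G X Y Z =
    [[ [[X', Y]] -, [[f ,- Z]] ]] \c sc_G X' Y Z;
  sc_ij : sc_i one \c sc_j one = idm one;
  sc_ijG : forall X Y,
    sc_i [[X, Y]] \c [[sc_j X ,- [[X, Y]] ]] \c sc_G X X Y = idm [[X, Y]];
  sc_Gj : forall X Y, sc_G X Y Y \c sc_j Y = sc_j [[X, Y]];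
  sc_iG : forall X Y,
    [[ [[one, X]] -, sc_i Y]] \c sc_G one X Y = [[sc_i X ,- Y]];
  sc_GG : forall U V W X,
    [[sc_G U V W ,- [[ [[U, V]], [[U, X]] ]] ]]
      \c sc_G [[U, V]] [[U, W]] [[U, X]] \c sc_G U W X =
    [[ [[V, W]] -, sc_G U V X]] \c sc_G V W X }.

Variable S : skew_closed.

(* The naturality of these maps in X and Y follows from [imor_comp] and
   [sc_j_dinat]. *)
Definition left_normal : Prop :=
  forall X Y : C, bijective (fun f : mor X Y => [[f ,- Y]] \c sc_j S Y).

Definition right_normal : Prop := forall X : C, is_iso (sc_i S X).

Section AssociativeNormal.
Variables U X Y Z : C.

(* Elements of the coproduct over V of C(U, [V, Z]) x C(X, [Y, V]), and the
   relation whose quotient is the coend over V. *)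
Definition coend_elt : Type := {V : C & (mor U [[V, Z]] * mor X [[Y, V]])%type}.

Definition coend_mk V (f : mor U [[V, Z]]) (g : mor X [[Y, V]]) : coend_elt :=
  existT _ V (f, g).

Inductive coend_eq : coend_elt -> coend_elt -> Prop :=
| coend_glue V W (v : mor V W) (f : mor U [[W, Z]]) (g : mor X [[Y, V]]) :
    coend_eq (coend_mk ([[v ,- Z]] \c f) g) (coend_mk f ([[Y -, v]] \c g))
| coend_refl p : coend_eq p p
| coend_sym p q : coend_eq p q -> coend_eq q p
| coend_trans p q r : coend_eq p q -> coend_eq q r -> coend_eq p r.

Definition coend_map (p : coend_elt) : mor U [[X, [[Y, Z]] ]] :=
  let: existT V (f, g) := p in [[g ,- [[Y, Z]] ]] \c sc_G S Y V Z \c f.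
End AssociativeNormal.

(* [coend_map] induces a bijection from the quotient by [coend_eq], that is from
   the coend. *)
Definition assoc_normal : Prop := forall U X Y Z : C,
  (forall p q : coend_elt U X Y Z, coend_eq p q <-> coend_map p = coend_map q)
  /\ (forall h : mor U [[X, [[Y, Z]] ]], exists p, coend_map p = h).

Definition normal : Prop := left_normal /\ right_normal /\ assoc_normal.

End SkewClosed.

(* F preserves the closed structure, with the identities [eqm e1] and [eqm e] as
   structure morphisms F one -> one and F [X, Y] -> [F X, F Y]; the first clause
   is the equality F [f, g] = [F f, F g]. *)
Definition strictly_closed (C D : category) (F : functor C D)
    (oneC : C) (HC : ihom_functor C) (SC : skew_closed oneC HC)
    (oneD : D) (HD : ihom_functor D) (SD : skew_closed oneD HD) : Prop :=
  exists (e1 : F oneC = oneD) (e : forall X Y, F (HC X Y) = HD (F X) (F Y)),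
  (forall X X' Y Y' (f : mor X' X) (g : mor Y Y'),
     eqm (e X' Y') \c fmor F (imor HC f g) =
     imor HD (fmor F f) (fmor F g) \c eqm (e X Y)) /\
  (forall X,
     fmor F (sc_i SC X) =
     sc_i SD (F X) \c imor HD (eqm (esym e1)) (idm (F X)) \c eqm (e oneC X)) /\
  (forall X,
     eqm (e X X) \c fmor F (sc_j SC X) = sc_j SD (F X) \c eqm e1) /\
  (forall X Y Z,
     imor HD (eqm (esym (e X Y))) (eqm (e X Z)) \c eqm (e (HC X Y) (HC X Z))
       \c fmor F (sc_G SC X Y Z) =
     sc_G SD (F X) (F Y) (F Z) \c eqm (e Y Z)).

Record monoidal (C : category) := Monoidal {
  mten : C -> C -> C;
  mtenm : forall X X' Y Y' : C,
    mor X X' -> mor Y Y' -> mor (mten X Y) (mten X' Y');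
  mone : C;
  malpha : forall X Y Z, mor (mten (mten X Y) Z) (mten X (mten Y Z));
  mlambda : forall X, mor (mten mone X) X;
  mrho : forall X, mor X (mten X mone);
  mtenm_id : forall X Y, mtenm (idm X) (idm Y) = idm (mten X Y);
  mtenm_comp : forall X X' X'' Y Y' Y'' (f' : mor X' X'') (f : mor X X')
      (g' : mor Y' Y'') (g : mor Y Y'),
    mtenm (f' \c f) (g' \c g) = mtenm f' g' \c mtenm f g;
  malpha_nat : forall X X' Y Y' Z Z' (f : mor X X') (g : mor Y Y')
      (h : mor Z Z'),
    malpha X' Y' Z' \c mtenm (mtenm f g) h =
    mtenm f (mtenm g h) \c malpha X Y Z;
  mlambda_nat : forall X X' (f : mor X X'),
    mlambda X' \c mtenm (idm mone) f = f \c mlambda X;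
  mrho_nat : forall X X' (f : mor X X'),
    mrho X' \c f = mtenm f (idm mone) \c mrho X;
  malpha_iso : forall X Y Z, is_iso (malpha X Y Z);
  mlambda_iso : forall X, is_iso (mlambda X);
  mrho_iso : forall X, is_iso (mrho X);
  mpentagon : forall W X Y Z,
    malpha W X (mten Y Z) \c malpha (mten W X) Y Z =
    mtenm (idm W) (malpha X Y Z) \c malpha W (mten X Y) Z
      \c mtenm (malpha W X Y) (idm Z);
  mtriangle : forall X Y,
    mtenm (idm X) (mlambda Y) \c malpha X mone Y \c mtenm (mrho X) (idm Y) =
    idm (mten X Y) }.

Arguments mtenm {C} M {X X' Y Y'} f g : rename.

Section ClosedMonoidal.
Variables (C : category) (M : monoidal C).

Local Notation "X \ox Y" := (mten M X Y) (at level 40, left associativity).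
Local Notation "f \om g" := (mtenm M f g) (at level 40, left associativity).

Lemma tens_left_comp X Y Y' Y'' (g : mor Y' Y'') (f : mor Y Y') :
  idm X \om (g \c f) = (idm X \om g) \c (idm X \om f).
Proof. by rewrite -mtenm_comp comp_idl. Qed.
Lemma tens_right_comp X Y Y' Y'' (g : mor Y' Y'') (f : mor Y Y') :
  (g \c f) \om idm X = (g \om idm X) \c (f \om idm X).
Proof. by rewrite -mtenm_comp comp_idl. Qed.

Definition tens_left (X : C) : functor C C :=
  {| fobj Y := X \ox Y; fmor Y Y' g := idm X \om g;
     fmor_id Y := mtenm_id M X Y; fmor_comp := @tens_left_comp X |}.

Definition tens_right (X : C) : functor C C :=
  {| fobj Y := Y \ox X; fmor Y Y' f := f \om idm X;
     fmor_id Y := mtenm_id M Y X; fmor_comp := @tens_right_comp X |}.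

Record closed_monoidal := ClosedMonoidal {
  cm_left : forall X, right_adjoint (tens_left X);
  cm_right : forall X, right_adjoint (tens_right X) }.

Variable K : closed_monoidal.

Definition coev (X Y : C) : mor Y (radj (cm_right K X) (Y \ox X)) :=
  adj_unit (cm_right K X) Y.
Definition ev (X Y : C) : mor (radj (cm_right K X) Y \ox X) Y :=
  adj_counit (cm_right K X) Y.

(* [X, Y] as a functor of both variables: its action on f : X' -> X is the mate
   of - \ox f. *)
Definition adj_imor (X X' Y Y' : C) (f : mor X' X) (g : mor Y Y') :
    mor (radj (cm_right K X) Y) (radj (cm_right K X') Y') :=
  fmor (radj (cm_right K X'))
    (g \c ev X Y \c (idm (radj (cm_right K X) Y) \om f))
  \c coev X' (radj (cm_right K X) Y).

Lemma adj_imor_id X Y : adj_imor (idm X) (idm Y) = idm _.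
Proof.
by rewrite /adj_imor mtenm_id comp_idr comp_idl adj_triangleR.
Qed.

Lemma ev_adj_imor X X' Y Y' (f : mor X' X) (g : mor Y Y') :
  ev X' Y' \c (adj_imor f g \om idm X') = g \c ev X Y \c (idm _ \om f).
Proof.
rewrite /adj_imor; set u := (g \c _ \c _).
rewrite tens_right_comp comp_assoc.
have := adj_counit_nat (cm_right K X') u.
rewrite /= -/(ev _ _) => ->; rewrite -comp_assoc.
have := adj_triangleL (cm_right K X') (radj (cm_right K X) Y).
by rewrite /= -/(coev _ _) => ->; rewrite comp_idr.
Qed.

Lemma adj_imor_comp X X' X'' Y Y' Y'' (f : mor X' X) (f' : mor X'' X')
    (g : mor Y Y') (g' : mor Y' Y'') :
  adj_imor (f \c f') (g' \c g) = adj_imor f' g' \c adj_imor f g.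
Proof.
set a := adj_imor f g; rewrite /adj_imor -[RHS]comp_assoc.
have := adj_unit_nat (cm_right K X'') a; rewrite /= -!/(coev _ _) => <-.
rewrite [RHS]comp_assoc -fmor_comp; congr (fmor _ _ \c _).
rewrite -[RHS]comp_assoc -mtenm_comp comp_idl comp_idr.
rewrite -[a in RHS]comp_idr -[f' in RHS]comp_idl.
rewrite mtenm_comp [RHS]comp_assoc.
rewrite -(comp_assoc g' _ (a \om _)) ev_adj_imor.
by rewrite -!comp_assoc -mtenm_comp comp_idl.
Qed.

Definition adj_ihom : ihom_functor C :=
  {| ihom X Y := radj (cm_right K X) Y;
     imor X X' Y Y' f g := adj_imor f g;
     imor_id := adj_imor_id;
     imor_comp := adj_imor_comp |}.

Local Notation "[[ X , Y ]]" := (ihom adj_ihom X Y).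
Local Notation "[[ f ,- Y ]]" := (imor adj_ihom f (idm Y)).
Local Notation "[[ X -, g ]]" := (imor adj_ihom (idm X) g).

(* S is the closed structure determined by the adjunctions (- (x) X, [X, -]). *)
Definition corresponding_closed (S : skew_closed (mone M) adj_ihom) : Prop :=
  (forall X Y Z,
     [[Y -, [[Z -, malpha M X Y Z]] ]] \c [[Y -, coev Z (X \ox Y)]]
       \c coev Y X =
     [[coev Z Y ,- [[Z, X \ox (Y \ox Z)]] ]]
       \c sc_G S Z (Y \ox Z) (X \ox (Y \ox Z)) \c coev (Y \ox Z) X) /\
  (forall X, [[X -, mlambda M X]] \c coev X (mone M) = sc_j S X) /\
  (forall X, mrho M X = sc_i S (X \ox mone M) \c coev (mone M) X).

End ClosedMonoidal.

(* As for [strictly_closed], [eqm e1] and [eqm e] are the structure morphisms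
   F one -> one and F (X (x) Y) -> F X (x) F Y. *)
Definition strict_monoidal (C D : category) (F : functor C D)
    (MC : monoidal C) (MD : monoidal D) : Prop :=
  exists (e1 : F (mone MC) = mone MD)
    (e : forall X Y, F (mten MC X Y) = mten MD (F X) (F Y)),
  (forall X X' Y Y' (f : mor X X') (g : mor Y Y'),
     eqm (e X' Y') \c fmor F (mtenm MC f g) =
     mtenm MD (fmor F f) (fmor F g) \c eqm (e X Y)) /\
  (forall X Y Z,
     mtenm MD (idm (F X)) (eqm (e Y Z)) \c eqm (e X (mten MC Y Z))
       \c fmor F (malpha MC X Y Z) =
     malpha MD (F X) (F Y) (F Z) \c mtenm MD (eqm (e X Y)) (idm (F Z))
       \c eqm (e (mten MC X Y) Z)) /\
  (forall X,
     fmor F (mlambda MC X) =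
     mlambda MD (F X) \c mtenm MD (eqm e1) (idm (F X)) \c eqm (e _ X)) /\
  (forall X,
     mtenm MD (idm (F X)) (eqm e1) \c eqm (e X _) \c fmor F (mrho MC X) =
     mrho MD (F X)).

(* A k-algebra is a ring with a ring map from k to its centre.  MathComp's
   [algType] is not used because it excludes the zero ring and the zero
   algebra. *)
Record algebra (k : comPzRingType) := Algebra {
  alg_ring :> pzRingType;
  alg_map : {rmorphism k -> alg_ring};
  alg_central : forall c (a : alg_ring), alg_map c * a = a * alg_map c }.

Section Mod.
Variable R : pzRingType.

Definition lin_comp (M N P : lmodType R) (g : {linear N -> P})
  (f : {linear M -> N}) : {linear M -> P} := g \o f.
Definition lin_id (M : lmodType R) : {linear M -> M} := idfun.

Lemma lin_compE (M N P : lmodType R) (g : {linear N -> P})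
  (f : {linear M -> N}) x : lin_comp g f x = g (f x).
Proof. by []. Qed.
Lemma lin_idE (M : lmodType R) x : lin_id M x = x.
Proof. by []. Qed.

Lemma lin_comp_idl (M N : lmodType R) (f : {linear M -> N}) : lin_comp (lin_id N) f = f.
Proof. exact: lin_ext. Qed.
Lemma lin_comp_idr (M N : lmodType R) (f : {linear M -> N}) : lin_comp f (lin_id M) = f.
Proof. exact: lin_ext. Qed.
Lemma lin_comp_assoc (M N P Q : lmodType R) (h : {linear P -> Q}) (g : {linear N -> P})
  (f : {linear M -> N}) : lin_comp h (lin_comp g f) = lin_comp (lin_comp h g) f.
Proof. exact: lin_ext. Qed.

Definition Mod : category :=
  {| obj := lmodType R; mor M N := {linear M -> N};
     idm := lin_id; comp := lin_comp; comp_idl := lin_comp_idl;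
     comp_idr := lin_comp_idr; comp_assoc := lin_comp_assoc |}.
End Mod.

Section Restriction.
Variables (k : comPzRingType) (A : algebra k).

(* Restriction of scalars along [alg_map A]. *)
Definition res_sort (M : lmodType A) : Type := M.
HB.instance Definition _ M := GRing.Zmodule.on (res_sort M).

Section ResLmod.
Variable M : lmodType A.
Definition res_scale (c : k) (m : res_sort M) : res_sort M :=
  (alg_map A c *: (m : M)).
Let res_scaleA c d m : res_scale c (res_scale d m) = res_scale (c * d) m.
Proof. by rewrite /res_scale scalerA rmorphM. Qed.
Let res_scale1 : left_id 1 res_scale.
Proof. by move=> m; rewrite /res_scale rmorph1 scale1r. Qed.
Let res_scaleDr : right_distributive res_scale +%R.
Proof. by move=> c m n; rewrite /res_scale -scalerDr. Qed.
Let res_scaleDl m : {morph res_scale^~ m : c d / c + d}.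
Proof. by move=> c d; rewrite /res_scale rmorphD scalerDl. Qed.
HB.instance Definition _ := GRing.Zmodule_isLmodule.Build k (res_sort M)
  res_scaleA res_scale1 res_scaleDr res_scaleDl.
End ResLmod.

Definition res (M : lmodType A) : lmodType k := res_sort M.

Lemma res_scaleE (M : lmodType A) (c : k) (m : res M) :
  c *: m = (alg_map A c *: (m : M)).
Proof. by []. Qed.

Lemma res_linear (M N : lmodType A) (f : {linear M -> N}) :
  linear (f : res M -> res N).
Proof. by move=> c m n; rewrite /= !res_scaleE linearP. Qed.

Definition res_mor (M N : lmodType A) (f : {linear M -> N}) :
  {linear res M -> res N} := mklin (res_linear f).

Lemma res_mor_id M : res_mor (lin_id M) = lin_id (res M).
Proof. exact: lin_ext. Qed.
Lemma res_mor_comp (M N P : lmodType A) (g : {linear N -> P}) (f : {linear M -> N}) :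
  res_mor (lin_comp g f) = lin_comp (res_mor g) (res_mor f).
Proof. exact: lin_ext. Qed.

Definition forget : functor (Mod A) (Mod k) :=
  @Functor (Mod A) (Mod k) res res_mor res_mor_id res_mor_comp.
End Restriction.

Definition alg_mod (k : comPzRingType) (A : algebra k) : lmodType k :=
  res (A^o : lmodType A).

Definition alg_hom (k : comPzRingType) (A B : algebra k) (f : A -> B) : Prop :=
  [/\ linear (f : alg_mod A -> alg_mod B), f 1 = 1 & {morph f : a b / a * b}].

Lemma alg_scaleE (k : comPzRingType) (A : algebra k) c (a : alg_mod A) :
  c *: a = alg_map A c * (a : A).
Proof. by []. Qed.

Lemma alg_scaleAl (k : comPzRingType) (A : algebra k) c (a b : A) :
  (c *: ((a * b) : alg_mod A)) = ((c *: (a : alg_mod A)) : A) * b.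
Proof. by rewrite !alg_scaleE mulrA. Qed.
Lemma alg_scaleAr (k : comPzRingType) (A : algebra k) c (a b : A) :
  (c *: ((a * b) : alg_mod A)) = a * ((c *: (b : alg_mod A)) : A).
Proof. by rewrite !alg_scaleE mulrA alg_central -mulrA. Qed.

Definition base_alg (k : comPzRingType) : algebra k :=
  @Algebra k k idfun (fun c a => mulrC c a).

Section OppositeAlgebra.
Variables (k : comPzRingType) (A : algebra k).
Definition op_map (c : k) : A^c := alg_map A c.
Let op_map_zmod : zmod_morphism op_map.
Proof. exact: (raddfB (alg_map A)). Qed.
Let op_map_monoid : monoid_morphism op_map.
Proof.
split=> [|c d]; first exact: (rmorph1 (alg_map A)).
by rewrite /op_map mulrC (rmorphM (alg_map A)).
Qed.
HB.instance Definition _ := GRing.isZmodMorphism.Build k A^c op_map op_map_zmod.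
HB.instance Definition _ :=
  GRing.isMonoidMorphism.Build k A^c op_map op_map_monoid.
Definition op_alg : algebra k :=
  @Algebra k A^c op_map (fun c a => esym (alg_central c (a : A))).
End OppositeAlgebra.

Section TensorAlgebra.
Variables (k : comPzRingType) (A B : algebra k).
Local Notation T := (tensor (alg_mod A) (alg_mod B)).
Local Notation tens := (@tens k (alg_mod A) (alg_mod B)).
Local Notation tlift := (@tlift k (alg_mod A) (alg_mod B) _).
Local Notation bilinear_fun := (@bilinear_fun k (alg_mod A) (alg_mod B) _).

Definition tens_mul (s t : T) : T :=
  tlift (fun (a : A) (b : B) =>
    tlift (fun (a' : A) (b' : B) => tens (a * a') (b * b')) t) s.

Let mul_inner a b :
  bilinear_fun (fun (a' : A) (b' : B) => tens (a * a') (b * b') : T).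
Proof.
split=> [b' c x y|a' c x y].
  by rewrite mulrDr -alg_scaleAr tensDl tensZl.
by rewrite mulrDr -alg_scaleAr tensDr tensZr.
Qed.

Let mul_innerl t :
  bilinear_fun (fun (a : A) (b : B) =>
    tlift (fun (a' : A) (b' : B) => tens (a * a') (b * b') : T) t).
Proof.
have e a b : tlift (fun (a' : A) (b' : B) => tens (a * a') (b * b') : T) t =
  \sum_(p <- trepr t) tens (a * p.1) (b * p.2) by [].
split=> [b c x y|a c x y]; rewrite !e scaler_sumr -big_split /=;
  apply: eq_bigr => p _.
  by rewrite mulrDl -alg_scaleAl tensDl tensZl.
by rewrite mulrDl -alg_scaleAl tensDr tensZr.
Qed.

Lemma tens_mulE a b a' b' :
  tens_mul (tens a b) (tens a' b') = tens (a * a') (b * b').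
Proof. by rewrite /tens_mul tlift_tens // tlift_tens. Qed.

Lemma tens_mul_linl t : linear (tens_mul^~ t).
Proof. exact: tlift_linear. Qed.
Lemma tens_mul_linr s : linear (tens_mul s).
Proof.
move=> c t u; rewrite /tens_mul.
have e v : tlift (fun (a : A) (b : B) => tlift (fun (a' : A) (b' : B) => tens (a * a') (b * b') : T) v) s
  = \sum_(p <- trepr s) tlift (fun (a' : A) (b' : B) => tens (p.1 * a') (p.2 * b')) v by [].
rewrite !e scaler_sumr -big_split /=; apply: eq_bigr => p _.
exact: (tlift_linear (mul_inner p.1 p.2)).
Qed.

Lemma tens_mulDl : left_distributive tens_mul +%R.
Proof.
by move=> s s' t; rewrite -[s in LHS]scale1r tens_mul_linl scale1r.
Qed.
Lemma tens_mulDr : right_distributive tens_mul +%R.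
Proof.
by move=> s t t'; rewrite -[t in LHS]scale1r tens_mul_linr scale1r.
Qed.
Lemma tens_mulZl c s t : tens_mul (c *: s) t = c *: tens_mul s t.
Proof.
have m0 : tens_mul 0 t = 0 by apply: (addrI (tens_mul 0 t)); rewrite -tens_mulDl !addr0.
by rewrite -[c *: s]addr0 tens_mul_linl m0 addr0.
Qed.
Lemma tens_mulZr c s t : tens_mul s (c *: t) = c *: tens_mul s t.
Proof.
have m0 : tens_mul s 0 = 0 by apply: (addrI (tens_mul s 0)); rewrite -tens_mulDr !addr0.
by rewrite -[c *: t]addr0 tens_mul_linr m0 addr0.
Qed.

Lemma tensor_ind (P : T -> Prop) :
  (forall a b, P (tens a b)) -> (forall s t, P s -> P t -> P (s + t)) ->
  P 0 -> forall t, P t.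
Proof.
move=> Pt PD P0; elim/tens_ind => s; rewrite tcls_sum.
by elim: s => [|p s ih]; rewrite ?big_nil ?big_cons //; apply: PD.
Qed.

Let tens_mul0 t : tens_mul 0 t = 0.
Proof. by have := tens_mulZl 0 0 t; rewrite !scale0r. Qed.
Let tens_mulr0 t : tens_mul t 0 = 0.
Proof. by have := tens_mulZr 0 t 0; rewrite !scale0r. Qed.

Lemma tens_mulA : associative tens_mul.
Proof.
elim/tensor_ind => [a b|s s' hs hs'|] t u; last by rewrite !tens_mul0.
  2: by rewrite !tens_mulDl hs hs'.
elim/tensor_ind: t u => [a' b'|s s' hs hs'|] u;
  last by rewrite tens_mul0 tens_mulr0 tens_mul0.
  2: by rewrite tens_mulDl !tens_mulDr tens_mulDl hs hs'.
elim/tensor_ind: u => [a'' b''|s s' hs hs'|]; last by rewrite !tens_mulr0.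
  2: by rewrite !tens_mulDr hs hs'.
by rewrite !tens_mulE !mulrA.
Qed.
Lemma tens_mul1l : left_id (tens 1 1) tens_mul.
Proof.
elim/tensor_ind => [a b|s s' hs hs'|]; first by rewrite tens_mulE !mul1r.
  by rewrite tens_mulDr hs hs'.
by rewrite tens_mulr0.
Qed.
Lemma tens_mul1r : right_id (tens 1 1) tens_mul.
Proof.
elim/tensor_ind => [a b|s s' hs hs'|]; first by rewrite tens_mulE !mulr1.
  by rewrite tens_mulDl hs hs'.
by rewrite tens_mul0.
Qed.

HB.instance Definition _ := GRing.Zmodule_isPzRing.Build T
  tens_mulA tens_mul1l tens_mul1r tens_mulDl tens_mulDr.

Definition tens_alg_map (c : k) : T := tens (alg_map A c) 1.
Let tens_alg_map_zmod : zmod_morphism tens_alg_map.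
Proof.
move=> c d; rewrite /tens_alg_map rmorphB.
by rewrite -[- _ in LHS]mulN1r -(rmorphN1 (alg_map A)) tensDl tensZl scaleN1r.
Qed.
Let tens_alg_map_monoid : monoid_morphism tens_alg_map.
Proof.
split=> [|c d]; first by rewrite /tens_alg_map rmorph1.
by rewrite -[RHS]/(tens_mul _ _) tens_mulE mulr1 /tens_alg_map rmorphM.
Qed.
HB.instance Definition _ :=
  GRing.isZmodMorphism.Build k T tens_alg_map tens_alg_map_zmod.
HB.instance Definition _ :=
  GRing.isMonoidMorphism.Build k T tens_alg_map tens_alg_map_monoid.
Let tens_alg_central c (t : T) : tens_alg_map c * t = t * tens_alg_map c.
Proof.
rewrite -[LHS]/(tens_mul _ _) -[RHS]/(tens_mul _ _).
elim/tensor_ind: t => [a b|s s' hs hs'|].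
- by rewrite !tens_mulE alg_central mul1r mulr1.
- by rewrite tens_mulDl tens_mulDr hs hs'.
- by rewrite tens_mul0 tens_mulr0.
Qed.
Definition tens_alg : algebra k := @Algebra k T tens_alg_map tens_alg_central.
End TensorAlgebra.

Section HomK.
Variables (k : comPzRingType) (M N : lmodType k).
Definition homk_sort : Type := {linear M -> N}.
HB.instance Definition _ := gen_eqMixin homk_sort.
HB.instance Definition _ := gen_choiceMixin homk_sort.

Implicit Types f g h : homk_sort.
Definition homk_add f g : homk_sort :=
  ((f : {linear M -> N}) \+ (g : {linear M -> N}) : {linear M -> N}).
Definition homk_opp f : homk_sort := (\- (f : {linear M -> N}) : {linear M -> N}).
Definition homk_zero : homk_sort := (\0 : {linear M -> N}).
Definition homk_scale (c : k) f : homk_sort :=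
  (c \*: (f : {linear M -> N}) : {linear M -> N}).

Let homk_addA : associative homk_add.
Proof. by move=> f g h; apply: lin_ext => x /=; rewrite addrA. Qed.
Let homk_addC : commutative homk_add.
Proof. by move=> f g; apply: lin_ext => x /=; rewrite addrC. Qed.
Let homk_add0 : left_id homk_zero homk_add.
Proof. by move=> f; apply: lin_ext => x /=; rewrite add0r. Qed.
Let homk_addN : left_inverse homk_zero homk_opp homk_add.
Proof. by move=> f; apply: lin_ext => x /=; rewrite addNr. Qed.
HB.instance Definition _ :=
  GRing.isZmodule.Build homk_sort homk_addA homk_addC homk_add0 homk_addN.

Let homk_scaleA c d f : homk_scale c (homk_scale d f) = homk_scale (c * d) f.
Proof. by apply: lin_ext => x /=; rewrite scalerA. Qed.
Let homk_scale1 : left_id 1 homk_scale.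
Proof. by move=> f; apply: lin_ext => x /=; rewrite scale1r. Qed.
Let homk_scaleDr : right_distributive homk_scale +%R.
Proof. by move=> c f g; apply: lin_ext => x /=; rewrite scalerDr. Qed.
Let homk_scaleDl f : {morph homk_scale^~ f : c d / c + d}.
Proof. by move=> c d; apply: lin_ext => x /=; rewrite scalerDl. Qed.
HB.instance Definition _ := GRing.Zmodule_isLmodule.Build k homk_sort
  homk_scaleA homk_scale1 homk_scaleDr homk_scaleDl.
Definition homk : lmodType k := homk_sort.
End HomK.

Coercion homk_fun (k : comPzRingType) (M N : lmodType k) (f : homk M N) :
  {linear M -> N} := f.

Section KmodClosed.
Variable k : comPzRingType.
Implicit Types M N P : lmodType k.

Definition homk_map (M M' N N' : lmodType k) (f : {linear M' -> M})
    (g : {linear N -> N'}) (h : homk M N) : homk M' N' :=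
  (g \o (h : {linear M -> N}) \o f : {linear M' -> N'}).

Lemma homk_map_linear M M' N N' (f : {linear M' -> M}) (g : {linear N -> N'}) :
  linear (homk_map f g).
Proof. by move=> c h h'; apply: lin_ext => m; rewrite /= linearP. Qed.

Definition homk_mor M M' N N' (f : {linear M' -> M}) (g : {linear N -> N'}) :
  {linear homk M N -> homk M' N'} := mklin (homk_map_linear f g).

Lemma homk_mor_id M N : homk_mor (lin_id M) (lin_id N) = lin_id (homk M N).
Proof. by apply: lin_ext => h; apply: lin_ext. Qed.
Lemma homk_mor_comp M M' M'' N N' N'' (f : {linear M' -> M})
    (f' : {linear M'' -> M'}) (g : {linear N -> N'}) (g' : {linear N' -> N''}) :
  homk_mor (lin_comp f f') (lin_comp g' g) =
  lin_comp (homk_mor f' g') (homk_mor f g).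
Proof. by apply: lin_ext => h; apply: lin_ext. Qed.

Definition kmod_ihom : ihom_functor (Mod k) :=
  @IhomFunctor (Mod k) (@homk k) homk_mor homk_mor_id homk_mor_comp.

Lemma homk_i_linear M : linear (fun f : homk k^o M => f 1).
Proof. by []. Qed.
Definition homk_i M : {linear homk k^o M -> M} := mklin (@homk_i_linear M).

Lemma homk_j_linear M : linear (fun c : k^o => c *: (lin_id M : homk M M)).
Proof. by move=> c d e; rewrite scalerDl scalerA. Qed.
Definition homk_j M : {linear k^o -> homk M M} := mklin (@homk_j_linear M).

Definition homk_comp M N P (f : homk N P) (g : homk M N) : homk M P :=
  (f \o g : {linear M -> P}).
Lemma homk_comp_linearr M N P (f : homk N P) : linear (@homk_comp M N P f).
Proof. by move=> c g h; apply: lin_ext => m; rewrite /= linearP. Qed.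
Definition homk_postcomp M N P (f : homk N P) : homk (homk M N) (homk M P) :=
  mklin (homk_comp_linearr f).
Lemma homk_G_linear M N P : linear (@homk_postcomp M N P).
Proof. by move=> c f g; apply: lin_ext => h; apply: lin_ext. Qed.
Definition homk_G M N P :
    {linear homk N P -> homk (homk M N) (homk M P)} :=
  mklin (@homk_G_linear M N P).

Lemma homk_i_nat M N (f : {linear M -> N}) :
  lin_comp (homk_i N) (homk_mor (lin_id k^o) f) = lin_comp f (homk_i M).
Proof. exact: lin_ext. Qed.
Lemma homk_j_dinat M N (f : {linear M -> N}) :
  lin_comp (homk_mor (lin_id M) f) (homk_j M) =
  lin_comp (homk_mor f (lin_id N)) (homk_j N).
Proof. by apply: lin_ext => c; apply: lin_ext => m; rewrite /= linearZ. Qed.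
Lemma homk_G_nat M N N' P P' (f : {linear N' -> N}) (g : {linear P -> P'}) :
  lin_comp (homk_G M N' P') (homk_mor f g) =
  lin_comp (homk_mor (homk_mor (lin_id M) f) (homk_mor (lin_id M) g))
    (homk_G M N P).
Proof. by apply: lin_ext => h; apply: lin_ext => u; apply: lin_ext. Qed.
Lemma homk_G_dinat M M' N P (f : {linear M -> M'}) :
  lin_comp (homk_mor (homk_mor f (lin_id N)) (lin_id (homk M P)))
    (homk_G M N P) =
  lin_comp (homk_mor (lin_id (homk M' N)) (homk_mor f (lin_id P)))
    (homk_G M' N P).
Proof. by apply: lin_ext => h; apply: lin_ext => u; apply: lin_ext. Qed.
Lemma homk_ij : lin_comp (homk_i k^o) (homk_j k^o) = lin_id k^o.
Proof. by apply: lin_ext => c; rewrite /= [LHS]mulr1. Qed.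
Lemma homk_ijG M N :
  lin_comp (lin_comp (homk_i (homk M N))
    (homk_mor (homk_j M) (lin_id (homk M N)))) (homk_G M M N) =
  lin_id (homk M N).
Proof.
by apply: lin_ext => h; apply: lin_ext => m; rewrite /= scale1r.
Qed.
Lemma homk_Gj M N : lin_comp (homk_G M N N) (homk_j N) = homk_j (homk M N).
Proof. by apply: lin_ext => c; apply: lin_ext => u; apply: lin_ext. Qed.
Lemma homk_iG M N :
  lin_comp (homk_mor (lin_id (homk k^o M)) (homk_i N)) (homk_G k^o M N) =
  homk_mor (homk_i M) (lin_id N).
Proof. by apply: lin_ext => h; apply: lin_ext. Qed.
Lemma homk_GG M N P Q :
  lin_comp (lin_comp
    (homk_mor (homk_G M N P) (lin_id (homk (homk M N) (homk M Q))))
    (homk_G (homk M N) (homk M P) (homk M Q))) (homk_G M P Q) =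
  lin_comp (homk_mor (lin_id (homk N P)) (homk_G M N Q)) (homk_G N P Q).
Proof.
apply: lin_ext => h; apply: lin_ext => u; apply: lin_ext => v.
exact: lin_ext.
Qed.

Definition kmod_closed : @skew_closed (Mod k) k^o kmod_ihom :=
  @SkewClosed (Mod k) k^o kmod_ihom homk_i homk_j homk_G homk_i_nat
    homk_j_dinat homk_G_nat homk_G_dinat homk_ij homk_ijG homk_Gj homk_iG
    homk_GG.
End KmodClosed.

Section KmodMonoidal.
Variable k : comPzRingType.
Implicit Types M N P Q V : lmodType k.

Lemma tens_map_bilinear M M' N N' (f : {linear M -> M'}) (g : {linear N -> N'}) :
  bilinear_fun (fun m n => tens (f m) (g n)).
Proof.
by split=> [n c x y|m c x y]; rewrite linearP ?tensDl ?tensDr ?tensZl ?tensZr.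
Qed.
Definition tens_map M M' N N' (f : {linear M -> M'}) (g : {linear N -> N'}) :
  {linear tensor M N -> tensor M' N'} := tliftl (tens_map_bilinear f g).
Lemma tens_mapE M M' N N' (f : {linear M -> M'}) (g : {linear N -> N'}) m n :
  tens_map f g (tens m n) = tens (f m) (g n).
Proof. exact: tliftlE. Qed.

Lemma tens_lin_ext M N V (f g : {linear tensor M N -> V}) :
  (forall m n, f (tens m n) = g (tens m n)) -> f = g.
Proof. by move=> fg; apply/lin_ext/tens_ext. Qed.

Section Assoc.
Variables M N P : lmodType k.
Lemma tens_assoc_inner p :
  bilinear_fun (fun (m : M) (n : N) => tens m (tens n p) : tensor M (tensor N P)).
Proof.
by split=> [n c x y|m c x y]; rewrite ?(tensDl, tensZl, tensDr, tensZr).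
Qed.
Lemma tens_assoc_bilinear :
  bilinear_fun (fun (t : tensor M N) (p : P) => tliftl (tens_assoc_inner p) t).
Proof.
split=> [p c s t|t c p p']; first exact: linearP.
rewrite -[RHS]/(((c \*: tliftl (tens_assoc_inner p))
  \+ tliftl (tens_assoc_inner p')) t).
apply: tens_ext => m n; rewrite /= !(tlift_tens (tens_assoc_inner _)).
by rewrite !tensDr !tensZr.
Qed.
Definition tens_assoc :
    {linear tensor (tensor M N) P -> tensor M (tensor N P)} :=
  tliftl tens_assoc_bilinear.
Lemma tens_assocE m n p :
  tens_assoc (tens (tens m n) p) = tens m (tens n p).
Proof. by rewrite !tliftlE. Qed.

Lemma tens_assocV_inner (m : M) :
  bilinear_fun (fun (n : N) (p : P) => tens (tens m n : tensor M N) p).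
Proof.
by split=> [n c x y|n c x y]; rewrite ?(tensDl, tensZl, tensDr, tensZr).
Qed.
Lemma tens_assocV_bilinear :
  bilinear_fun (fun (m : M) (t : tensor N P) => tliftl (tens_assocV_inner m) t).
Proof.
split=> [t c m m'|m c s t]; last exact: linearP.
rewrite -[RHS]/(((c \*: tliftl (tens_assocV_inner m))
  \+ tliftl (tens_assocV_inner m')) t).
apply: tens_ext => n p; rewrite /= !(tlift_tens (tens_assocV_inner _)).
by rewrite !tensDl !tensZl.
Qed.
Definition tens_assocV :
    {linear tensor M (tensor N P) -> tensor (tensor M N) P} :=
  tliftl tens_assocV_bilinear.
Lemma tens_assocVE m n p :
  tens_assocV (tens m (tens n p)) = tens (tens m n) p.
Proof. by rewrite !tliftlE. Qed.
End Assoc.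

Lemma tens_ext3 M N P V (f g : {linear tensor (tensor M N) P -> V}) :
  (forall m n p, f (tens (tens m n) p) = g (tens (tens m n) p)) -> f = g.
Proof.
move=> fg; apply: tens_lin_ext => t p.
have lt (h : {linear tensor (tensor M N) P -> V}) :
  linear (fun t => h (tens t p)).
  by move=> c x y; rewrite tensDl tensZl linearP.
by apply: (@tens_ext _ _ _ _ (mklin (lt f)) (mklin (lt g))) => m n; apply: fg.
Qed.

Lemma tens_ext3' M N P V (f g : {linear tensor M (tensor N P) -> V}) :
  (forall m n p, f (tens m (tens n p)) = g (tens m (tens n p))) -> f = g.
Proof.
move=> fg; apply: tens_lin_ext => m t.
have lt (h : {linear tensor M (tensor N P) -> V}) :
  linear (fun t => h (tens m t)).
  by move=> c x y; rewrite tensDr tensZr linearP.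
by apply: (@tens_ext _ _ _ _ (mklin (lt f)) (mklin (lt g))) => n p; apply: fg.
Qed.

Lemma tens_ext4 M N P Q V (f g : {linear tensor (tensor (tensor M N) P) Q -> V}) :
  (forall m n p q, f (tens (tens (tens m n) p) q) =
    g (tens (tens (tens m n) p) q)) -> f = g.
Proof.
move=> fg; apply: tens_lin_ext => t q.
have lt (h : {linear tensor (tensor (tensor M N) P) Q -> V}) :
  linear (fun t => h (tens t q)).
  by move=> c x y; rewrite tensDl tensZl linearP.
have e : mklin (lt f) = mklin (lt g) by apply: tens_ext3 => m n p; apply: fg.
exact: (congr1 (fun h : {linear _ -> _} => h t) e).
Qed.

Lemma tens_lambda_bilinear M : bilinear_fun (fun (c : k^o) (m : M) => c *: m).
Proof.
split=> [m c x y|c d x y]; first by rewrite scalerDl scalerA.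
by rewrite scalerDr !scalerA mulrC.
Qed.
Definition tens_lambda M : {linear tensor k^o M -> M} :=
  tliftl (@tens_lambda_bilinear M).
Lemma tens_lambdaE M c (m : M) : tens_lambda M (tens c m) = c *: m.
Proof. exact: tliftlE. Qed.

Lemma tens_rho_linear M : linear (fun m : M => tens m (1 : k^o)).
Proof. by move=> c x y; rewrite tensDl tensZl. Qed.
Definition tens_rho M : {linear M -> tensor M k^o} := mklin (@tens_rho_linear M).
Lemma tens_rhoE M m : tens_rho M m = tens m (1 : k^o). Proof. by []. Qed.

Lemma tens_map_id M N : tens_map (lin_id M) (lin_id N) = lin_id (tensor M N).
Proof. by apply: tens_lin_ext => m n; rewrite tens_mapE !lin_idE. Qed.
Lemma tens_map_comp M M' M'' N N' N'' (f' : {linear M' -> M''})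
    (f : {linear M -> M'}) (g' : {linear N' -> N''}) (g : {linear N -> N'}) :
  tens_map (lin_comp f' f) (lin_comp g' g) =
  lin_comp (tens_map f' g') (tens_map f g).
Proof. by apply: tens_lin_ext => m n; rewrite !lin_compE !tens_mapE. Qed.
Lemma tens_assoc_nat M M' N N' P P' (f : {linear M -> M'}) (g : {linear N -> N'})
    (h : {linear P -> P'}) :
  lin_comp (tens_assoc M' N' P') (tens_map (tens_map f g) h) =
  lin_comp (tens_map f (tens_map g h)) (tens_assoc M N P).
Proof.
by apply: tens_ext3 => m n p; rewrite !lin_compE !(tens_mapE, tens_assocE).
Qed.
Lemma tens_lambda_nat M N (f : {linear M -> N}) :
  lin_comp (tens_lambda N) (tens_map (lin_id k^o) f) =
  lin_comp f (tens_lambda M).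
Proof.
by apply: tens_lin_ext => c m; rewrite !lin_compE tens_mapE !tens_lambdaE linearZ.
Qed.
Lemma tens_rho_nat M N (f : {linear M -> N}) :
  lin_comp (tens_rho N) f = lin_comp (tens_map f (lin_id k^o)) (tens_rho M).
Proof. by apply: lin_ext => m; rewrite !lin_compE tens_mapE. Qed.
Lemma tens_assoc_iso M N P : @is_iso (Mod k) _ _ (tens_assoc M N P).
Proof.
exists (tens_assocV M N P); split.
  by apply: tens_ext3 => m n p; rewrite !lin_compE tens_assocE tens_assocVE.
by apply: tens_ext3' => m n p; rewrite !lin_compE tens_assocVE tens_assocE.
Qed.
Lemma tens_lambda_iso M : @is_iso (Mod k) _ _ (tens_lambda M).
Proof.
have l : linear (fun m : M => tens (1 : k^o) m).
  by move=> c x y; rewrite tensDr tensZr.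
exists (mklin l); split.
  apply: tens_lin_ext => c m; rewrite !lin_compE tens_lambdaE.
  by rewrite lin_idE /= tensZr -tensZl [c *: _]mulr1.
by apply: lin_ext => m; rewrite !lin_compE tens_lambdaE scale1r.
Qed.
Lemma tens_rho_iso M : @is_iso (Mod k) _ _ (tens_rho M).
Proof.
have b : bilinear_fun (fun (m : M) (c : k^o) => c *: m).
  split=> [c d x y|m c x y]; first by rewrite scalerDr !scalerA mulrC.
  by rewrite scalerDl scalerA.
exists (tliftl b); split.
  apply: lin_ext => m; rewrite lin_compE.
  by rewrite [LHS](tlift_tens b) scale1r.
apply: tens_lin_ext => m c; rewrite lin_compE [tliftl b _](tlift_tens b).
by rewrite lin_idE /= tensZl -tensZr [c *: _]mulr1.
Qed.
Lemma tens_pentagon M N P Q :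
  lin_comp (tens_assoc M N (tensor P Q)) (tens_assoc (tensor M N) P Q) =
  lin_comp (lin_comp (tens_map (lin_id M) (tens_assoc N P Q))
    (tens_assoc M (tensor N P) Q)) (tens_map (tens_assoc M N P) (lin_id Q)).
Proof.
by apply: tens_ext4 => m n p q; rewrite !lin_compE !(tens_mapE, tens_assocE).
Qed.
Lemma tens_triangle M N :
  lin_comp (lin_comp (tens_map (lin_id M) (tens_lambda N)) (tens_assoc M k^o N))
    (tens_map (tens_rho M) (lin_id N)) = lin_id (tensor M N).
Proof.
apply: tens_lin_ext => m n.
by rewrite !lin_compE tens_mapE tens_rhoE tens_assocE tens_mapE tens_lambdaE scale1r.
Qed.

Definition kmod_monoidal : monoidal (Mod k) :=
  @Monoidal (Mod k) (fun M N => tensor M N : lmodType k) tens_map k^o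
    tens_assoc tens_lambda tens_rho
    tens_map_id tens_map_comp tens_assoc_nat tens_lambda_nat tens_rho_nat
    tens_assoc_iso tens_lambda_iso tens_rho_iso tens_pentagon tens_triangle.
End KmodMonoidal.

(* Sweedler notation: for t = \sum_i x_i (x) y_i in A (x) B, the sum of the
   E x_i y_i; it does not depend on the x_i and y_i when E is bilinear
   ([tlift_tcls]). *)
Definition sweedler (k : comPzRingType) (A B : algebra k) (V : nmodType)
    (t : tens_alg A B) (E : A -> B -> V) : V :=
  @tlift k (alg_mod A) (alg_mod B) V E t.

Notation "\sw_ ( x , y <- t ) E" := (sweedler t (fun x y => E))
  (at level 41, x name, y name, t at level 200, E at level 41,
   format "\sw_ ( x ,  y  <-  t )  E").
Notation atens A B a b := (@tens _ (alg_mod A) (alg_mod B) a b).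

Section Gabi.
Variables (k : comPzRingType) (A : algebra k).

(* With delta a = a_+ (x) a_-: p, q stand for a_+, a_-; pp, pm for a_++, a_+-;
   qp, qm for a_-+, a_--.  The casts [: A] move from A^op to A, so that the
   products are taken in A. *)
Record gabi := Gabi {
  g_eps : A -> k;
  g_delta : A -> tens_alg A (op_alg A);
  g_eps_hom : @alg_hom k A (base_alg k) g_eps;
  g_delta_hom : alg_hom g_delta;
  g_unit : forall a, \sw_(p, q <- g_delta a) (p * alg_map A (g_eps q)) = a;
  g_mult : forall a,
    \sw_(p, q <- g_delta a) (p * (q : A)) = alg_map A (g_eps a);
  g_assoc : forall a,
    \sw_(p, q <- g_delta a) \sw_(pp, pm <- g_delta p) \sw_(qp, qm <- g_delta q)
       @tens k (alg_mod A) (tensor (alg_mod A) (alg_mod A)) pp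
         (atens A A qp ((qm : A) * (pm : A))) =
    \sw_(p, q <- g_delta a)
       @tens k (alg_mod A) (tensor (alg_mod A) (alg_mod A)) p
         (atens A A q (1 : A)) }.

Variable G : gabi.
Local Notation eps := (g_eps G).
Local Notation delta := (g_delta G).

(* The unit object: k, with A acting via eps. *)
Definition gone_sort (_ : gabi) : Type := k^o.
HB.instance Definition _ := GRing.Zmodule.on (gone_sort G).
Definition gone_scale (a : A) (c : gone_sort G) : gone_sort G := eps a * c.

Lemma g_eps0 : eps 0 = 0.
Proof.
case: (g_eps_hom G) => l _ _; have := l 1 0 0.
by rewrite !scale1r addr0 -{1}[eps 0]addr0 => /addrI.
Qed.
Lemma g_eps_map c : eps (alg_map A c) = c.
Proof.
case: (g_eps_hom G) => l e1 _; have := l c 1 0.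
by rewrite !addr0 g_eps0 addr0 e1 !alg_scaleE !mulr1.
Qed.

Let epsD a b : eps (a + b) = eps a + eps b.
Proof.
case: (g_eps_hom G) => l _ _; have := l 1 a b; rewrite !scale1r; apply.
Qed.
Let eps1 : eps 1 = 1. Proof. by case: (g_eps_hom G). Qed.
Let epsM a b : eps (a * b) = eps a * eps b. Proof. by case: (g_eps_hom G). Qed.

Let gone_scaleA a b c : gone_scale a (gone_scale b c) = gone_scale (a * b) c.
Proof. by rewrite /gone_scale epsM mulrA. Qed.
Let gone_scale1 : left_id 1 gone_scale.
Proof. by move=> c; rewrite /gone_scale eps1 mul1r. Qed.
Let gone_scaleDr : right_distributive gone_scale +%R.
Proof. by move=> a c d; rewrite /gone_scale mulrDr. Qed.
Let gone_scaleDl c : {morph gone_scale^~ c : a b / a + b}.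
Proof. by move=> a b; rewrite /gone_scale epsD mulrDl. Qed.
HB.instance Definition _ := GRing.Zmodule_isLmodule.Build A (gone_sort G)
  gone_scaleA gone_scale1 gone_scaleDr gone_scaleDl.
Definition gone : lmodType A := gone_sort G.

Lemma res_act_scale (M : lmodType A) (c : k) (a : A) (m : res M) :
  (a *: ((c *: m : res M) : M) : res M) = c *: ((a *: (m : M)) : res M).
Proof. by rewrite res_scaleE [RHS]res_scaleE [LHS]scalerA [RHS]scalerA (alg_central c a). Qed.

Lemma res_alg_scale (M : lmodType A) (c : k) (a : alg_mod A) (m : M) :
  (((c *: a : alg_mod A) : A) *: m : res M) = c *: ((a : A) *: m : res M).
Proof. by rewrite res_scaleE alg_scaleE scalerA. Qed.

Lemma res_op_scale (M : lmodType A) (c : k) (a : alg_mod (op_alg A)) (m : M) :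
  (((c *: a : alg_mod (op_alg A)) : A) *: m : res M) =
  c *: ((a : A) *: m : res M).
Proof. by rewrite res_scaleE scalerA (alg_central c (a : A)). Qed.

(* The internal hom [M, N] = Hom_k(M, N) with (a.f)(m) = a_+ f(a_- m). *)
Section Ghom.
Variables M N : lmodType A.
Implicit Types f g : homk (res M) (res N).

Definition gact_fun (t : tens_alg A (op_alg A)) f (m : res M) : res N :=
  \sw_(p, q <- t) ((p *: (f ((q : A) *: (m : M) : res M) : N)) : res N).

Lemma gact_linear t f : linear (gact_fun t f).
Proof.
move=> c m n; rewrite /gact_fun /sweedler /tlift scaler_sumr -big_split /=.
apply: eq_bigr => p _.
by rewrite [X in f X]scalerDr res_act_scale linearP scalerDr res_act_scale.
Qed.

Definition gact t f : homk (res M) (res N) := mklin (gact_linear t f).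

Lemma gact_bilinear f (m : res M) :
  @bilinear_fun k (alg_mod A) (alg_mod (op_alg A)) (res N)
    (fun (p : A) (q : op_alg A) =>
      (p *: (f ((q : A) *: (m : M) : res M) : N)) : res N).
Proof.
split=> [q c x y|p c x y].
  by rewrite [LHS]scalerDl res_alg_scale.
by rewrite [X in f X]scalerDl res_op_scale linearP [LHS]scalerDr res_act_scale.
Qed.

Lemma gact_tens (a b : A) f (m : res M) :
  gact (atens A (op_alg A) a b) f m = a *: (f (b *: (m : M) : res M) : N).
Proof. exact: (tlift_tens (gact_bilinear f m)). Qed.

Lemma gact_lin t f (m : res M) : gact t f m = tliftl (gact_bilinear f m) t.
Proof. by []. Qed.

Lemma gactDl s t f : gact (s + t) f = gact s f + gact t f.
Proof. by apply: lin_ext => m; exact: (linearD (tliftl (gact_bilinear f m)) s t). Qed.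

Lemma gact0l f : gact 0 f = 0.
Proof. by apply: lin_ext => m; exact: (linear0 (tliftl (gact_bilinear f m))). Qed.

Lemma gactDr t f g : gact t (f + g) = gact t f + gact t g.
Proof.
apply: lin_ext => m; rewrite /= /gact_fun /sweedler /tlift -big_split /=.
by apply: eq_bigr => p _; rewrite scalerDr.
Qed.

Lemma gact1 f : gact 1 f = f.
Proof.
apply: lin_ext => m; rewrite [1]/(atens A (op_alg A) 1 1) gact_tens.
by rewrite !scale1r.
Qed.

Lemma gactM s t f : gact (s * t) f = gact s (gact t f).
Proof.
elim/tensor_ind: s => [a b|s s' hs hs'|]; last by rewrite mul0r !gact0l.
  2: by rewrite mulrDl !gactDl hs hs'.
elim/tensor_ind: t => [a' b'|t t' ht ht'|].
- apply: lin_ext => m; rewrite -[_ * _]/(tens_mul _ _) tens_mulE !gact_tens.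
  by rewrite !scalerA.
- by rewrite mulrDr !gactDl gactDr ht ht'.
- rewrite mulr0 !gact0l; apply: lin_ext => m; rewrite gact_tens.
  by rewrite [RHS]scaler0.
Qed.

Definition ghom_sort : Type := homk (res M) (res N).
HB.instance Definition _ := GRing.Zmodule.on ghom_sort.
Definition ghom_scale (a : A) (f : ghom_sort) : ghom_sort := gact (delta a) f.

Let deltaD a b : delta (a + b) = delta a + delta b.
Proof.
case: (g_delta_hom G) => l _ _; have := l 1 a b; rewrite !scale1r; apply.
Qed.
Let delta1 : delta 1 = 1. Proof. by case: (g_delta_hom G). Qed.
Let deltaM a b : delta (a * b) = delta a * delta b.
Proof. by case: (g_delta_hom G). Qed.

Let ghom_scaleA a b f : ghom_scale a (ghom_scale b f) = ghom_scale (a * b) f.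
Proof. by rewrite /ghom_scale deltaM gactM. Qed.
Let ghom_scale1 : left_id 1 ghom_scale.
Proof. by move=> f; rewrite /ghom_scale delta1 gact1. Qed.
Let ghom_scaleDr : right_distributive ghom_scale +%R.
Proof. by move=> a f g; apply: gactDr. Qed.
Let ghom_scaleDl f : {morph ghom_scale^~ f : a b / a + b}.
Proof. by move=> a b; rewrite /ghom_scale deltaD gactDl. Qed.
HB.instance Definition _ := GRing.Zmodule_isLmodule.Build A ghom_sort
  ghom_scaleA ghom_scale1 ghom_scaleDr ghom_scaleDl.
Definition ghom : lmodType A := ghom_sort.
End Ghom.

Lemma ghom_scaleE (M N : lmodType A) (a : A) (f : ghom M N) :
  a *: f = gact (delta a) (f : homk (res M) (res N)) :> ghom M N.
Proof. by []. Qed.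

Lemma res_ghom_scaleE (M N : lmodType A) (c : k) (f : res (ghom M N)) :
  c *: f = c *: (f : homk (res M) (res N)).
Proof.
rewrite res_scaleE ghom_scaleE; case: (g_delta_hom G) => l d1 _.
have l0 : delta 0 = 0.
  have := l 1 0 0; rewrite !scale1r addr0 -{1}[delta 0]addr0.
  by move/addrI.
have -> : delta (alg_map A c) = c *: (1 : alg_mod (tens_alg A (op_alg A))).
  by have := l c 1 0; rewrite l0 !addr0 d1 alg_scaleE mulr1.
have -> : c *: (1 : alg_mod (tens_alg A (op_alg A))) =
    atens A (op_alg A) (alg_map A c) (1 : A).
  by rewrite alg_scaleE mulr1.
by apply: lin_ext => m; rewrite gact_tens scale1r.
Qed.

Lemma sweedler_scale (B C : algebra k) (M : lmodType A) (t : tens_alg B C)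
  (E : B -> C -> A) (m : M) :
  (\sw_(p, q <- t) E p q) *: m = \sw_(p, q <- t) (E p q *: m).
Proof. exact: scaler_suml. Qed.

Section GhomMap.
Variables (M M' N N' : lmodType A) (f : {linear M' -> M}) (g : {linear N -> N'}).
Definition ghom_map (h : ghom M N) : ghom M' N' :=
  homk_map (res_mor f) (res_mor g) (h : homk (res M) (res N)).
Lemma ghom_map_linear : linear ghom_map.
Proof.
move=> a h h'; rewrite !ghom_scaleE; apply: lin_ext => m.
rewrite /= linearD; congr (_ + _).
rewrite /gact_fun /sweedler /tlift [LHS](linear_sum g).
by apply: eq_bigr => p _; rewrite /= !linearZ.
Qed.
Definition ghom_mor : {linear ghom M N -> ghom M' N'} := mklin ghom_map_linear.
End GhomMap.

Lemma ghom_mor_id M N : ghom_mor (lin_id M) (lin_id N) = lin_id (ghom M N).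
Proof. by apply: lin_ext => h; apply: lin_ext. Qed.
Lemma ghom_mor_comp (M M' M'' N N' N'' : lmodType A) (f : {linear M' -> M})
    (f' : {linear M'' -> M'}) (g : {linear N -> N'}) (g' : {linear N' -> N''}) :
  ghom_mor (lin_comp f f') (lin_comp g' g) =
  lin_comp (ghom_mor f' g') (ghom_mor f g).
Proof. by apply: lin_ext => h; apply: lin_ext. Qed.

Definition gabi_ihom : ihom_functor (Mod A) :=
  @IhomFunctor (Mod A) ghom ghom_mor ghom_mor_id ghom_mor_comp.

Lemma ghom_i_linear (M : lmodType A) :
  linear (fun f : ghom gone M => (f : homk (res gone) (res M)) (1 : k) : M).
Proof.
move=> a f g; rewrite ghom_scaleE /=; congr (_ + _).
rewrite /gact_fun -[a in RHS](g_unit G) sweedler_scale.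
apply: eq_bigr => p _; rewrite -scalerA; congr (_ *: _).
rewrite -[RHS]/(eps p.2 *: ((f : homk (res gone) (res M)) (1 : k))) -linearZ.
congr ((f : homk (res gone) (res M)) _).
rewrite res_scaleE -[LHS]/(eps p.2 * 1).
by rewrite -[RHS]/(eps (alg_map A (eps p.2)) * 1) g_eps_map.
Qed.
Definition ghom_i (M : lmodType A) : {linear ghom gone M -> M} :=
  mklin (@ghom_i_linear M).

Lemma ghom_j_linear (M : lmodType A) :
  linear (fun c : gone => ((c : k) *: (lin_id (res M) : homk (res M) (res M)))
    : ghom M M).
Proof.
move=> a c d; rewrite ghom_scaleE; apply: lin_ext => m.
rewrite -[LHS]/((eps a * (c : k) + d) *: m) scalerDl; congr (_ + _).
rewrite mulrC -scalerA [eps a *: m]res_scaleE -g_mult sweedler_scale.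
rewrite /sweedler /tlift /= [LHS](scaler_sumr (V := res M)).
by apply: eq_bigr => p _; rewrite -[X in c *: X]scalerA -res_act_scale.
Qed.
Definition ghom_j (M : lmodType A) : {linear gone -> ghom M M} :=
  mklin (@ghom_j_linear M).

Lemma homk_sumE (M N : lmodType k) (I : Type) (r : seq I) (F : I -> homk M N) m :
  (\sum_(i <- r) F i : homk M N) m = \sum_(i <- r) F i m.
Proof. by elim: r => [|i r ih]; rewrite ?big_nil ?big_cons //= -ih. Qed.

Section GhomG.
Variables M N P : lmodType A.
Lemma ghom_postcomp_linear (f : ghom N P) :
  linear (fun g : res (ghom M N) =>
    homk_comp (f : homk (res N) (res P)) (g : homk (res M) (res N))
    : res (ghom M P)).
Proof.
move=> c g h; rewrite !res_ghom_scaleE.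
exact: (@homk_comp_linearr _ (res M) (res N) (res P) f c g h).
Qed.
Definition ghom_postcomp (f : ghom N P) : ghom (ghom M N) (ghom M P) :=
  mklin (ghom_postcomp_linear f).

Section Contract.
Variables (f : homk (res N) (res P)) (g : homk (res M) (res N)) (m : res M).
Lemma contract_inner_bilinear :
  @bilinear_fun k (alg_mod A) (alg_mod A) (res N)
    (fun (y z : A) => y *: (g (z *: (m : M) : res M) : N) : res N).
Proof.
split=> [z c x y|y c x z].
  by rewrite [LHS]scalerDl res_alg_scale.
by rewrite [X in g X]scalerDl res_alg_scale linearP [LHS]scalerDr res_act_scale.
Qed.
Lemma contract_bilinear :
  @bilinear_fun k (alg_mod A) (tensor (alg_mod A) (alg_mod A)) (res P)
    (fun (x : A) t => x *: (f (tliftl contract_inner_bilinear t) : P) : res P).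
Proof.
split=> [t c x y|x c s t]; first by rewrite [LHS]scalerDl res_alg_scale.
by rewrite !linearP [LHS]scalerDr res_act_scale.
Qed.
Definition contract := tliftl contract_bilinear.
Lemma contractE (x y z : A) :
  contract (@tens k (alg_mod A) (tensor (alg_mod A) (alg_mod A)) x
    (atens A A y z)) =
  x *: (f (y *: (g (z *: (m : M) : res M) : N) : res N) : P).
Proof. by rewrite [LHS](tlift_tens contract_bilinear) (tliftlE contract_inner_bilinear). Qed.
End Contract.

Lemma ghom_G_linear : linear ghom_postcomp.
Proof.
move=> a f f'; rewrite !ghom_scaleE.
apply: lin_ext => g; apply: lin_ext => m /=; congr (_ + _).
have := congr1 (contract f g m) (g_assoc G a).
rewrite /sweedler [X in X = _ -> _](linear_sum (contract f g m)).
rewrite [X in _ = X -> _](linear_sum (contract f g m)).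
under [in X in _ = X -> _]eq_bigr => p _ do rewrite contractE scale1r.
move=> E; apply: etrans; first exact: (esym E).
rewrite /gact_fun /sweedler /tlift.
rewrite (homk_sumE _ (fun p : alg_mod A * alg_mod (op_alg A) =>
  ghom_scale (p.1 : A) (ghom_postcomp f (ghom_scale (p.2 : A) g)))).
apply: eq_bigr => p _.
rewrite (linear_sum (contract f g m)); apply: eq_bigr => q _.
rewrite (linear_sum (contract f g m)).
transitivity ((q.1 : A) *: ((f : homk (res N) (res P))
  (\sum_(r <- trepr (delta p.2)) ((r.1 : A) *: ((g : homk (res M) (res N))
    ((r.2 : A) *: (((q.2 : A) *: (m : M)) : M)) : N) : res N)) : P)); last by [].
rewrite linear_sum [RHS]scaler_sumr; apply: eq_bigr => r _.
by rewrite contractE scalerA.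
Qed.
Definition ghom_G : {linear ghom N P -> ghom (ghom M N) (ghom M P)} :=
  mklin ghom_G_linear.
End GhomG.

Lemma ghom_i_nat (M N : lmodType A) (f : {linear M -> N}) :
  lin_comp (ghom_i N) (ghom_mor (lin_id gone) f) = lin_comp f (ghom_i M).
Proof. exact: lin_ext. Qed.
Lemma ghom_j_dinat (M N : lmodType A) (f : {linear M -> N}) :
  lin_comp (ghom_mor (lin_id M) f) (ghom_j M) =
  lin_comp (ghom_mor f (lin_id N)) (ghom_j N).
Proof.
apply: lin_ext => c; apply: lin_ext => m.
have := linearP (res_mor f) (c : k) m 0; rewrite linear0 !addr0; exact.
Qed.
Lemma ghom_G_nat (M N N' P P' : lmodType A) (f : {linear N' -> N})
    (g : {linear P -> P'}) :
  lin_comp (ghom_G M N' P') (ghom_mor f g) =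
  lin_comp (ghom_mor (ghom_mor (lin_id M) f) (ghom_mor (lin_id M) g))
    (ghom_G M N P).
Proof. by apply: lin_ext => h; apply: lin_ext => u; apply: lin_ext. Qed.
Lemma ghom_G_dinat (M M' N P : lmodType A) (f : {linear M -> M'}) :
  lin_comp (ghom_mor (ghom_mor f (lin_id N)) (lin_id (ghom M P)))
    (ghom_G M N P) =
  lin_comp (ghom_mor (lin_id (ghom M' N)) (ghom_mor f (lin_id P)))
    (ghom_G M' N P).
Proof. by apply: lin_ext => h; apply: lin_ext => u; apply: lin_ext. Qed.
Lemma ghom_ij : lin_comp (ghom_i gone) (ghom_j gone) = lin_id gone.
Proof.
apply: lin_ext => c.
rewrite -[LHS]/(((c : k) *: ((1 : k) : res gone)) : gone).
by rewrite res_scaleE -[LHS]/(eps (alg_map A c) * 1) mulr1 g_eps_map.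
Qed.
Lemma ghom_ijG M N :
  lin_comp (lin_comp (ghom_i (ghom M N))
    (ghom_mor (ghom_j M) (lin_id (ghom M N)))) (ghom_G M M N) =
  lin_id (ghom M N).
Proof.
by apply: lin_ext => h; apply: lin_ext => m; rewrite /= scale1r.
Qed.
Lemma ghom_Gj M N : lin_comp (ghom_G M N N) (ghom_j N) = ghom_j (ghom M N).
Proof.
apply: lin_ext => c; apply: lin_ext => u; apply: lin_ext => m.
by rewrite -[RHS]/(((c : k) *: (u : res (ghom M N)) : homk _ _) m) res_ghom_scaleE.
Qed.
Lemma ghom_iG M N :
  lin_comp (ghom_mor (lin_id (ghom gone M)) (ghom_i N)) (ghom_G gone M N) =
  ghom_mor (ghom_i M) (lin_id N).
Proof. by apply: lin_ext => h; apply: lin_ext. Qed.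
Lemma ghom_GG M N P Q :
  lin_comp (lin_comp
    (ghom_mor (ghom_G M N P) (lin_id (ghom (ghom M N) (ghom M Q))))
    (ghom_G (ghom M N) (ghom M P) (ghom M Q))) (ghom_G M P Q) =
  lin_comp (ghom_mor (lin_id (ghom N P)) (ghom_G M N Q)) (ghom_G N P Q).
Proof.
apply: lin_ext => h; apply: lin_ext => u; apply: lin_ext => v.
exact: lin_ext.
Qed.

Definition gabi_closed : @skew_closed (Mod A) gone gabi_ihom :=
  @SkewClosed (Mod A) gone gabi_ihom ghom_i ghom_j ghom_G ghom_i_nat
    ghom_j_dinat ghom_G_nat ghom_G_dinat ghom_ij ghom_ijG ghom_Gj ghom_iG
    ghom_GG.

End Gabi.

Definition normal_gabi (k : comPzRingType) (A : algebra k) : Type :=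
  {G : gabi A | normal (gabi_closed G)}.

Section Hopf.
Variables (k : comPzRingType) (A : algebra k).

Record bialgebra := Bialgebra {
  b_eps : A -> k;
  b_delta : A -> tens_alg A A;
  b_eps_hom : @alg_hom k A (base_alg k) b_eps;
  b_delta_hom : alg_hom b_delta;
  b_counitl : forall a,
    \sw_(x, y <- b_delta a) (alg_map A (b_eps x) * y) = a;
  b_counitr : forall a,
    \sw_(x, y <- b_delta a) (x * alg_map A (b_eps y)) = a;
  b_coassoc : forall a,
    \sw_(x, y <- b_delta a) \sw_(x1, x2 <- b_delta x)
       @tens k (alg_mod A) (tensor (alg_mod A) (alg_mod A)) x1
         (atens A A x2 y) =
    \sw_(x, y <- b_delta a) \sw_(y1, y2 <- b_delta y)
       @tens k (alg_mod A) (tensor (alg_mod A) (alg_mod A)) x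
         (atens A A y1 y2) }.

Definition is_antipode (B : bialgebra) (S : A -> A) : Prop :=
  [/\ linear (S : alg_mod A -> alg_mod A),
      forall a, \sw_(x, y <- b_delta B a) (S x * y) = alg_map A (b_eps B a) &
      forall a, \sw_(x, y <- b_delta B a) (x * S y) = alg_map A (b_eps B a)].

Definition hopf_structure : Type :=
  {B : bialgebra | exists S : A -> A, is_antipode B S}.
End Hopf.

(* Main.v *)
Require Import Defs.
From HB Require Import structures.
From mathcomp Require Import all_boot all_algebra.
From mathcomp Require Import boolp.

Set Implicit Arguments.
Unset Strict Implicit.
Unset Printing Implicit Defensive.

Import GRing.Theory.
Local Open Scope ring_scope.

(** Why the theorem holds. Write a_1 (x) a_2 for a comultiplication of A and
   a_+ (x) a_- for the map delta of a gabi-algebra. The two structures are linked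
   by the Galois map beta (a (x) b) = a_1 (x) a_2 b and the map
   gamma (a (x) b) = a_+ (x) a_- b on A (x) A: a gabi-algebra and a bialgebra with
   the same counit correspond to each other when beta and gamma are mutually
   inverse ([corresponds]). Both identities have a categorical meaning. That beta
   gamma = id says that m |-> (n |-> m (x) n) is A-linear, and gamma beta = id says
   that evaluation is A-linear: together, that Hom_k (N, -) is right adjoint to
   - (x) N over A. A bialgebra has at most one such delta, and then
   delta a = a_1 (x) S(a_2) with S the antipode ([translation_unique],
   [translation_antipodeP]); conversely delta determines the comultiplication
   ([bialgebra_unique]).

   From Hopf to gabi: the axioms of a gabi-algebra are verified by applying beta or
   gamma, which are injective ([translation_gabi]). The diagonal action makes the
   A-modules a monoidal category ([diag_monoidal]), closed by the adjunction above
   and by Hom_A (X (x) A, -) on the other side. A closed structure that corresponds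
   to a closed monoidal one is always normal ([closed_monoidal_normal]): the
   canonical map out of the coend sends (f, g) to the double mate of a composite of
   the mates of f and g, and taking mates is bijective.

   From gabi to Hopf: normality is used with the free module A in the first
   variable, where it says that k-linear maps X -> Hom_k (Y, Z) are classes of
   pairs of a k-linear map V -> Z and an A-linear map X -> [Y, V]. Existence
   embeds X (x) Y in an A-module ([tensor_embedding]), and uniqueness shows that A
   acts on the image of X (x) Y, in one and the same way on all values of A-linear
   maps into internal homs ([act_ev]). For X = Y = A, the action on 1 (x) 1 is the
   comultiplication. Its counit laws, its coassociativity and the two identities for
   beta and gamma are the A-linearity of j and of the inverse of i, of Gamma, and of
   the universal maps ([normal_lifted_translation]). This argument sees the internal
   hom only through a k-linear bijection with Hom_k, so it applies equally to
   gabi-algebras and to arbitrary closed structures with a strict forgetful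
   functor, and proves both formulations. *)

(** * Closed monoidal categories are normal-closed *)

(** The adjunction enters through its unit coev and counit ev only, so that the
   results apply both to the internal hom built from chosen right adjoints and to
   the internal hom of a gabi-algebra. *)
Section ClosedMonoidalNormal.
Variables (C : category) (M : monoidal C) (H : ihom_functor C).
Variables (coev : forall X Y, mor Y (H X (mten M Y X)))
  (ev : forall X Y, mor (mten M (H X Y) X) Y).
Local Notation "X \ox Y" := (mten M X Y) (at level 40, left associativity).
Local Notation "f \om g" := (mtenm M f g) (at level 40, left associativity).
Local Notation "[[ f ,- Y ]]" := (imor H f (idm Y)).
Local Notation "[[ X -, g ]]" := (imor H (idm X) g).

Hypothesis coev_nat : forall X Y Y' (f : mor Y Y'),
  [[X -, f \om idm X]] \c coev X Y = coev X Y' \c f.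
Hypothesis coev_dinat : forall X X' Y (f : mor X X'),
  [[X -, idm Y \om f]] \c coev X Y = [[f ,- Y \ox X']] \c coev X' Y.
Hypothesis ev_nat : forall X Y Y' (g : mor Y Y'),
  ev X Y' \c ([[X -, g]] \om idm X) = g \c ev X Y.
Hypothesis ev_coev : forall X Y, ev X (Y \ox X) \c (coev X Y \om idm X) = idm _.
Hypothesis coev_ev : forall X Y, [[X -, ev X Y]] \c coev X (H X Y) = idm _.

Variable S : skew_closed (mone M) H.
Hypothesis S_G : forall X Y Z,
  [[Y -, [[Z -, malpha M X Y Z]] ]] \c [[Y -, coev Z (X \ox Y)]] \c coev Y X =
  [[coev Z Y ,- H Z (X \ox (Y \ox Z))]]
    \c sc_G S Z (Y \ox Z) (X \ox (Y \ox Z)) \c coev (Y \ox Z) X.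
Hypothesis S_j : forall X, [[X -, mlambda M X]] \c coev X (mone M) = sc_j S X.
Hypothesis S_i : forall X, mrho M X = sc_i S (X \ox mone M) \c coev (mone M) X.

Let cur U X Y (f : mor (U \ox X) Y) : mor U (H X Y) := [[X -, f]] \c coev X U.
Let unc U X Y (g : mor U (H X Y)) : mor (U \ox X) Y := ev X Y \c (g \om idm X).

Let imor_split X X' Y Y' (f : mor X' X) (g : mor Y Y') :
  imor H f g = [[f ,- Y']] \c [[X -, g]].
Proof. by rewrite -imor_comp !comp_idl. Qed.
Let imor_split' X X' Y Y' (f : mor X' X) (g : mor Y Y') :
  imor H f g = [[X' -, g]] \c [[f ,- Y]].
Proof. by rewrite -imor_comp !comp_idr. Qed.
Let imor_r X Y Y' Y'' (g : mor Y Y') (g' : mor Y' Y'') :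
  [[X -, g' \c g]] = [[X -, g']] \c [[X -, g]].
Proof. by rewrite -imor_comp comp_idl. Qed.
Let imor_l X X' X'' Y (f : mor X' X) (f' : mor X'' X') :
  [[f \c f' ,- Y]] = [[f' ,- Y]] \c [[f ,- Y]].
Proof. by rewrite -imor_comp comp_idl. Qed.
Let mten_r U X Y Z (g : mor Y Z) (f : mor X Y) :
  (g \c f) \om idm U = (g \om idm U) \c (f \om idm U).
Proof. by rewrite -mtenm_comp comp_idl. Qed.

Let curK U X Y (f : mor (U \ox X) Y) : unc (cur f) = f.
Proof.
by rewrite /unc /cur mten_r comp_assoc ev_nat -comp_assoc ev_coev comp_idr.
Qed.
Let uncK U X Y (g : mor U (H X Y)) : cur (unc g) = g.
Proof.
by rewrite /unc /cur imor_r -comp_assoc coev_nat comp_assoc coev_ev comp_idl.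
Qed.

Let cur_l U V W Z (F : mor (U \ox W) Z) (v : mor V W) :
  cur (F \c (idm U \om v)) = [[v ,- Z]] \c cur F.
Proof.
rewrite /cur imor_r -comp_assoc coev_dinat !comp_assoc.
by congr (_ \c _); rewrite -imor_split -imor_split'.
Qed.
Let unc_r U Y V W (v : mor V W) (g : mor U (H Y V)) :
  unc ([[Y -, v]] \c g) = v \c unc g.
Proof. by rewrite /unc mten_r !comp_assoc ev_nat. Qed.

(** The map in question sends f to the mate of f \c mlambda X. *)
Lemma closed_left_normal : left_normal S.
Proof.
move=> X Y; have [l [lK Kl] ] := mlambda_iso M X.
have E f : [[f ,- Y]] \c sc_j S Y = cur (f \c mlambda M X).
  rewrite -S_j comp_assoc -imor_split imor_split' -comp_assoc -coev_dinat.
  by rewrite comp_assoc -imor_r mlambda_nat.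
exists (fun g => unc g \c l) => [f | g]; rewrite E.
  by rewrite curK -comp_assoc Kl comp_idr.
by rewrite -comp_assoc lK comp_idr uncK.
Qed.

(** Composing with i sends g to its mate composed with mrho, so the mate of the
   inverse of mrho is inverse to i. *)
Lemma closed_right_normal : right_normal S.
Proof.
have E W Y (g : mor W (H (mone M) Y)) : sc_i S Y \c g = unc g \c mrho M W.
  by rewrite -{1}[g]uncK /cur comp_assoc sc_i_nat -comp_assoc -S_i.
move=> X; have [r [rK Kr] ] := mrho_iso M X.
have iK : sc_i S X \c cur r = idm X by rewrite E curK.
exists (cur r); split=> //.
have [r' [_ Kr'] ] := mrho_iso M (H (mone M) X).
have inj g g' : sc_i S X \c g = sc_i S X \c g' -> g = g' :> mor (H (mone M) X) _.
  move=> /(congr1 (fun h => cur (h \c r'))).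
  by rewrite !E -!comp_assoc Kr' !comp_idr !uncK.
by apply: inj; rewrite comp_assoc iK comp_idl comp_idr.
Qed.

Let hat U X Y Z (p : coend_elt H U X Y Z) : mor (U \ox (X \ox Y)) Z :=
  let: existT V (f, g) := p in unc f \c (idm U \om unc g).

(** The canonical map sends (f, g) to the double mate of the composite of
   the mates of f and g, reassociated; mates being bijective, it separates
   coend classes as soon as this composite does. *)
Let coend_mapE U X Y Z (p : coend_elt H U X Y Z) :
  coend_map S p = cur (cur (hat p \c malpha M U X Y)).
Proof.
case: p => V [f g]; rewrite /coend_map /hat.
set fh := unc f; set gh := unc g.
have ef : f = [[V -, fh]] \c coev V U by rewrite -[f]uncK.
have eg : g = [[Y -, gh]] \c coev Y X by rewrite -[g]uncK.
set k := fh \c (idm U \om gh).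
have glue : [[gh ,- Z]] \c f = [[X \ox Y -, k]] \c coev (X \ox Y) U.
  rewrite ef comp_assoc -imor_split imor_split' -comp_assoc -coev_dinat.
  by rewrite comp_assoc -imor_r.
have G_l : [[ [[Y -, gh]] ,- H Y Z]] \c sc_G S Y V Z =
    sc_G S Y (X \ox Y) Z \c [[gh ,- Z]].
  by have := sc_G_nat S Y gh (idm Z); rewrite imor_id.
have G_r : sc_G S Y (X \ox Y) Z \c [[X \ox Y -, k]] =
    [[ H Y (X \ox Y) -, [[Y -, k]] ]] \c sc_G S Y (X \ox Y) (U \ox (X \ox Y)).
  by have := sc_G_nat S Y (idm (X \ox Y)) k; rewrite imor_id.
rewrite {1}eg imor_l -[X in X \c f]comp_assoc G_l -!comp_assoc glue.
rewrite [X in _ \c X]comp_assoc G_r -comp_assoc [LHS]comp_assoc -imor_split.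
rewrite imor_split' -comp_assoc [X in _ \c X]comp_assoc -S_G.
by rewrite /cur !imor_r -!comp_assoc.
Qed.

(** Sliding the mate of g across the coend brings (f, g) to the form
   (mate of hat (f, g), coev), so hat is a complete invariant. *)
Lemma closed_assoc_normal : assoc_normal S.
Proof.
move=> U X Y Z; have [a [aK Ka] ] := malpha_iso M U X Y; split; last first.
  move=> h; exists (coend_mk (cur (unc (unc h) \c a)) (coev Y X)).
  rewrite coend_mapE /= curK -{1}[coev Y X]comp_idl -(imor_id H) curK.
  by rewrite mtenm_id comp_idr -comp_assoc aK comp_idr !uncK.
have norm (p : coend_elt H U X Y Z) :
    coend_eq p (coend_mk (cur (hat p)) (coev Y X)).
  case: p => V [f g] /=; set gh := unc g.
  rewrite cur_l uncK.
  apply: coend_trans (coend_sym (coend_glue gh f (coev Y X))).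
  by rewrite -/(cur gh) uncK; apply: coend_refl.
move=> p q; rewrite !coend_mapE; split=> [ | E]; last first.
  apply: coend_trans (norm p) _.
  have -> : hat p = hat q; last exact/coend_sym/norm.
  have := congr1 (fun h => unc (unc h) \c a) E.
  by rewrite !curK -!comp_assoc Ka !comp_idr.
elim=> {p q} [V W v f g|//|p q _ ->//|p q r _ -> _ -> //].
have e : unc ([[v ,- Z]] \c f) = unc f \c (idm U \om v).
  by rewrite -[f in LHS]uncK -cur_l curK.
by rewrite /= e unc_r tens_left_comp !comp_assoc.
Qed.

Theorem closed_monoidal_normal : normal S.
Proof.
split; first exact: closed_left_normal.
by split; [exact: closed_right_normal | exact: closed_assoc_normal].
Qed.
End ClosedMonoidalNormal.

(** * Modules given by an action, and strict equality of modules *)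

Section ActionModule.
Variables (R : pzRingType) (T : zmodType) (act : R -> T -> T).
Record is_action : Prop := IsAction {
  actA : forall a b t, act a (act b t) = act (a * b) t;
  act1 : left_id 1 act;
  actDr : right_distributive act +%R;
  actDl : forall t, {morph act^~ t : a b / a + b} }.
Variable h : is_action.
(** An alias of T that carries the proof, so that each action on T gets its own
   module structure. *)
Definition act_sort (_ : is_action) : Type := T.
HB.instance Definition _ := GRing.Zmodule.on (act_sort h).
HB.instance Definition _ := GRing.Zmodule_isLmodule.Build R (act_sort h)
  (actA h) (act1 h) (actDr h) (actDl h).
Definition act_mod : lmodType R := act_sort h.
End ActionModule.

(** A strict functor must preserve objects up to equality of modules. Here the
   two sides share the additive group but their scalar actions agree only
   pointwise; the transport along the resulting equality still fixes every
   element, which reduces each strictness law to an elementwise check. *)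
Lemma lmod_scale_eq (k : comPzRingType) T o z a b c d e f g
    (m1 m2 : GRing.Nmodule_isLSemiModule.axioms_ k T z a c d e f g) :
  (forall x t, GRing.Nmodule_isLSemiModule.scale m1 x t =
    GRing.Nmodule_isLSemiModule.scale m2 x t) ->
  exists E :
    @GRing.Lmodule.Pack k T (@GRing.Lmodule.Class k T o z a b c d e f g m1) =
    @GRing.Lmodule.Pack k T (@GRing.Lmodule.Class k T o z a b c d e f g m2),
    forall x : T, (@eqm (Mod k) _ _ E : {linear _ -> _}) x = x.
Proof.
case: m1 m2 => s1 A1 B1 C1 D1 F1 [s2 A2 B2 C2 D2 F2] /= ss.
have es : s1 = s2 by apply: funext => x; apply: funext.
case: _ / es A2 B2 C2 D2 F2 {ss} => A2 B2 C2 D2 F2.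
rewrite (Prop_irrelevance A1 A2) (Prop_irrelevance B1 B2) (Prop_irrelevance C1 C2).
rewrite (Prop_irrelevance D1 D2) (Prop_irrelevance F1 F2).
by exists erefl.
Qed.

Section ResAct.
Variables (k : comPzRingType) (A : algebra k).
Lemma res_act_mod (N : lmodType k) (act : A -> N -> N) (h : is_action act) :
  (forall c n, act (alg_map A c) n = c *: n) ->
  exists E : res (act_mod h) = N,
    forall x : N, (@eqm (Mod k) _ _ E : {linear _ -> _}) x = x.
Proof.
case: N act h => T [o z a b c d e f g m] act h H.
by apply: (@lmod_scale_eq _ _ _ _ _ _ _ _ _ _ _ _ m).
Qed.
Lemma res_ghom_eq (G : gabi A) (M N : lmodType A) :
  exists E : res (ghom G M N) = homk (res M) (res N),
    forall f : homk (res M) (res N),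
      (@eqm (Mod k) _ _ E : {linear _ -> _}) f = f.
Proof.
apply: (@lmod_scale_eq k (homk_sort (res M) (res N))) => c f.
exact: (@res_ghom_scaleE k A G M N c f).
Qed.
End ResAct.

(** * Multilinear calculus for Sweedler sums *)

Section LinearCalculus.
Variable k : comPzRingType.
Implicit Types U V W : lmodType k.

Lemma lin_var U : linear (fun x : U => x).
Proof. by []. Qed.
Lemma lin_app U V W (f : {linear V -> W}) (F : U -> V) :
  linear F -> linear (fun x => f (F x)).
Proof. by move=> h c x y; rewrite h linearP. Qed.
Lemma lin_fun U V W (f : V -> W) (F : U -> V) :
  linear f -> linear F -> linear (fun x => f (F x)).
Proof. by move=> hf h c x y; rewrite h hf. Qed.
Lemma lin_add U V (F G : U -> V) :
  linear F -> linear G -> linear (fun x => F x + G x).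
Proof.
by move=> hF hG c x y; rewrite hF hG scalerDr !addrA; congr (_ + _); rewrite addrAC.
Qed.
Lemma lin_sum U V I (r : seq I) (F : I -> U -> V) :
  (forall i, linear (F i)) -> linear (fun x => \sum_(i <- r) F i x).
Proof.
move=> h c x y; rewrite scaler_sumr -big_split /=.
by apply: eq_bigr => i _; rewrite h.
Qed.
Lemma lin_k1 U V (F : U -> k^o) (v : V) :
  linear F -> linear (fun x => (F x : k) *: v).
Proof. by move=> h c x y; rewrite h scalerDl scalerA. Qed.
Lemma lin_k2 U V (F : U -> V) c : linear F -> linear (fun x => c *: F x).
Proof. by move=> h d x y; rewrite h scalerDr !scalerA mulrC. Qed.
Lemma lin_tens1 U V W (F : U -> V) (w : W) :
  linear F -> linear (fun x => tens (F x) w).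
Proof. by move=> h c x y; rewrite h tensDl tensZl. Qed.
Lemma lin_tens2 U V W (F : U -> W) (v : V) :
  linear F -> linear (fun x => tens v (F x)).
Proof. by move=> h c x y; rewrite h tensDr tensZr. Qed.
Lemma lin_tlift1 U V W (X : lmodType k) (F : U -> tensor V W)
  (E : V -> W -> X) : bilinear_fun E -> linear F -> linear (fun x => tlift E (F x)).
Proof. by move=> hE hF; apply: (lin_app (tliftl hE) hF). Qed.
Lemma lin_homk U V W (F : U -> homk V W) v : linear F -> linear (fun x => F x v).
Proof. by move=> h c x y; rewrite h. Qed.

Variable A : algebra k.
Lemma lin_mul1 U (F : U -> alg_mod A) (b : A) :
  linear F -> linear (fun x => (F x : A) * b : alg_mod A).
Proof. by move=> h c x y; rewrite h mulrDl -alg_scaleAl. Qed.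
Lemma lin_mul2 U (F : U -> alg_mod A) (b : A) :
  linear F -> linear (fun x => b * (F x : A) : alg_mod A).
Proof. by move=> h c x y; rewrite h mulrDr -alg_scaleAr. Qed.
Lemma lin_act1 U (M : lmodType A) (F : U -> alg_mod A) (m : M) :
  linear F -> linear (fun x => (F x : A) *: m : res M).
Proof.
by move=> h c x y; rewrite h [LHS]scalerDl res_alg_scale.
Qed.
Lemma lin_act2 U (M : lmodType A) (F : U -> res M) (a : A) :
  linear F -> linear (fun x => a *: (F x : M) : res M).
Proof.
by move=> h c x y; rewrite h [LHS]scalerDr res_act_scale.
Qed.
Lemma lin_algmap U (F : U -> k^o) :
  linear F -> linear (fun x => alg_map A (F x) : alg_mod A).
Proof. by move=> h c x y; rewrite h rmorphD [_ *: _]/(_ * _) rmorphM. Qed.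

(** The opposite algebra has a different module structure on the same set, its
   scalars acting from the other side; they agree because k is central. *)
Lemma op_scale c (a : A) :
  c *: (a : alg_mod (op_alg A)) = c *: (a : alg_mod A).
Proof. exact: esym (alg_central c a). Qed.

Lemma lin_op U (f : A -> U) :
  linear (f : alg_mod A -> U) -> linear (f : alg_mod (op_alg A) -> U).
Proof. by move=> h c x y; rewrite -h op_scale. Qed.
Lemma lin_op' U (F : U -> A) :
  linear (F : U -> alg_mod A) -> linear (F : U -> alg_mod (op_alg A)).
Proof. by move=> h c x y; rewrite h op_scale. Qed.
End LinearCalculus.

Section TensorProductLinear.
Variables (k : comPzRingType) (A B : algebra k).
Local Notation T := (tensor (alg_mod A) (alg_mod B)).

(** The k-module underlying the algebra A (x) B is not literally the tensor
   product: its scalars act by multiplication by c (x) 1. *)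
Lemma tens_alg_scale c (t : tens_alg A B) :
  c *: (t : alg_mod (tens_alg A B)) = c *: (t : T).
Proof.
rewrite -[LHS]/(tens_mul (tens_alg_map A B c) t).
rewrite /tens_alg_map -[alg_map A c]mulr1 -alg_scaleE tensZl tens_mulZl.
by rewrite tens_mul1l.
Qed.

Lemma alg_hom_linear (C : algebra k) (f : C -> tens_alg A B) :
  alg_hom f -> linear (f : alg_mod C -> T).
Proof. by case=> h _ _ c x y; rewrite -tens_alg_scale; apply: h. Qed.

Lemma lin_tmul1 (U : lmodType k) (F : U -> T) (t : tens_alg A B) :
  linear F -> linear (fun x => (F x : tens_alg A B) * t : T).
Proof. by move=> h c x y; rewrite h; apply: tens_mul_linl. Qed.
Lemma lin_tmul2 (U : lmodType k) (F : U -> T) (t : tens_alg A B) :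
  linear F -> linear (fun x => t * (F x : tens_alg A B) : T).
Proof. by move=> h c x y; rewrite h; apply: tens_mul_linr. Qed.
End TensorProductLinear.

(** Proves linearity of an expression in one variable by descending through the
   operations on the path to that variable. *)
Ltac multilin := repeat first
  [ exact: lin_var | assumption
  | apply: lin_mul1 | apply: lin_mul2 | apply: lin_act1 | apply: lin_act2
  | apply: lin_tens1 | apply: lin_tens2 | apply: lin_k1 | apply: lin_k2
  | apply: lin_tmul1 | apply: lin_tmul2 | apply: lin_homk | apply: lin_app
  | apply: lin_algmap | apply: lin_op | apply: lin_op' ].

Section Sweedler.
Variables (k : comPzRingType) (A : algebra k).

Definition bilin (V : lmodType k) (E : A -> A -> V) : Prop :=
  [/\ forall y, linear ((fun x => E x y) : alg_mod A -> V) &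
      forall x, linear (E x : alg_mod A -> V)].
Definition trilin (V : lmodType k) (E : A -> A -> A -> V) : Prop :=
  [/\ forall y z, linear ((fun x => E x y z) : alg_mod A -> V),
      forall x z, linear ((fun y => E x y z) : alg_mod A -> V) &
      forall x y, linear (E x y : alg_mod A -> V)].

Lemma bilin_op (V : lmodType k) (E : A -> A -> V) : bilin E ->
  @bilinear_fun k (alg_mod A) (alg_mod (op_alg A)) V E.
Proof. by case=> h1 h2; split=> // x; apply: lin_op (h2 x). Qed.

Lemma sw_push (B C : algebra k) (V W : lmodType k) (f : V -> W) (t : tens_alg B C)
    (E : B -> C -> V) :
  linear f -> f (\sw_(x, y <- t) E x y) = \sw_(x, y <- t) f (E x y).
Proof. by move=> h; exact: (linear_sum (mklin h)). Qed.

Lemma eq_sw (B C : algebra k) (V : nmodType) (t : tens_alg B C)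
    (E F : B -> C -> V) : (forall x y, E x y = F x y) ->
  \sw_(x, y <- t) E x y = \sw_(x, y <- t) F x y.
Proof. by move=> h; apply: eq_bigr => p _. Qed.

Lemma sw_id (B C : algebra k) (t : tens_alg B C) :
  \sw_(x, y <- t) atens B C x y = t.
Proof. exact: esym (tens_sumP t). Qed.
End Sweedler.

Section Bialgebra.
Variables (k : comPzRingType) (A : algebra k) (B : bialgebra A).
Local Notation Delta := (b_delta B).
Local Notation eps := (b_eps B).

Lemma eps_linear : linear (eps : alg_mod A -> k^o).
Proof. by case: (b_eps_hom B). Qed.
Lemma Delta_linear : linear (Delta : alg_mod A -> tensor (alg_mod A) (alg_mod A)).
Proof. exact: alg_hom_linear (b_delta_hom B). Qed.

Lemma sw_counitl (V : lmodType k) (F : A -> V) a : linear (F : alg_mod A -> V) ->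
  \sw_(x, y <- Delta a) (eps x *: F y) = F a.
Proof.
move=> h; rewrite -[a in RHS](b_counitl B) (sw_push _ _ h).
apply: eq_sw => x y; have := linearZ_LR (mklin h) (eps x) y.
by rewrite /= => <-.
Qed.
Lemma sw_counitr (V : lmodType k) (F : A -> V) a : linear (F : alg_mod A -> V) ->
  \sw_(x, y <- Delta a) (eps y *: F x) = F a.
Proof.
move=> h; rewrite -[a in RHS](b_counitr B) (sw_push _ _ h).
apply: eq_sw => x y; rewrite -alg_central; have := linearZ_LR (mklin h) (eps y) x.
by rewrite /= => <-.
Qed.

(** The image of the coassociativity axiom under the linear map that E induces
   on the triple tensor product. *)
Lemma sw_coassoc (V : lmodType k) (E : A -> A -> A -> V) a : trilin E ->
  \sw_(x, y <- Delta a) \sw_(x1, x2 <- Delta x) E x1 x2 y =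
  \sw_(x, y <- Delta a) \sw_(y1, y2 <- Delta y) E x y1 y2.
Proof.
case=> h1 h2 h3.
have b x : @bilinear_fun k (alg_mod A) (alg_mod A) V (fun y z => E x y z).
  by split.
have b' : @bilinear_fun k (alg_mod A) (tensor (alg_mod A) (alg_mod A)) V
    (fun x t => @tlift k (alg_mod A) (alg_mod A) V (fun y z => E x y z) t).
  split=> [t|x]; last exact: tlift_linear (b x).
  by apply: lin_sum => p; apply: h1.
have := congr1 (tliftl b') (b_coassoc B a).
rewrite !(sw_push _ _ (linearP (tliftl b'))).
under eq_sw => x y.
  rewrite (sw_push _ _ (linearP (tliftl b'))).
  under eq_sw => x1 x2 do rewrite tliftlE (tlift_tens (b _)).
  over.
move=> ->; apply: eq_sw => x y.
rewrite (sw_push _ _ (linearP (tliftl b'))); apply: eq_sw => y1 y2.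
by rewrite tliftlE (tlift_tens (b _)).
Qed.
End Bialgebra.

(** * Translation maps and antipodes *)

Section Translation.
Variables (k : comPzRingType) (A : algebra k).
Local Notation Aop := (op_alg A).

Lemma sw_op_tens (V : lmodType k) (E : A -> A -> V) x y : bilin E ->
  \sw_(p, q <- atens A Aop x y) E p q = E x y.
Proof. by move=> h; exact: (tlift_tens (bilin_op h)). Qed.
Lemma sw_tens (V : lmodType k) (E : A -> A -> V) x y : bilin E ->
  \sw_(p, q <- atens A A x y) E p q = E x y.
Proof. by case=> h1 h2; apply: tlift_tens; split. Qed.

Section Maps.
Variables (B : bialgebra A) (d : A -> tens_alg A Aop).
Local Notation Delta := (b_delta B).

(** Write delta a = a_+ (x) a_- and consider the two right A-linear maps
   beta (a (x) b) = a_1 (x) a_2 b (the Galois map) and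
   gamma (a (x) b) = a_+ (x) a_- b of A (x) A. The two conditions say that
   beta gamma = id, respectively gamma beta = id, on the generators
   a (x) 1, hence everywhere. *)
Definition translation_r : Prop := forall a,
  \sw_(p, q <- d a) \sw_(x, y <- Delta p) atens A A x (y * q) = atens A A a 1.
Definition translation_l : Prop := forall a,
  \sw_(x, y <- Delta a) \sw_(p, q <- d x) atens A A p ((q : A) * y) = atens A A a 1.

Lemma sw_translation_r (V : lmodType k) (E : A -> A -> V) a :
  translation_r -> bilin E ->
  \sw_(p, q <- d a) \sw_(x, y <- Delta p) E x (y * q) = E a 1.
Proof.
move=> /(_ a) T [h1 h2].
have b : @bilinear_fun k (alg_mod A) (alg_mod A) V E by split.
have := congr1 (tliftl b) T; rewrite tliftlE => <-.
rewrite (sw_push _ _ (linearP (tliftl b))); apply: eq_sw => p q.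
rewrite (sw_push _ _ (linearP (tliftl b))); apply: eq_sw => x y.
by rewrite tliftlE.
Qed.
Lemma sw_translation_l (V : lmodType k) (E : A -> A -> V) a :
  translation_l -> bilin E ->
  \sw_(x, y <- Delta a) \sw_(p, q <- d x) E p ((q : A) * y) = E a 1.
Proof.
move=> /(_ a) T [h1 h2].
have b : @bilinear_fun k (alg_mod A) (alg_mod A) V E by split.
have := congr1 (tliftl b) T; rewrite tliftlE => <-.
rewrite (sw_push _ _ (linearP (tliftl b))); apply: eq_sw => p q.
rewrite (sw_push _ _ (linearP (tliftl b))); apply: eq_sw => x y.
by rewrite tliftlE.
Qed.
End Maps.

(** A right inverse of the Galois map equals any left inverse. *)
Lemma translation_unique (B : bialgebra A) (d d' : A -> tens_alg A Aop) :
  linear (d' : alg_mod A -> tensor (alg_mod A) (alg_mod Aop)) ->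
  translation_r B d -> translation_l B d' -> d =1 d'.
Proof.
move=> hd' T T' a.
have bl : bilin (fun u v => \sw_(p, q <- d' u) atens A Aop p ((q : A) * v)).
  split=> [v|u].
    apply: (lin_tlift1 _ hd'); apply: bilin_op; split=> [y|x]; multilin.
  by apply: lin_sum => i; multilin.
have := sw_translation_r a T bl.
under [X in _ = X -> _]eq_sw => p q do rewrite mulr1.
rewrite sw_id => <-; rewrite -[LHS]sw_id; apply: eq_sw => p q.
have b : bilin (fun u w => atens A Aop u (w * (q : A))).
  by split=> ?; multilin.
have := sw_translation_l p T' b; rewrite mul1r => <-.
by apply: eq_sw => x y; apply: eq_sw => u v; rewrite mulrA.
Qed.

Section AntipodeTranslation.
Variables (B : bialgebra A) (S : A -> A).
Local Notation Delta := (b_delta B).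
Local Notation eps := (b_eps B).
(** The value at a (x) 1 of the inverse that an antipode S gives for the Galois
   map. *)
Definition antipode_translation (a : A) : tens_alg A Aop :=
  \sw_(x, y <- Delta a) atens A Aop x (S y).
Hypothesis S_lin : linear (S : alg_mod A -> alg_mod A).

Lemma antipode_translation_linear :
  linear (antipode_translation : alg_mod A -> tensor (alg_mod A) (alg_mod Aop)).
Proof.
apply: (lin_tlift1 _ (Delta_linear B)).
split=> [y|x]; multilin.
Qed.

Lemma left_antipode_translation :
  (forall a, \sw_(x, y <- Delta a) (S x * y) = alg_map A (eps a)) ->
  translation_l B antipode_translation.
Proof.
move=> hS a.
transitivity (\sw_(x, y <- Delta a) \sw_(x1, x2 <- Delta x)
   atens A A x1 (S x2 * y)).
  apply: eq_sw => x y.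
  pose f := fun t : tensor (alg_mod A) (alg_mod Aop) =>
     \sw_(p, q <- t) atens A A p ((q : A) * y).
  have b : bilin (fun p q => atens A A p (q * y)) by split=> ?; multilin.
  have lf : linear f by apply: tlift_linear (bilin_op b).
  rewrite -/(f _) (sw_push _ _ lf).
  by apply: eq_sw => x1 x2; rewrite /f (sw_op_tens _ _ b).
rewrite sw_coassoc; last by split=> ? ?; multilin; apply: lin_fun S_lin _; multilin.
transitivity (\sw_(x, y <- Delta a) (eps y *: (atens A A x 1))).
  apply: eq_sw => x y.
  pose f := fun z : alg_mod A => atens A A x z.
  have lf : linear f by rewrite /f; multilin.
  rewrite -(sw_push (f := f)) // hS /f -tensZr; congr tens.
  by rewrite alg_scaleE mulr1.
by rewrite (sw_counitr B (F := fun x => atens A A x 1)) //; multilin.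
Qed.

Lemma right_antipode_translation :
  (forall a, \sw_(x, y <- Delta a) (x * S y) = alg_map A (eps a)) ->
  translation_r B antipode_translation.
Proof.
move=> hS a.
transitivity (\sw_(x, y <- Delta a) \sw_(x1, x2 <- Delta x)
   atens A A x1 (x2 * S y)).
  pose f := fun t : tensor (alg_mod A) (alg_mod Aop) =>
     \sw_(p, q <- t) \sw_(x, y <- Delta p) atens A A x (y * (q : A)).
  have b : bilin (fun p q => \sw_(x, y <- Delta p) atens A A x (y * q)).
    split=> [q|p]; last by apply: lin_sum => i; multilin.
    apply: (lin_tlift1 _ (Delta_linear B)); split=> ?; multilin.
  have lf : linear f by apply: tlift_linear (bilin_op b).
  rewrite -/(f _) (sw_push _ _ lf).
  by apply: eq_sw => x1 x2; rewrite /f (sw_op_tens _ _ b).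
rewrite sw_coassoc; last by split=> ? ?; multilin; apply: lin_fun S_lin _; multilin.
transitivity (\sw_(x, y <- Delta a) (eps y *: (atens A A x 1))).
  apply: eq_sw => x y.
  pose f := fun z : alg_mod A => atens A A x z.
  have lf : linear f by rewrite /f; multilin.
  rewrite -(sw_push (f := f)) // hS /f -tensZr; congr tens.
  by rewrite alg_scaleE mulr1.
by rewrite (sw_counitr B (F := fun x => atens A A x 1)) //; multilin.
Qed.
End AntipodeTranslation.

Section TranslationAntipode.
Variables (B : bialgebra A) (d : A -> tens_alg A Aop).
Local Notation Delta := (b_delta B).
Local Notation eps := (b_eps B).
Hypothesis d_lin : linear (d : alg_mod A -> tensor (alg_mod A) (alg_mod Aop)).
Hypotheses (T_r : translation_r B d) (T_l : translation_l B d).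

(** The counit applied to the first factor of beta (delta a) = a (x) 1. *)
Lemma translation_mult a : \sw_(p, q <- d a) (p * (q : A)) = alg_map A (eps a).
Proof.
have b : bilin (fun x y => (eps x *: (y : alg_mod A) : alg_mod A)).
  by split=> ?; multilin; apply: eps_linear.
have := sw_translation_r a T_r b; rewrite [RHS]alg_scaleE mulr1 => <-.
refine (@eq_sw k _ _ (alg_mod A) _ _ _ _) => p q; rewrite sw_counitl //.
by apply: lin_mul1 => *.
Qed.
(** The counit applied to the second factor of beta (delta a) = a (x) 1. *)
Lemma translation_unit a : \sw_(p, q <- d a) (p * alg_map A (eps q)) = a.
Proof.
have b : bilin (fun x y => (eps y *: (x : alg_mod A) : alg_mod A)).
  by split=> ?; multilin; apply: eps_linear.
have := sw_translation_r a T_r b.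
have [_ e1 eM] := b_eps_hom B.
rewrite e1 scale1r; apply: etrans.
refine (@eq_sw k _ _ (alg_mod A) _ _ _ _) => p q.
rewrite -{1}(sw_counitr B (F := (fun x => x) : A -> alg_mod A) p) //.
have lf : linear (fun x : alg_mod A => (x : A) * alg_map A (eps q) : alg_mod A).
  by multilin.
rewrite (sw_push _ _ lf); refine (@eq_sw k _ _ (alg_mod A) _ _ _ _) => x y.
by rewrite eM !alg_scaleE rmorphM -!mulrA (alg_central _ x).
Qed.

Definition translation_antipode (a : A) : A :=
  \sw_(p, q <- d a) (eps p *: (q : alg_mod A)).

(** The counit applied to gamma (Delta a) = a (x) 1 shows that S is a left
   antipode. By uniqueness of the translation map, delta a = a_1 (x) S(a_2), so
   a_1 S(a_2) = a_+ a_- = eps a. *)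
Lemma translation_antipodeP : is_antipode B translation_antipode.
Proof.
have b : bilin (fun p q => (eps p *: (q : alg_mod A) : alg_mod A)).
  by split=> ?; multilin; apply: eps_linear.
have S_lin : linear (translation_antipode : alg_mod A -> alg_mod A).
  exact: (lin_tlift1 (bilin_op b) d_lin).
have hl a : \sw_(x, y <- Delta a) (translation_antipode x * y) =
    alg_map A (eps a).
  have := sw_translation_l a T_l b; rewrite [RHS]alg_scaleE mulr1 => <-.
  refine (@eq_sw k _ _ (alg_mod A) _ _ _ _) => x y.
  have lf : linear (fun x : alg_mod A => (x : A) * y : alg_mod A) by multilin.
  rewrite /translation_antipode (sw_push _ _ lf).
  refine (@eq_sw k _ _ (alg_mod A) _ _ _ _) => p q.
  by rewrite alg_scaleAl.
split=> // a; rewrite -translation_mult.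
have E := translation_unique (antipode_translation_linear B S_lin) T_r
  (left_antipode_translation S_lin hl).
rewrite E /antipode_translation; set S := translation_antipode.
have b' : bilin (fun p q => p * q : alg_mod A) by split=> ?; multilin.
have lf := tlift_linear (bilin_op b').
apply: etrans (esym (sw_push (Delta a) (fun x y => atens A Aop x (S y)) lf)).
by refine (@eq_sw k _ _ (alg_mod A) _ _ _ _) => x y; rewrite [RHS](sw_op_tens _ _ b').
Qed.
End TranslationAntipode.
End Translation.

(** * The gabi-algebra of a translation map *)

Section GabiOfTranslation.
Variables (k : comPzRingType) (A : algebra k) (B : bialgebra A).
Local Notation Aop := (op_alg A).
Local Notation AA := (tensor (alg_mod A) (alg_mod A)).
Local Notation AAop := (tensor (alg_mod A) (alg_mod Aop)).
Local Notation Delta := (b_delta B).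
Local Notation eps := (b_eps B).
Variable d : A -> tens_alg A Aop.
Hypothesis d_lin : linear (d : alg_mod A -> AAop).
Hypotheses (T_r : translation_r B d) (T_l : translation_l B d).

(** The Galois map beta, read on the opposite second factor, where delta takes
   its values. *)
Definition galois (s : tens_alg A Aop) : tens_alg A A :=
  \sw_(p, q <- s) (Delta p * atens A A 1 (q : A) : AA).

Let galois_bilin : bilin (fun p q => Delta p * atens A A 1 q : AA).
Proof.
split=> [q|p]; multilin.
exact: Delta_linear.
Qed.
Lemma galois_linear : linear (galois : AAop -> AA).
Proof. exact: tlift_linear (bilin_op galois_bilin). Qed.
Lemma galois_tens p q : galois (atens A Aop p q) = Delta p * atens A A 1 q.
Proof. exact: sw_op_tens galois_bilin. Qed.

Lemma mul_tens1 (t : tens_alg A A) q :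
  t * atens A A 1 q = \sw_(x, y <- t) (atens A A x (y * q) : AA).
Proof.
rewrite -[t in LHS]sw_id.
have l : linear (fun t : AA => (t : tens_alg A A) * atens A A 1 q : AA).
  by multilin.
rewrite (sw_push _ _ l); apply: eq_sw => x y.
by rewrite [LHS]tens_mulE mulr1.
Qed.

Lemma galois_translation a : galois (d a) = atens A A a 1.
Proof. by rewrite -(T_r a); apply: eq_sw => p q; rewrite -mul_tens1. Qed.

Lemma galois_inj : injective galois.
Proof.
have b : bilin (fun u v => \sw_(p, q <- d u) atens A Aop p ((q : A) * v)).
  split=> [v|u]; last by apply: lin_sum => i; multilin.
  by apply: (lin_tlift1 _ d_lin); apply: bilin_op; split=> ?; multilin.
have bf : @bilinear_fun k (alg_mod A) (alg_mod A) AAop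
  (fun u v => \sw_(p, q <- d u) atens A Aop p ((q : A) * v)) by case: b.
suff K : cancel galois (tliftl bf) by apply: can_inj K.
apply: (@tens_ext _ _ _ _ (lin_comp (tliftl bf) (mklin galois_linear))
  (lin_id _)) => p q /=.
rewrite galois_tens mul_tens1.
apply: etrans (sw_push (Delta p) (fun x y => atens A A x (y * (q : A)))
  (linearP (tliftl bf))) _.
transitivity (\sw_(x, y <- Delta p) \sw_(u, v <- d x)
   atens A Aop u (((v : A) * y) * (q : A))).
  apply: eq_sw => x y; rewrite tliftlE; apply: eq_sw => u v.
  by rewrite mulrA.
have b' : bilin (fun u w => atens A Aop u (w * (q : A))).
  by split=> ?; multilin.
by rewrite (sw_translation_l p T_l b') mul1r.
Qed.

(** The order reversal in the second factor of the source is what makes beta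
   compatible with products in this form. *)
Lemma galois_mul (s t : tens_alg A Aop) :
  galois (s * t) = \sw_(p, q <- s) (Delta p * galois t * atens A A 1 (q : A) : AA).
Proof.
have b : bilin (fun p q => Delta p * galois t * atens A A 1 q : AA).
  split=> [q|p]; multilin.
  exact: Delta_linear.
have l : linear (fun s : AAop => galois ((s : tens_alg A Aop) * t) : AA).
  by apply: (lin_fun galois_linear); apply: lin_tmul1.
apply: (@tens_ext _ _ _ _ (mklin l) (tliftl (bilin_op b))) => p q {l s} /=.
rewrite [RHS](tlift_tens (bilin_op b)) {b}.
have l : linear (fun t : AAop => galois (atens A Aop p q * (t : tens_alg A Aop)) : AA).
  by apply: (lin_fun galois_linear); apply: lin_tmul2.
have l' : linear (fun t : AAop => Delta p * galois t * atens A A 1 (q : A) : AA).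
  by apply: lin_tmul1; apply: lin_tmul2; apply: galois_linear.
apply: (@tens_ext _ _ _ _ (mklin l) (mklin l')) => p' q' /=.
rewrite [X in galois X]tens_mulE !galois_tens.
have [_ _ DM] := b_delta_hom B.
rewrite DM -!mulrA; congr (_ * (_ * _)).
by rewrite [RHS]tens_mulE mulr1.
Qed.

(** Both sides of each identity have the same image under the injective Galois
   map; this avoids the antimultiplicativity of the antipode. *)
Lemma translation_hom : alg_hom d.
Proof.
have [_ D1 _] := b_delta_hom B.
split=> [c x y | | a b].
- by rewrite (d_lin c x y) [in RHS]tens_alg_scale.
- apply: galois_inj; rewrite galois_translation.
  by rewrite -[1 in RHS]/(atens A Aop 1 1) galois_tens D1 mul1r.
apply: galois_inj; rewrite galois_mul !galois_translation.
transitivity (galois (d a) * atens A A b 1).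
  by rewrite galois_translation [RHS]tens_mulE mulr1.
have l : linear (fun t : AA => (t : tens_alg A A) * atens A A b 1 : AA).
  by multilin.
rewrite (sw_push _ _ l); apply: eq_sw => p q.
by rewrite -!mulrA; congr (_ * _); rewrite [LHS]tens_mulE [RHS]tens_mulE !mulr1 !mul1r.
Qed.

Local Notation AAA := (tensor (alg_mod A) AA).
Local Notation tens3 x t := (@tens k (alg_mod A) AA x t).

Let untwist_in (y z : A) (t : tens_alg A A) (u : A) : AAA :=
  \sw_(pp, pm <- d u) tens3 pp (atens A A y ((pm : A) * z) * t).
Let untwist_in_trilin t : trilin (fun u y z => untwist_in y z t u).
Proof.
split=> [y z|u z|u y].
- apply: (lin_tlift1 _ d_lin); apply: bilin_op; split=> ?; multilin.
- by apply: lin_sum => i; multilin.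
- by apply: lin_sum => i; multilin.
Qed.

(** x (x) t |-> x_++ (x) (x_- (x) x_+-) t, which inverts
   x (x) t |-> x_1 (x) Delta(x_2) t on the left. *)
Definition untwist (x : A) (t : tens_alg A A) : AAA :=
  \sw_(p, q <- d x) \sw_(pp, pm <- d p) tens3 pp (atens A A (q : A) (pm : A) * t).

(** Coassociativity turns the composite into two successive applications of
   gamma beta = id. *)
Lemma untwist_twist x t :
  \sw_(u, v <- Delta x) untwist u (Delta v * t) = tens3 x t.
Proof.
pose F u v1 v2 := \sw_(p, q <- d u) untwist_in ((q : A) * v1) v2 t p.
have trF : trilin F.
  have [h1 h2 h3] := untwist_in_trilin t.
  split=> [y z|u z|u y].
  - apply: (lin_tlift1 _ d_lin); apply: bilin_op; split=> [q|p]; first exact: h1.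
    by apply: (lin_fun (h2 p z)); multilin.
  - by apply: lin_sum => i; apply: (lin_fun (h2 i.1 z)); multilin.
  - by apply: lin_sum => i; apply: h3.
transitivity (\sw_(u, v <- Delta x) \sw_(v1, v2 <- Delta v) F u v1 v2).
  apply: eq_sw => u v; rewrite /F.
  have l (y q pm : A) : linear (fun s : AA =>
      tens3 y (atens A A q pm * ((s : tens_alg A A) * t))).
    by multilin.
  rewrite -[Delta v in LHS]sw_id.
  pose g := fun s : AA => untwist u ((s : tens_alg A A) * t).
  have lg : linear g by apply: lin_sum => i; apply: lin_sum => j; apply: l.
  rewrite -[LHS]/(g _) (sw_push _ _ lg).
  apply: eq_sw => v1 v2; apply: eq_sw => p q; apply: eq_sw => pp pm.
  by rewrite mulrA [atens A A _ _ * _ in LHS]tens_mulE.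
rewrite -(sw_coassoc B x trF).
transitivity (\sw_(u, v <- Delta x) untwist_in 1 v t u).
  apply: eq_sw => u v.
  have b : bilin (fun p y => untwist_in y v t p).
    by have [h1 h2 _] := untwist_in_trilin t; split.
  exact: (sw_translation_l u T_l b).
have b : bilin (fun p z => tens3 p (atens A A 1 z * t)).
  by split=> ?; multilin.
rewrite (sw_translation_l x T_l b); congr tens.
exact: tens_mul1l.
Qed.

(** As beta (delta a) = a (x) 1, the map inverted by untwist sends the right-hand
   side to a (x) 1 (x) 1; untwisting this element gives the left-hand side. *)
Lemma translation_coaction a :
  \sw_(p, q <- d a) \sw_(pp, pm <- d p) tens3 pp (atens A A (q : A) (pm : A)) =
  \sw_(p, q <- d a) tens3 p (Delta (q : A)).
Proof.
have D1 : Delta 1 = 1 by case: (b_delta_hom B).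
have DM : {morph Delta : a b / a * b} by case: (b_delta_hom B).
transitivity (untwist a (Delta 1)).
  apply: eq_sw => p q; apply: eq_sw => pp pm; rewrite D1; congr tens.
  exact: esym (tens_mul1r _).
have b : bilin (fun x y => untwist x (Delta y)).
  split=> [y|x]; last first.
    apply: lin_sum => i; apply: lin_sum => j; multilin; exact: Delta_linear.
  have [h1 h2 h3] := untwist_in_trilin (Delta y).
  apply: (lin_tlift1 _ d_lin); apply: bilin_op; split=> [q|p].
    apply: (lin_tlift1 _ d_lin); apply: bilin_op; split=> ?; multilin.
  by apply: lin_sum => i; multilin.
rewrite -(sw_translation_r a T_r b); apply: eq_sw => p q.
by rewrite -[RHS]untwist_twist; apply: eq_sw => u v; rewrite DM.
Qed.

(** The image of the preceding identity under id (x) gamma, where gamma undoes the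
   comultiplication of the right-hand side. *)
Lemma translation_assoc a :
  \sw_(p, q <- d a) \sw_(pp, pm <- d p) \sw_(qp, qm <- d q)
     tens3 pp (atens A A (qp : A) ((qm : A) * (pm : A))) =
  \sw_(p, q <- d a) tens3 p (atens A A (q : A) (1 : A)).
Proof.
have b : bilin (fun u v => \sw_(p, q <- d u) atens A A p ((q : A) * v)).
  split=> [v|u]; last by apply: lin_sum => i; multilin.
  by apply: (lin_tlift1 _ d_lin); apply: bilin_op; split=> ?; multilin.
have bf : @bilinear_fun k (alg_mod A) (alg_mod A) AA
  (fun u v => \sw_(p, q <- d u) atens A A p ((q : A) * v)) by case: b.
pose L := tens_map (lin_id (alg_mod A)) (tliftl bf).
have := congr1 L (translation_coaction a).
rewrite !(sw_push _ _ (linearP L)) => E.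
apply: etrans (etrans E _).
  apply: eq_sw => p q; rewrite (sw_push _ _ (linearP L)); apply: eq_sw => pp pm.
  rewrite tens_mapE tliftlE.
  have l : linear (fun t : AA => tens3 pp t) by multilin.
  by rewrite (sw_push _ _ l).
apply: eq_sw => p q; rewrite tens_mapE; congr tens.
rewrite -[in LHS](sw_id (Delta _)) (sw_push _ _ (linearP (tliftl bf))).
rewrite -[RHS](T_l (q : A)); apply: eq_sw => x y.
by rewrite tliftlE.
Qed.

Definition translation_gabi : gabi A :=
  @Gabi k A eps d (b_eps_hom B) translation_hom (translation_unit T_r)
    (translation_mult T_r) translation_assoc.
End GabiOfTranslation.

(** If gamma is inverse to the Galois maps beta of B and beta' of B', then
   beta = beta gamma beta' = beta', and the comultiplication is the value of beta
   on the elements a (x) 1. *)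
Lemma bialgebra_unique (k : comPzRingType) (A : algebra k) (B B' : bialgebra A)
    (d : A -> tens_alg A (op_alg A)) :
  translation_r B d -> translation_l B' d -> b_eps B =1 b_eps B' -> B = B'.
Proof.
move=> T_r T_l e.
have e1 : b_eps B = b_eps B' by apply: funext.
have e2 : b_delta B = b_delta B'.
  apply: funext => a.
  transitivity (\sw_(u, v <- b_delta B' a) \sw_(p, q <- d u)
     (b_delta B p * atens A A 1 ((q : A) * v)) : tensor (alg_mod A) (alg_mod A)).
    have b : bilin (fun p q => b_delta B p * atens A A 1 q
       : tensor (alg_mod A) (alg_mod A)).
      by split=> ?; multilin; exact: Delta_linear.
    rewrite (sw_translation_l a T_l b).
    exact: esym (tens_mul1r _).
  rewrite -[RHS]sw_id; apply: eq_sw => u v.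
  transitivity (galois B (d u) * atens A A 1 v); last first.
    rewrite galois_translation // [LHS]tens_mulE mulr1 mul1r //.
  have l : linear (fun t : tensor (alg_mod A) (alg_mod A) =>
     (t : tens_alg A A) * atens A A 1 v : tensor (alg_mod A) (alg_mod A)).
    by multilin.
  rewrite (sw_push _ _ l); apply: eq_sw => p q.
  by rewrite -mulrA; congr (_ * _); rewrite [RHS]tens_mulE mulr1.
case: B B' e1 e2 {T_r T_l e} => e0 D0 h1 h2 h3 h4 h5.
case=> e0' D0' h1' h2' h3' h4' h5' /= E1 E2.
case: _ / E1 in h1' h3' h4' *; case: _ / E2 in h2' h3' h4' h5' *.
by congr Bialgebra; apply: Prop_irrelevance.
Qed.

(** * The diagonal action of a bialgebra *)

Section DiagonalAction.
Variables (k : comPzRingType) (A : algebra k) (B : bialgebra A).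
Local Notation Delta := (b_delta B).
Local Notation AA := (tensor (alg_mod A) (alg_mod A)).

Lemma act_linear (M : lmodType A) (a : A) :
  linear (fun m : res M => a *: (m : M) : res M).
Proof. by multilin. Qed.
Definition act_lin M a : {linear res M -> res M} := mklin (@act_linear M a).

Lemma tens_ext_comb (U V W : lmodType k) (f g h : {linear tensor U V -> W}) c :
  (forall u v, f (tens u v) = c *: g (tens u v) + h (tens u v)) ->
  forall t, f t = c *: g t + h t.
Proof.
move=> H.
by apply: (@tens_ext _ _ _ _ f ((c \*: g) \+ h : {linear tensor U V -> W})).
Qed.

Section Action.
Variables M N : lmodType A.
Local Notation T := (tensor (res M) (res N)).

Definition tens_act (s : tens_alg A A) (t : T) : T :=
  \sw_(x, y <- s) tens_map (act_lin M x) (act_lin N y) t.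

Let tens_act_bilin t :
  bilin (fun x y => tens_map (act_lin M x) (act_lin N y) t).
Proof.
split=> [y c x x'|x c y y']; apply: tens_ext_comb => m n; rewrite !tens_mapE.
  by rewrite -tensZl -tensDl; congr tens; rewrite [LHS]scalerDl res_alg_scale.
by rewrite -tensZr -tensDr; congr tens; rewrite [LHS]scalerDl res_alg_scale.
Qed.
Lemma tens_act_linear1 t : linear (tens_act^~ t : AA -> T).
Proof. by apply: tlift_linear; have [h1 h2] := tens_act_bilin t; split. Qed.
Lemma tens_act_linear2 s : linear (tens_act s).
Proof. by apply: lin_sum => i; exact: linearP. Qed.
Lemma tens_actE (x y : A) (m : res M) (n : res N) :
  tens_act (atens A A x y) (tens m n) = tens (x *: (m : M) : res M) (y *: (n : N) : res N).
Proof. by rewrite /tens_act (sw_tens _ _ (tens_act_bilin _)) tens_mapE. Qed.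

Lemma tens_actM s s' t : tens_act s (tens_act s' t) = tens_act (s * s') t.
Proof.
have l1 : linear (fun s : AA => tens_act s (tens_act s' t)).
  exact: tens_act_linear1.
have l2 : linear (fun s : AA => tens_act ((s : tens_alg A A) * s') t).
  by apply: (lin_fun (tens_act_linear1 t)); multilin.
apply: (@tens_ext _ _ _ _ (mklin l1) (mklin l2)) => x y {l1 l2 s} /=.
have l1 : linear (fun s : AA => tens_act (atens A A x y) (tens_act s t)).
  exact: (lin_fun (tens_act_linear2 _) (tens_act_linear1 t)).
have l2 : linear (fun s : AA => tens_act (atens A A x y * (s : tens_alg A A)) t).
  by apply: (lin_fun (tens_act_linear1 t)); multilin.
apply: (@tens_ext _ _ _ _ (mklin l1) (mklin l2)) => x' y' {l1 l2 s'} /=.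
rewrite [X in _ = tens_act X t]tens_mulE.
have l := lin_fun (tens_act_linear2 (atens A A x y)) (tens_act_linear2 (atens A A x' y')).
apply: (@tens_ext _ _ _ _ (mklin l) (mklin (tens_act_linear2 (atens A A (x * x') (y * y'))))).
by move=> m n /=; rewrite !tens_actE !scalerA.
Qed.
Lemma tens_act1 t : tens_act 1 t = t.
Proof.
apply: (@tens_ext _ _ _ _ (mklin (tens_act_linear2 1)) (lin_id _)) => m n /=.
by rewrite [1]/(atens A A 1 1) tens_actE !scale1r.
Qed.

Definition diag_act (a : A) (t : T) : T := tens_act (Delta a) t.
Lemma diag_act_is_action : is_action diag_act.
Proof.
have [_ D1 DM] := b_delta_hom B.
have l t := lin_fun (tens_act_linear1 t) (Delta_linear B).
split=> [a b t|t|a s t|t a b]; rewrite /diag_act.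
- by rewrite tens_actM -DM.
- by rewrite D1 tens_act1.
- by have := tens_act_linear2 (Delta a) 1 s t; rewrite !scale1r.
- by have := l t 1 a b; rewrite !scale1r.
Qed.
Definition tmod : lmodType A := act_mod diag_act_is_action.
Definition tmod_tens (m : M) (n : N) : tmod := tens (m : res M) (n : res N).

Lemma diag_act_map c t : diag_act (alg_map A c) t = c *: t.
Proof.
have [_ D1 _] := b_delta_hom B.
have l := lin_fun (tens_act_linear1 t) (Delta_linear B).
have := linearZ_LR (mklin l) c 1.
by rewrite /= D1 tens_act1 alg_scaleE mulr1.
Qed.
Lemma res_tmod_scale c (t : res tmod) : c *: t = c *: (t : T) :> T.
Proof. exact: diag_act_map. Qed.
Lemma res_tmod_eq : exists E : res tmod = T,
  forall x : T, (@eqm (Mod k) _ _ E : {linear _ -> _}) x = x.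
Proof. exact: res_act_mod diag_act_map. Qed.

Lemma tm_actE a m n :
  a *: tmod_tens m n = \sw_(x, y <- Delta a) (tmod_tens (x *: m) (y *: n) : res tmod).
Proof.
rewrite -[LHS]/(diag_act a (tens _ _)) /diag_act /tens_act.
by apply: eq_bigr => p _; rewrite tens_mapE.
Qed.

(** Underlying additive groups are shared by tmod and the tensor product, but the
   k-module structures are only provably equal, so the basic properties of pure
   tensors are restated for tmod. *)
Lemma tmod_ind (P : tmod -> Prop) : (forall m n, P (tmod_tens m n)) ->
  (forall s t, P s -> P t -> P (s + t)) -> P 0 -> forall t, P t.
Proof.
move=> Pt PD P0; elim/tens_ind => s; rewrite tcls_sum.
by elim: s => [|p s ih]; rewrite ?big_nil ?big_cons //; apply: PD.
Qed.
Lemma tmDl m m' n : tmod_tens (m + m') n = tmod_tens m n + tmod_tens m' n.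
Proof. exact: tensDl. Qed.
Lemma tmDr m n n' : tmod_tens m (n + n') = tmod_tens m n + tmod_tens m n'.
Proof. exact: tensDr. Qed.
Lemma tm_linearl n : linear ((fun m => tmod_tens m n) : res M -> res tmod).
Proof. by move=> c x y; rewrite res_tmod_scale; apply: (tens_bilinear _ _).1. Qed.
Lemma tm_linearr m : linear (tmod_tens m : res N -> res tmod).
Proof. by move=> c x y; rewrite res_tmod_scale; apply: (tens_bilinear _ _).2. Qed.
Lemma tm0l n : tmod_tens 0 n = 0.
Proof. by apply: (addrI (tmod_tens 0 n)); rewrite -tmDl !addr0. Qed.
Lemma tm0r m : tmod_tens m 0 = 0.
Proof. by apply: (addrI (tmod_tens m 0)); rewrite -tmDr !addr0. Qed.

(** A k-bilinear map is A-linear on the diagonal module as soon as it is so on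
   pure tensors. *)
Section Lift.
Variables (Z : lmodType A) (E : M -> N -> Z).
Hypotheses (E_l : forall n, linear ((fun m => E m n) : res M -> res Z))
  (E_r : forall m, linear (E m : res N -> res Z)).
Lemma tmod_lift_bilinear : @bilinear_fun k (res M) (res N) (res Z) E.
Proof. by split. Qed.
Definition tmod_lift_fun (t : tmod) : Z := tliftl tmod_lift_bilinear t.
Lemma tmod_lift_tm m n : tmod_lift_fun (tmod_tens m n) = E m n.
Proof. exact: (tlift_tens tmod_lift_bilinear m n). Qed.
Lemma tmod_lift_linear_k : linear (tmod_lift_fun : res tmod -> res Z).
Proof.
by move=> c s t; rewrite res_tmod_scale /tmod_lift_fun linearP.
Qed.
Hypothesis E_act : forall a m n,
  tmod_lift_fun (a *: tmod_tens m n) = a *: E m n.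
Lemma tmod_lift_linear : linear tmod_lift_fun.
Proof.
have fD := linearD (tliftl tmod_lift_bilinear).
have f0 : tmod_lift_fun 0 = 0 by exact: (linear0 (tliftl tmod_lift_bilinear)).
move=> a s t; rewrite [LHS]fD; congr (_ + _).
elim/tmod_ind: s => [m n|s s' hs hs'|].
- by rewrite -[LHS]/(tmod_lift_fun (a *: tmod_tens m n)) E_act -tmod_lift_tm.
- by rewrite scalerDr [LHS]fD [in RHS]/tmod_lift_fun [in RHS]fD scalerDr; congr (_ + _).
- by rewrite scaler0 f0 [RHS]scaler0.
Qed.
Definition tmod_lift : {linear tmod -> Z} := mklin tmod_lift_linear.
Lemma tmod_liftE m n : tmod_lift (tmod_tens m n) = E m n.
Proof. exact: tmod_lift_tm. Qed.
End Lift.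

Lemma tmod_lift_sum (Z : lmodType A) (E : M -> N -> Z) E_l E_r a m n :
  @tmod_lift_fun Z E E_l E_r (a *: tmod_tens m n) =
  \sw_(x, y <- Delta a) (E (x *: m) (y *: n) : res Z).
Proof.
rewrite tm_actE (sw_push _ _ (tmod_lift_linear_k E_l E_r)).
by apply: eq_sw => x y; rewrite tmod_lift_tm.
Qed.

Lemma tmod_ext (Z : lmodType A) (f g : {linear tmod -> Z}) :
  (forall m n, f (tmod_tens m n) = g (tmod_tens m n)) -> f = g.
Proof.
move=> h; apply: lin_ext; elim/tmod_ind => [//|s t hs ht|]; last by rewrite !linear0.
by rewrite !linearD hs ht.
Qed.
End Action.
End DiagonalAction.

(** * The monoidal category of modules over a bialgebra *)

Lemma iso_of_cancel (R : pzRingType) (M N : lmodType R) (f : {linear M -> N})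
    (g : N -> M) : cancel f g -> cancel g f -> @is_iso (Mod R) M N f.
Proof.
move=> fK gK.
have l : linear g by move=> a x y; apply: (can_inj fK); rewrite linearP !gK.
by exists (mklin l); split; apply: lin_ext.
Qed.

(** The unit object is that of a gabi-algebra with the same counit, so that this
   monoidal structure and the closed structure of the gabi-algebra have literally
   the same unit. *)
Section DiagonalMonoidal.
Variables (k : comPzRingType) (A : algebra k) (B : bialgebra A) (G : gabi A).
Hypothesis eps_eq : forall a, g_eps G a = b_eps B a.
Local Notation Delta := (b_delta B).
Local Notation eps := (b_eps B).
Local Notation "M \ox N" := (tmod B M N) (at level 40, left associativity).
Local Notation tm m n := (tmod_tens B m n).

Lemma gone_scaleE (a : A) (c : gone G) : a *: c = (eps a * (c : k) : gone G).
Proof. by rewrite -eps_eq. Qed.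
Lemma res_gone_scale c (d : res (gone G)) : c *: d = (c * (d : k) : res (gone G)).
Proof. by rewrite -[c in RHS](g_eps_map G). Qed.
Lemma res_gone_eq : exists E : res (gone G) = k^o,
  forall c : k^o, (@eqm (Mod k) _ _ E : {linear _ -> _}) c = c.
Proof. exact: (@lmod_scale_eq k k) res_gone_scale. Qed.

Lemma tmod_ext3 M N P (Z : lmodType A) (f g : {linear M \ox N \ox P -> Z}) :
  (forall m n p, f (tm (tm m n) p) = g (tm (tm m n) p)) -> f = g.
Proof.
move=> h; apply: tmod_ext => t p; elim/tmod_ind: t => [//|s t hs ht|].
  by rewrite tmDl !linearD hs ht.
by rewrite tm0l !linear0.
Qed.
Lemma tmod_ext4 M N P Q (Z : lmodType A) (f g : {linear M \ox N \ox P \ox Q -> Z}) :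
  (forall m n p q, f (tm (tm (tm m n) p) q) = g (tm (tm (tm m n) p) q)) -> f = g.
Proof.
move=> h; apply: tmod_ext3 => t p q; elim/tmod_ind: t => [//|s t hs ht|].
  by rewrite !tmDl !linearD hs ht.
by rewrite !tm0l !linear0.
Qed.

Section Map.
Variables (M M' N N' : lmodType A) (f : {linear M -> M'}) (g : {linear N -> N'}).
Let El n : linear ((fun m => tm (f m) (g n)) : res M -> res (M' \ox N')).
Proof. exact: (lin_fun (tm_linearl B _) (res_linear f)). Qed.
Let Er m : linear ((fun n => tm (f m) (g n)) : res N -> res (M' \ox N')).
Proof. exact: (lin_fun (tm_linearr B _) (res_linear g)). Qed.
Let Eact a m n : tmod_lift_fun El Er (a *: tm m n) = a *: tm (f m) (g n).
Proof.
by rewrite tmod_lift_sum tm_actE; apply: eq_sw => x y; rewrite !linearZ.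
Qed.
Definition tmod_map : {linear M \ox N -> M' \ox N'} := tmod_lift Eact.
Lemma tmod_mapE m n : tmod_map (tm m n) = tm (f m) (g n).
Proof. exact: tmod_liftE. Qed.
End Map.

(** The associator is lifted in two stages, first in M and N for a fixed element
   of P; its A-linearity is the coassociativity of B. *)
Section Assoc.
Variables M N P : lmodType A.
Let inl p n : linear ((fun m => tm m (tm n p)) : res M -> res (M \ox (N \ox P))).
Proof. exact: tm_linearl. Qed.
Let inr p m : linear ((fun n => tm m (tm n p)) : res N -> res (M \ox (N \ox P))).
Proof. exact: (lin_fun (tm_linearr B _) (tm_linearl B _)). Qed.
Definition tmod_assoc_in p (t : M \ox N) := tmod_lift_fun (inl p) (inr p) t.
Let in_tm p m n : tmod_assoc_in p (tm m n) = tm m (tm n p).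
Proof. by rewrite /tmod_assoc_in tmod_lift_tm. Qed.
Let in_l p : linear (tmod_assoc_in p : res (M \ox N) -> res (M \ox (N \ox P))).
Proof. exact: tmod_lift_linear_k. Qed.
Let in_D p s t : tmod_assoc_in p (s + t) = tmod_assoc_in p s + tmod_assoc_in p t.
Proof. exact: (linearD (mklin (in_l p))). Qed.
Let in_0 p : tmod_assoc_in p 0 = 0.
Proof. exact: (linear0 (mklin (in_l p))). Qed.
Let in_r t : linear ((fun p => tmod_assoc_in p t) : res P -> res (M \ox (N \ox P))).
Proof.
elim/tmod_ind: t => [m n|s t hs ht|] c x y; rewrite ?in_0 ?in_D ?scaler0 ?addr0 //.
  rewrite !in_tm; apply: (lin_fun (tm_linearr B _) (tm_linearr B _)).
exact: (lin_add hs ht).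
Qed.
Let E_act a t p :
  @tmod_lift_fun k A B (M \ox N) P _ (fun t p => tmod_assoc_in p t) in_l in_r
    (a *: tm t p) = a *: tmod_assoc_in p t.
Proof.
rewrite tmod_lift_sum.
elim/tmod_ind: t => [m n|s t hs ht|]; last 2 first.
- rewrite in_D scalerDr -hs -ht -big_split; apply: eq_bigr => i _.
  by rewrite scalerDr in_D.
- by rewrite in_0 scaler0; apply: big1 => i _; rewrite scaler0 in_0.
pose F x y z := tm (x *: m) (tm (y *: n) (z *: p)) : res (M \ox (N \ox P)).
have trF : trilin F.
  split=> [y z|x z|x y].
  - by apply: (lin_fun (tm_linearl B _)); multilin.
  - apply: (lin_fun (tm_linearr B _)); apply: (lin_fun (tm_linearl B _)); multilin.
  - apply: (lin_fun (tm_linearr B _)); apply: (lin_fun (tm_linearr B _)); multilin.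
rewrite in_tm tm_actE.
transitivity (\sw_(x, y <- Delta a) \sw_(x1, x2 <- Delta x) F x1 x2 y).
  apply: eq_sw => x y; rewrite tm_actE (sw_push _ _ (in_l (y *: p))).
  by apply: eq_sw => x1 x2; rewrite in_tm.
rewrite (sw_coassoc _ _ trF); apply: eq_sw => x y.
by rewrite tm_actE (sw_push _ _ (tm_linearr B (x *: m))).
Qed.
Definition tmod_assoc : {linear M \ox N \ox P -> M \ox (N \ox P)} :=
  @tmod_lift k A B _ _ _ (fun t p => tmod_assoc_in p t) in_l in_r E_act.
Lemma tmod_assocE m n p : tmod_assoc (tm (tm m n) p) = tm m (tm n p).
Proof. by rewrite /tmod_assoc tmod_liftE in_tm. Qed.
End Assoc.

Section Unit.
Variable M : lmodType A.
Let l_l (m : M) : linear ((fun c : gone G => (c : k) *: (m : res M)) :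
  res (gone G) -> res M).
Proof. by move=> c x y; rewrite res_gone_scale scalerDl scalerA. Qed.
Let l_r (c : gone G) : linear ((fun m => (c : k) *: (m : res M)) : res M -> res M).
Proof. by multilin. Qed.
Let l_act a (c : gone G) m :
  @tmod_lift_fun k A B (gone G) M M (fun c m => (c : k) *: (m : res M)) l_l l_r
    (a *: tm c m) = a *: ((c : k) *: (m : res M) : M).
Proof.
rewrite tmod_lift_sum.
pose F (x : A) : res M := (c : k) *: (x *: m : res M).
have l : linear (F : alg_mod A -> res M) by rewrite /F; multilin.
rewrite res_act_scale -[RHS](sw_counitl B (F := F) a l); apply: eq_sw => x y.
by rewrite gone_scaleE scalerA.
Qed.
Definition tmod_lambda : {linear gone G \ox M -> M} :=
  @tmod_lift k A B (gone G) M M (fun c m => (c : k) *: (m : res M)) l_l l_r l_act.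
Lemma tmod_lambdaE (c : gone G) (m : M) : tmod_lambda (tm c m) = (c : k) *: (m : res M).
Proof. exact: (tmod_liftE l_act). Qed.
Lemma tmod_lambda_iso : @is_iso (Mod A) _ _ tmod_lambda.
Proof.
pose g (m : M) := tm (1 : gone G) m.
apply: (@iso_of_cancel A (gone G \ox M) M tmod_lambda g) => [|m].
  2: by rewrite tmod_lambdaE scale1r.
elim/tmod_ind => [c m|s t hs ht|].
- rewrite tmod_lambdaE /g.
  have := linearZ_LR (mklin (tm_linearr B (N := M) (1 : gone G))) (c : k) m.
  have := linearZ_LR (mklin (tm_linearl B (M := gone G) m)) (c : k) (1 : gone G).
  by rewrite /= res_gone_scale mulr1 => -> ->.
- by rewrite linearD /g tmDr; congr (_ + _).
- by rewrite linear0 /g tm0r.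
Qed.

Let r_act a (m : M) : tm (a *: m) (1 : gone G) = a *: tm m (1 : gone G).
Proof.
rewrite tm_actE.
have l : linear ((fun x : A => tm (x *: m) (1 : gone G)) : alg_mod A -> res (M \ox gone G)).
  by apply: (lin_fun (tm_linearl B _)); multilin.
rewrite -(sw_counitr B a l); apply: eq_sw => x y.
have := linearZ_LR (mklin (tm_linearr B (x *: m))) (eps y) (1 : gone G).
rewrite /= => <-; congr (tmod_tens _ _ _).
by rewrite res_gone_scale gone_scaleE.
Qed.
Let r_lin : linear (fun m : M => tm m (1 : gone G)).
Proof. by move=> a m n; rewrite tmDl r_act. Qed.
Definition tmod_rho : {linear M -> M \ox gone G} := mklin r_lin.
Lemma tmod_rhoE (m : M) : tmod_rho m = tm m (1 : gone G).
Proof. by []. Qed.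
Let r_bilin : @bilinear_fun k (res M) (res (gone G)) (res M)
  (fun (m : res M) (c : gone G) => (c : k) *: m).
Proof.
split=> [c d x y|m c x y]; first by rewrite scalerDr !scalerA mulrC.
by rewrite res_gone_scale scalerDl scalerA.
Qed.
Lemma tmod_rho_iso : @is_iso (Mod A) _ _ tmod_rho.
Proof.
pose g := tliftl r_bilin.
have gE (m : M) (c : gone G) : g (tm m c) = (c : k) *: (m : res M) by exact: tliftlE.
have gD (s t : M \ox gone G) : g (s + t) = g s + g t by exact: linearD.
apply: (@iso_of_cancel A M (M \ox gone G) tmod_rho g) => [m|].
  by rewrite tmod_rhoE gE scale1r.
elim/tmod_ind => [m c|s t hs ht|].
- rewrite gE tmod_rhoE.
  have := linearZ_LR (mklin (tm_linearl B m)) (c : k) (1 : gone G).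
  have := linearZ_LR (mklin (tm_linearr B (N := gone G) m)) (c : k) (1 : gone G).
  rewrite /= res_gone_scale mulr1 => -> _.
  exact: (linearZ_LR (mklin (tm_linearl B (1 : gone G))) (c : k) m).
- by rewrite gD linearD; congr (_ + _).
- by rewrite [g 0]linear0 linear0.
Qed.
End Unit.

Section AssocIso.
Variables M N P : lmodType A.
Let inl m p : linear ((fun n => tm (tm m n) p) : res N -> res (M \ox N \ox P)).
Proof. exact: (lin_fun (tm_linearl B _) (tm_linearr B _)). Qed.
Let inr m n : linear ((fun p => tm (tm m n) p) : res P -> res (M \ox N \ox P)).
Proof. exact: tm_linearr. Qed.
Definition tmod_assocV_in m (t : N \ox P) :=
  @tmod_lift_fun k A B N P _ (fun n p => tm (tm m n) p) (inl m) (inr m) t.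
Let in_tm m n p : tmod_assocV_in m (tm n p) = tm (tm m n) p.
Proof. by rewrite /tmod_assocV_in tmod_lift_tm. Qed.
Let in_r m : linear (tmod_assocV_in m : res (N \ox P) -> res (M \ox N \ox P)).
Proof. exact: tmod_lift_linear_k. Qed.
Let in_D m s t : tmod_assocV_in m (s + t) = tmod_assocV_in m s + tmod_assocV_in m t.
Proof. exact: (linearD (mklin (in_r m))). Qed.
Let in_0 m : tmod_assocV_in m 0 = 0.
Proof. exact: (linear0 (mklin (in_r m))). Qed.
Let in_l t : linear ((fun m => tmod_assocV_in m t) : res M -> res (M \ox N \ox P)).
Proof.
elim/tmod_ind: t => [m n|s t hs ht|] c x y; rewrite ?in_0 ?in_D ?scaler0 ?addr0 //.
  by rewrite !in_tm; apply: (lin_fun (tm_linearl B _) (tm_linearl B _)).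
exact: (lin_add hs ht).
Qed.
Lemma tmod_assoc_iso : @is_iso (Mod A) _ _ (tmod_assoc M N P).
Proof.
pose g := @tmod_lift_fun k A B M (N \ox P) _ (fun m t => tmod_assocV_in m t) in_l in_r.
have gE m n p : g (tm m (tm n p)) = tm (tm m n) p.
  by rewrite /g tmod_lift_tm in_tm.
have gl : linear (g : res (M \ox (N \ox P)) -> res (M \ox N \ox P)).
  exact: tmod_lift_linear_k.
have gD s t : g (s + t) = g s + g t by exact: (linearD (mklin gl)).
have g0 : g 0 = 0 by exact: (linear0 (mklin gl)).
apply: (@iso_of_cancel A _ _ (tmod_assoc M N P) g).
  elim/tmod_ind => [t p|s t hs ht|]; last by rewrite linear0 g0.
    elim/tmod_ind: t => [m n|s t hs ht|].
    - by rewrite tmod_assocE gE.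
    - by rewrite tmDl linearD gD hs ht.
    - by rewrite tm0l linear0 g0.
  by rewrite linearD gD hs ht.
elim/tmod_ind => [m t|s t hs ht|]; last by rewrite g0 linear0.
  elim/tmod_ind: t => [n p|s t hs ht|].
  - by rewrite gE tmod_assocE.
  - by rewrite tmDr gD linearD hs ht.
  - by rewrite tm0r g0 linear0.
by rewrite gD linearD hs ht.
Qed.
End AssocIso.

Definition diag_monoidal : monoidal (Mod A).
Proof.
refine (@Monoidal (Mod A) (tmod B) tmod_map (gone G) tmod_assoc tmod_lambda tmod_rho
  _ _ _ _ _ tmod_assoc_iso tmod_lambda_iso tmod_rho_iso _ _).
- by move=> M N; apply: tmod_ext => m n; rewrite tmod_mapE.
- move=> M M' M'' N N' N'' f' f g' g; apply: tmod_ext => m n.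
  by rewrite lin_compE !tmod_mapE.
- move=> M M' N N' P P' f g h; apply: tmod_ext3 => m n p.
  by rewrite !lin_compE !(tmod_mapE, tmod_assocE).
- move=> M M' f; apply: tmod_ext => c m.
  rewrite !lin_compE tmod_mapE !tmod_lambdaE.
  exact: esym (linearZ_LR (res_mor f) (c : k) m).
- by move=> M M' f; apply: lin_ext => m; rewrite !lin_compE tmod_mapE.
- move=> M N P Q; apply: tmod_ext4 => m n p q.
  by rewrite !lin_compE !(tmod_mapE, tmod_assocE).
- move=> M N; apply: tmod_ext => m n.
  rewrite !lin_compE tmod_mapE tmod_rhoE tmod_assocE tmod_mapE tmod_lambdaE.
  by rewrite scale1r.
Defined.
End DiagonalMonoidal.

(** * Internal homs as adjoints *)

Section LinearMaps.
Variables (R : pzRingType) (M N : lmodType R).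
Definition lhom_sort : Type := {linear M -> N}.
HB.instance Definition _ := gen_eqMixin lhom_sort.
HB.instance Definition _ := gen_choiceMixin lhom_sort.
Implicit Types f g h : lhom_sort.
Definition lhom_add f g : lhom_sort :=
  ((f : {linear M -> N}) \+ (g : {linear M -> N}) : {linear M -> N}).
Definition lhom_opp f : lhom_sort := (\- (f : {linear M -> N}) : {linear M -> N}).
Definition lhom_zero : lhom_sort := (\0 : {linear M -> N}).
Let lhom_addA : associative lhom_add.
Proof. by move=> f g h; apply: lin_ext => x /=; rewrite addrA. Qed.
Let lhom_addC : commutative lhom_add.
Proof. by move=> f g; apply: lin_ext => x /=; rewrite addrC. Qed.
Let lhom_add0 : left_id lhom_zero lhom_add.
Proof. by move=> f; apply: lin_ext => x /=; rewrite add0r. Qed.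
Let lhom_addN : left_inverse lhom_zero lhom_opp lhom_add.
Proof. by move=> f; apply: lin_ext => x /=; rewrite addNr. Qed.
HB.instance Definition _ :=
  GRing.isZmodule.Build lhom_sort lhom_addA lhom_addC lhom_add0 lhom_addN.
End LinearMaps.

Definition regular_mod (R : pzRingType) : lmodType R := R^o.

Section DiagonalClosed.
Variables (k : comPzRingType) (A : algebra k) (B : bialgebra A) (G : gabi A).
Hypothesis eps_eq : forall a, g_eps G a = b_eps B a.
Hypotheses (T_r : translation_r B (g_delta G)) (T_l : translation_l B (g_delta G)).
Local Notation "M \ox N" := (tmod B M N) (at level 40, left associativity).
Local Notation tm m n := (tmod_tens B m n).
Local Notation reg := (regular_mod A).
Local Notation Mon := (diag_monoidal eps_eq).

Section Adjunction.
Variable X : lmodType A.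

Section Coev.
Variable Y : lmodType A.
Definition ghom_coev_fun (y : Y) : ghom G X (Y \ox X) := mklin (tm_linearr B (N := X) y).
(** A-linearity of coev is beta gamma = id for the Galois map. *)
Lemma ghom_coev_linear : linear ghom_coev_fun.
Proof.
move=> a y y'; rewrite ghom_scaleE; apply: lin_ext => x.
rewrite /= tmDl; congr (_ + _); rewrite /gact_fun.
have b : bilin (fun u v : A => tm (u *: y) (v *: x) : res (Y \ox X)).
  split=> [v|u]; first by apply: (lin_fun (tm_linearl B _)); multilin.
  by apply: (lin_fun (tm_linearr B _)); multilin.
have := sw_translation_r a T_r b; rewrite scale1r => <-.
apply: eq_sw => p q; rewrite [RHS]tm_actE; apply: eq_sw => u v.
by rewrite scalerA.
Qed.
Definition ghom_coev : {linear Y -> ghom G X (Y \ox X)} := mklin ghom_coev_linear.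
End Coev.

(** A-linearity of evaluation is gamma beta = id for the Galois map. *)
Section Ev.
Variable Y : lmodType A.
Let E (f : ghom G X Y) (x : X) : Y := (f : homk (res X) (res Y)) x.
Let E_l x : linear (E^~ x : res (ghom G X Y) -> res Y).
Proof. by move=> c f g; rewrite /E res_ghom_scaleE. Qed.
Let E_r f : linear (E f : res X -> res Y).
Proof. by move=> c x y; rewrite /E linearP. Qed.
Let E_act a (f : ghom G X Y) x :
  @tmod_lift_fun k A B _ X Y E E_l E_r (a *: tm f x) = a *: E f x.
Proof.
rewrite tmod_lift_sum.
have b : bilin (fun u v : A => u *: E f (v *: x) : res Y).
  by split=> ?; multilin.
have := sw_translation_l a T_l b; rewrite scale1r => <-.
apply: eq_sw => u v; rewrite ghom_scaleE; apply: eq_sw => p q.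
by rewrite /E scalerA.
Qed.
Definition ghom_ev : {linear ghom G X Y \ox X -> Y} :=
  @tmod_lift k A B _ X Y E E_l E_r E_act.
Lemma ghom_evE (f : ghom G X Y) (x : X) :
  ghom_ev (tm f x) = (f : homk (res X) (res Y)) x.
Proof. exact: (tmod_liftE E_act). Qed.
End Ev.

Let radj_id Y : ghom_mor G (lin_id X) (lin_id Y) = lin_id (ghom G X Y).
Proof. exact: ghom_mor_id. Qed.
Let radj_comp (Y Y' Y'' : lmodType A) (g : {linear Y' -> Y''}) (f : {linear Y -> Y'}) :
  ghom_mor G (lin_id X) (lin_comp g f) =
  lin_comp (ghom_mor G (lin_id X) g) (ghom_mor G (lin_id X) f).
Proof. by rewrite -ghom_mor_comp; congr (ghom_mor G _ _); apply: lin_ext. Qed.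
Definition ghom_functor : functor (Mod A) (Mod A) :=
  @Functor (Mod A) (Mod A) (ghom G X) (fun Y Y' f => ghom_mor G (lin_id X) f)
    radj_id radj_comp.

Definition diag_right_adjoint : right_adjoint (tens_right Mon X).
Proof.
refine (@RightAdjoint (Mod A) (Mod A) (tens_right Mon X) ghom_functor
  ghom_coev ghom_ev _ _ _ _).
- by move=> Y Y' f; apply: lin_ext => y; apply: lin_ext => x; exact: tmod_mapE.
- move=> Y Y' g; apply: tmod_ext => f x.
  by rewrite !lin_compE tmod_mapE !ghom_evE.
- move=> Y; apply: tmod_ext => y x.
  by rewrite lin_compE tmod_mapE ghom_evE.
- by move=> Y; apply: lin_ext => f; apply: lin_ext => x; exact: ghom_evE.
Defined.

(** As the antipode need not be bijective, its inverse is not available to twist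
   the action on k-linear maps. But X (x) - preserves colimits and A is a
   generator, so the right adjoint is Hom_A (X (x) A, -), with A acting through
   right multiplication on the source. *)
Section LeftAdjoint.
Variable Z : lmodType A.
Definition rmul_fun (a : A) (b : reg) : reg := (b : A) * a.
Lemma rmul_linear a : linear (rmul_fun a).
Proof. by move=> c x y; rewrite /rmul_fun mulrDl -mulrA. Qed.
Definition rmul a : {linear reg -> reg} := mklin (rmul_linear a).

Definition lhom_act (a : A) (f : lhom_sort (X \ox reg) Z) : lhom_sort (X \ox reg) Z :=
  lin_comp (f : {linear _ -> _}) (tmod_map B (lin_id X) (rmul a)).
Lemma lhom_actE a (f : lhom_sort (X \ox reg) Z) x (b : reg) :
  (lhom_act a f : {linear _ -> _}) (tm x b) =
  (f : {linear _ -> _}) (tm x ((b : A) * a : reg)).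
Proof. by rewrite lin_compE (tmod_mapE B (lin_id X) (rmul a)). Qed.
Lemma lhom_act_is_action : is_action lhom_act.
Proof.
split=> [a b f|f|a f g|f a b]; apply: tmod_ext => x c.
- by rewrite !lhom_actE mulrA.
- by rewrite lhom_actE mulr1.
- by rewrite lhom_actE; exact: esym (congr2 +%R (lhom_actE _ _ _ _) (lhom_actE _ _ _ _)).
- rewrite lhom_actE mulrDr tmDr linearD.
  exact: esym (congr2 +%R (lhom_actE _ _ _ _) (lhom_actE _ _ _ _)).
Qed.
Definition lhom : lmodType A := act_mod lhom_act_is_action.
End LeftAdjoint.

Section LeftUnit.
Variable Y : lmodType A.
Lemma ract_linear (y : Y) : linear (fun b : reg => (b : A) *: y).
Proof. by move=> c u v; rewrite scalerDl scalerA. Qed.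
Definition ract y : {linear reg -> Y} := mklin (ract_linear y).
Definition lhom_unit_fun (y : Y) : lhom (X \ox Y) := tmod_map B (lin_id X) (ract y).
Lemma lhom_unit_linear : linear lhom_unit_fun.
Proof.
move=> a y y'; apply: tmod_ext => x b.
rewrite tmod_mapE [ract _ _]/= scalerDr scalerA tmDr.
apply: esym; refine (congr2 +%R _ (tmod_mapE B (lin_id X) (ract y') x b)).
by rewrite [LHS]lhom_actE [LHS]tmod_mapE.
Qed.
Definition lhom_unit : {linear Y -> lhom (X \ox Y)} := mklin lhom_unit_linear.
End LeftUnit.

Section LeftCounit.
Variable Z : lmodType A.
Let E (x : X) (f : lhom Z) : Z := (f : {linear X \ox reg -> Z}) (tm x (1 : reg)).
Let E_l f : linear (E^~ f : res X -> res Z).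
Proof.
exact: (lin_fun (res_linear (f : {linear X \ox reg -> Z})) (tm_linearl B _)).
Qed.
Let E_r x : linear (E x : res (lhom Z) -> res Z).
Proof.
move=> c f g; refine (congr2 +%R _ erefl).
apply: etrans (lhom_actE (alg_map A c) f x (1 : A)) _.
have l := lin_fun (res_linear (f : {linear X \ox reg -> Z}))
  (tm_linearr B (N := reg) x).
have := linearZ_LR (mklin l) c (1 : A).
by rewrite /= alg_scaleE mulr1 mul1r.
Qed.
Let E_act a x (f : lhom Z) :
  @tmod_lift_fun k A B X _ Z E E_l E_r (a *: tm x f) = a *: E x f.
Proof.
rewrite tmod_lift_sum /E -linearZ tm_actE.
have l := res_linear (f : {linear X \ox reg -> Z}).
rewrite (sw_push _ _ l); apply: eq_sw => u v.
have e : v *: (1 : reg) = v by exact: mulr1.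
by rewrite [LHS]lhom_actE mul1r e.
Qed.
Definition lhom_counit : {linear X \ox lhom Z -> Z} :=
  @tmod_lift k A B X _ Z E E_l E_r E_act.
Lemma lhom_counitE x (f : lhom Z) :
  lhom_counit (tm x f) = (f : {linear X \ox reg -> Z}) (tm x (1 : reg)).
Proof. exact: (tmod_liftE E_act). Qed.
End LeftCounit.

Section LeftMap.
Variables (Z Z' : lmodType A) (g : {linear Z -> Z'}).
Definition lhom_map_fun (f : lhom Z) : lhom Z' := lin_comp g (f : {linear _ -> _}).
Lemma lhom_map_linear : linear lhom_map_fun.
Proof. by move=> a f f'; apply: lin_ext => t; rewrite /= linearD. Qed.
Definition lhom_map : {linear lhom Z -> lhom Z'} := mklin lhom_map_linear.
End LeftMap.

Definition lhom_functor : functor (Mod A) (Mod A).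
Proof.
refine (@Functor (Mod A) (Mod A) lhom lhom_map _ _).
- by move=> Z; apply: lin_ext => f; apply: lin_ext.
- by move=> Z Z' Z'' g f; apply: lin_ext => h; apply: lin_ext.
Defined.

Definition diag_left_adjoint : right_adjoint (tens_left Mon X).
Proof.
refine (@RightAdjoint (Mod A) (Mod A) (tens_left Mon X) lhom_functor
  lhom_unit lhom_counit _ _ _ _).
- move=> Y Y' f; apply: lin_ext => y; apply: tmod_ext => x b.
  transitivity (tmod_map B (lin_id X) f (tmod_map B (lin_id X) (ract y) (tm x b))).
    by [].
  transitivity (tmod_map B (lin_id X) (ract (f y)) (tm x b)); last by [].
  by rewrite !tmod_mapE; congr (tmod_tens _ _ _); exact: linearZ.
- move=> Z Z' g; apply: tmod_ext => x f.
  by rewrite !lin_compE tmod_mapE !lhom_counitE.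
- move=> Y; apply: tmod_ext => x y.
  by rewrite lin_compE tmod_mapE lhom_counitE tmod_mapE /= scale1r.
- move=> Z; apply: lin_ext => f; apply: tmod_ext => x b.
  transitivity (lhom_counit Z (tmod_map B (lin_id X) (ract (Y := lhom Z) f) (tm x b))).
    by [].
  by rewrite tmod_mapE lhom_counitE [LHS]lhom_actE mul1r.
Defined.
End Adjunction.

Definition diag_closed_monoidal : closed_monoidal Mon :=
  @ClosedMonoidal (Mod A) Mon diag_left_adjoint diag_right_adjoint.
Local Notation K := diag_closed_monoidal.

Lemma diag_adj_imorE (X X' Y Y' : lmodType A) (f : {linear X' -> X})
    (g : {linear Y -> Y'}) :
  imor (adj_ihom K) f g = ghom_mor G f g :> {linear ghom G X Y -> ghom G X' Y'}.
Proof.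
apply: lin_ext => h; apply: lin_ext => x.
transitivity (g (ghom_ev X Y (tmod_map B (lin_id (ghom G X Y)) f (tm h x)))).
  by [].
by rewrite tmod_mapE ghom_evE.
Qed.

(** The closed structure of the gabi-algebra, whose internal hom acts on morphisms
   as the one given by the adjunction does. *)
Definition diag_skew_closed : skew_closed (mone Mon) (adj_ihom K).
Proof.
refine (@SkewClosed (Mod A) (gone G) (adj_ihom K) (@ghom_i k A G) (@ghom_j k A G)
  (@ghom_G k A G) _ _ _ _ _ _ _ _ _);
  move=> *; rewrite ?[imor _ _ _]diag_adj_imorE.
- exact: ghom_i_nat.
- exact: ghom_j_dinat.
- exact: ghom_G_nat.
- exact: ghom_G_dinat.
- exact: ghom_ij.
- exact: ghom_ijG.
- exact: ghom_Gj.
- exact: ghom_iG.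
- exact: ghom_GG.
Defined.
End DiagonalClosed.

(** * Normality of the closed structures *)

Section CorrespondingClosedNormal.
Variables (C : category) (M : monoidal C) (K : closed_monoidal M).
Lemma adj_imor_radj X Y Y' (g : mor Y Y') :
  imor (adj_ihom K) (idm X) g = fmor (radj (cm_right K X)) g.
Proof.
rewrite /= /adj_imor mtenm_id comp_idr fmor_comp -comp_assoc.
by have /= -> := adj_triangleR (cm_right K X) Y; rewrite comp_idr.
Qed.
Theorem corresponding_closed_normal (S : skew_closed (mone M) (adj_ihom K)) :
  corresponding_closed S -> normal S.
Proof.
case=> S_G [S_j S_i].
apply: (@closed_monoidal_normal C M (adj_ihom K) (coev K) (ev K)) => //.
- by move=> X Y Y' f; rewrite adj_imor_radj; apply: (adj_unit_nat (cm_right K X)).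
- move=> X X' Y f; rewrite adj_imor_radj /= /adj_imor comp_idl.
  have := adj_unit_nat (cm_right K X) (coev K X' Y).
  rewrite /= -!/(coev _ _ _) => nat; rewrite -comp_assoc -nat comp_assoc.
  rewrite -fmor_comp; congr (fmor _ _ \c _).
  rewrite -comp_assoc -mtenm_comp comp_idl comp_idr.
  have -> : mtenm M (coev K X' Y) f =
      mtenm M (coev K X' Y) (idm X') \c mtenm M (idm Y) f.
    by rewrite -mtenm_comp comp_idr comp_idl.
  rewrite comp_assoc; have /= := adj_triangleL (cm_right K X') Y.
  by rewrite -/(ev _ _ _) -/(coev _ _ _) => ->; rewrite comp_idl.
- by move=> X Y Y' g; rewrite adj_imor_radj; apply: (adj_counit_nat (cm_right K X)).
- by move=> X Y; apply: (adj_triangleL (cm_right K X)).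
- by move=> X Y; rewrite adj_imor_radj; apply: (adj_triangleR (cm_right K X)).
Qed.
End CorrespondingClosedNormal.

Section DiagonalNormal.
Variables (k : comPzRingType) (A : algebra k) (B : bialgebra A) (G : gabi A).
Hypothesis eps_eq : forall a, g_eps G a = b_eps B a.
Hypotheses (T_r : translation_r B (g_delta G)) (T_l : translation_l B (g_delta G)).
Local Notation tm m n := (tmod_tens B m n).
Local Notation Mon := (diag_monoidal eps_eq).

Theorem translation_gabi_normal : normal (gabi_closed G).
Proof.
apply: (@closed_monoidal_normal (Mod A) Mon (gabi_ihom G)
  (fun X Y => ghom_coev T_r X Y) (fun X Y => ghom_ev T_l X Y)).
- by move=> X Y Y' f; apply: lin_ext => y; apply: lin_ext => x; exact: tmod_mapE.
- by move=> X X' Y f; apply: lin_ext => y; apply: lin_ext => x; exact: tmod_mapE.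
- by move=> X Y Y' g; apply: tmod_ext => f x; rewrite !lin_compE tmod_mapE !ghom_evE.
- by move=> X Y; apply: tmod_ext => y x; rewrite !lin_compE tmod_mapE !ghom_evE.
- by move=> X Y; apply: lin_ext => f; apply: lin_ext => x; exact: ghom_evE.
- move=> X Y Z; apply: lin_ext => x; apply: lin_ext => y; apply: lin_ext => z.
  exact: tmod_assocE.
- move=> X; apply: lin_ext => c; apply: lin_ext => x.
  exact: tmod_lambdaE.
- by move=> X; apply: lin_ext.
Qed.

Theorem diag_corresponding :
  corresponding_closed (diag_skew_closed eps_eq T_r T_l).
Proof.
split; [move=> X Y Z | split=> X].
- rewrite ![imor _ _ _]diag_adj_imorE.
  apply: lin_ext => x; apply: lin_ext => y; apply: lin_ext => z.
  exact: tmod_assocE.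
- rewrite [imor _ _ _]diag_adj_imorE.
  by apply: lin_ext => c; apply: lin_ext => x; exact: tmod_lambdaE.
- exact: lin_ext.
Qed.
End DiagonalNormal.

(** * Strictness of the forgetful functor *)

Lemma eqmK (C : category) (X Y : C) (e : X = Y) : eqm (esym e) \c eqm e = idm X.
Proof. by case: _ / e; rewrite comp_idl. Qed.
Lemma eqm_symK (C : category) (X Y : C) (e : X = Y) : eqm e \c eqm (esym e) = idm Y.
Proof. by case: _ / e; rewrite comp_idl. Qed.

Section DiagonalStrict.
Variables (k : comPzRingType) (A : algebra k) (B : bialgebra A) (G : gabi A).
Hypothesis eps_eq : forall a, g_eps G a = b_eps B a.
Hypotheses (T_r : translation_r B (g_delta G)) (T_l : translation_l B (g_delta G)).
Local Notation tm m n := (tmod_tens B m n).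
Local Notation Mon := (diag_monoidal eps_eq).

Lemma res_tmod_ext (M N : lmodType A) (V : lmodType k)
    (f g : {linear res (tmod B M N) -> V}) :
  (forall m n, f (tm m n) = g (tm m n)) -> f =1 g.
Proof.
move=> h; elim/tmod_ind => [//|s t hs ht|]; last by rewrite !linear0.
by rewrite !linearD hs ht.
Qed.
Lemma res_tmod_ext3 (M N P : lmodType A) (V : lmodType k)
    (f g : {linear res (tmod B (tmod B M N) P) -> V}) :
  (forall m n p, f (tm (tm m n) p) = g (tm (tm m n) p)) -> f =1 g.
Proof.
move=> h; apply: res_tmod_ext => t p; elim/tmod_ind: t => [//|s t hs ht|].
  by rewrite tmDl !linearD hs ht.
by rewrite tm0l !linear0.
Qed.

Theorem diag_strict_monoidal : strict_monoidal (forget A) Mon (kmod_monoidal k).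
Proof.
have [e1 e1E] := res_gone_eq G.
pose e X Y := projT1 (cid (res_tmod_eq B X Y)).
have eE X Y (x : tensor (res X) (res Y)) :
  (@eqm (Mod k) _ _ (e X Y) : {linear _ -> _}) x = x.
  exact: (projT2 (cid (res_tmod_eq B X Y))).
exists e1, e; split; [|split; [|split]].
- move=> X X' Y Y' f g; apply: lin_ext; apply: res_tmod_ext => m n.
  rewrite !lin_compE !eE [RHS]tens_mapE.
  exact: tmod_mapE.
- move=> X Y Z; apply: lin_ext; apply: res_tmod_ext3 => x y z.
  rewrite !lin_compE !eE.
  apply: etrans.
    apply: (congr1 (tens_map (lin_id (res X)) (@eqm (Mod k) _ _ (e Y Z)))).
    exact: tmod_assocE.
  apply: etrans; first exact: tens_mapE.
  rewrite eE; apply: esym; apply: etrans.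
    apply: (congr1 (tens_assoc _ _ _)); exact: tens_mapE.
  by rewrite eE; exact: tens_assocE.
- move=> X; apply: lin_ext; apply: res_tmod_ext => c x.
  rewrite !lin_compE !eE; apply: etrans; first exact: tmod_lambdaE.
  apply: esym; apply: etrans.
    by apply: (congr1 (tens_lambda _)); exact: tens_mapE.
  by rewrite e1E; exact: tens_lambdaE.
- move=> X; apply: lin_ext => x; rewrite !lin_compE !eE.
  apply: etrans; first exact: tens_mapE.
  by rewrite e1E.
Qed.

Lemma gabi_strict_data : exists (e1 : res (gone G) = k^o)
    (e : forall X Y, res (ghom G X Y) = homk (res X) (res Y)),
  [/\ forall c : k^o, (@eqm (Mod k) _ _ e1 : {linear _ -> _}) c = c,
      forall c : k^o, (@eqm (Mod k) _ _ (esym e1) : {linear _ -> _}) c = c,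
      forall X Y (f : homk (res X) (res Y)),
        (@eqm (Mod k) _ _ (e X Y) : {linear _ -> _}) f = f &
      forall X Y (f : homk (res X) (res Y)),
        (@eqm (Mod k) _ _ (esym (e X Y)) : {linear _ -> _}) f = f].
Proof.
have [e1 e1E] := res_gone_eq G.
pose e X Y := projT1 (cid (res_ghom_eq G X Y)).
have eE X Y (x : homk (res X) (res Y)) :
  (@eqm (Mod k) _ _ (e X Y) : {linear _ -> _}) x = x.
  exact: (projT2 (cid (res_ghom_eq G X Y))).
exists e1, e; split=> // [c|X Y f].
  by rewrite -{1}[c]e1E -lin_compE [lin_comp _ _](eqmK (C := Mod k)).
by rewrite -{1}[f]eE -lin_compE [lin_comp _ _](eqmK (C := Mod k)).
Qed.

Theorem diag_strictly_closed :
  strictly_closed (forget A) (diag_skew_closed eps_eq T_r T_l) (kmod_closed k).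
Proof.
have [e1 [e [e1E e1V eE eV]]] := gabi_strict_data.
exists e1, e; split; [|split; [|split]].
- move=> X X' Y Y' f g; rewrite [imor _ _ _]diag_adj_imorE.
  apply: lin_ext => h; apply: lin_ext => x.
  by rewrite !lin_compE !eE.
- move=> X; apply: lin_ext => f; rewrite !lin_compE eE.
  transitivity ((f : homk (res (gone G)) (res X))
    ((@eqm (Mod k) _ _ (esym e1) : {linear _ -> _}) (1 : k^o))); last by [].
  by rewrite e1V.
- move=> X; apply: lin_ext => c; rewrite !lin_compE eE e1E.
  exact: lin_ext.
- move=> X Y Z; apply: lin_ext => f; rewrite !lin_compE !eE.
  apply: lin_ext => g; apply: lin_ext => x.
  transitivity ((@eqm (Mod k) _ _ (e X Z) : {linear _ -> _})
    (homk_comp (f : homk _ _) ((@eqm (Mod k) _ _ (esym (e X Y)) : {linear _ -> _}) g)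
      : homk (res X) (res Z)) x).
    by [].
  by rewrite eE eV.
Qed.
End DiagonalStrict.

(** * From a normal-closed structure to a bialgebra with a translation map *)

(** A (x) C with A acting on the left factor. *)
Section FreeModule.
Variables (k : comPzRingType) (A C : algebra k).
Local Notation T := (tensor (alg_mod A) (alg_mod C)).
Definition free_act (a : A) (t : tens_alg A C) : tens_alg A C := atens A C a 1 * t.
Lemma free_is_action : is_action free_act.
Proof.
split=> [a b t|t|a s t|t a b]; rewrite /free_act.
- by rewrite mulrA [X in X * t]tens_mulE mulr1.
- exact: tens_mul1l.
- exact: mulrDr.
- by rewrite -mulrDl; congr (_ * t); exact: tensDl.
Qed.
Definition free_mod : lmodType A := act_mod free_is_action.
Lemma free_scaleE (a : A) (x : A) (y : C) :
  a *: (atens A C x y : free_mod) = atens A C (a * x) y.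
Proof. by apply: etrans (tens_mulE _ _ _ _) _; rewrite mul1r. Qed.
Lemma res_free_scale c (t : res free_mod) : c *: t = c *: (t : T) :> T.
Proof. by rewrite -tens_alg_scale. Qed.
End FreeModule.

Section FreeUnit.
Variables (k : comPzRingType) (A : algebra k).
Local Notation reg := (regular_mod A).
Lemma free_unit_linear : linear ((fun b : A => atens A A 1 b) :
  res reg -> res (free_mod A A)).
Proof.
move=> c x y; rewrite res_free_scale.
have l : linear ((fun b : A => atens A A 1 b) :
    alg_mod A -> tensor (alg_mod A) (alg_mod A)) by multilin.
exact: l.
Qed.
Lemma free_op_unit_linear : linear ((fun b : A => atens A (op_alg A) 1 b) :
  res reg -> res (free_mod A (op_alg A))).
Proof.
move=> c x y; rewrite res_free_scale.
have l : linear ((fun b : A => atens A (op_alg A) 1 b) :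
    alg_mod A -> tensor (alg_mod A) (alg_mod (op_alg A))) by multilin.
exact: l.
Qed.
End FreeUnit.

(** A closed structure on A-modules is lifted from k-modules when its internal hom
   is, up to the k-linear bijections phi, the module of k-linear maps with the
   usual structure morphisms. Both a gabi-algebra, with phi the identity, and an
   arbitrary strict closed structure, with phi a transport along an equality of
   objects, are of this kind. *)
Section NormalLifted.
Variables (k : comPzRingType) (A : algebra k).
Local Notation reg := (regular_mod A).
Local Notation AA := (tensor (alg_mod A) (alg_mod A)).
Variables (one : lmodType A) (H : ihom_functor (Mod A)).
Variable S : @skew_closed (Mod A) one H.
Local Notation HM X Y := (ihom H X Y : lmodType A).
Variables (phi : forall X Y : lmodType A, {linear res (HM X Y) -> homk (res X) (res Y)})
  (psi : forall X Y : lmodType A, {linear homk (res X) (res Y) -> res (HM X Y)}).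
Hypotheses (phiK : forall (X Y : lmodType A) (h : HM X Y), psi X Y (phi X Y h) = h)
  (psiK : forall (X Y : lmodType A) (f : homk (res X) (res Y)), phi X Y (psi X Y f) = f).
Variables (theta : {linear res one -> k^o}) (u : one).
Hypotheses (theta_u : theta u = 1)
  (u_theta : forall c : res one, (theta c : k) *: (u : res one) = c).
Local Notation ev h x := (phi _ _ h x).
Hypotheses
  (phi_imor : forall (X X' Y Y' : lmodType A) (f : {linear X' -> X})
     (g : {linear Y -> Y'}) (h : HM X Y) (x : X'),
     ev ((imor H f g : {linear HM X Y -> HM X' Y'}) h) x = g (ev h (f x)))
  (phi_i : forall (X : lmodType A) (h : HM one X),
     (sc_i S X : {linear HM one X -> X}) h = ev h u)
  (phi_j : forall (X : lmodType A) (x : X),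
     ev ((sc_j S X : {linear one -> HM X X}) u) x = x)
  (phi_G : forall (X Y Z : lmodType A) (f : HM Y Z) (h : HM X Y) (x : X),
     ev (ev ((sc_G S X Y Z : {linear HM Y Z -> HM (HM X Y) (HM X Z)}) f) h : HM X Z) x
     = ev f (ev h x)).
Hypotheses (S_right : right_normal S) (S_assoc : assoc_normal S).

Lemma phi_inj X Y : injective (phi X Y).
Proof. by move=> h h' E; rewrite -[h]phiK E phiK. Qed.

Lemma reg_scale1 (a : A) : a *: (1 : reg) = a.
Proof. exact: mulr1. Qed.
Lemma ract1 (M : lmodType A) (m : M) : ract m (1 : A) = m.
Proof. exact: scale1r. Qed.
Lemma reg_linE (M : lmodType A) (f : {linear reg -> M}) (a : A) :
  f a = a *: f (1 : A).
Proof. by rewrite -linearZ /=; congr (f _); rewrite -[LHS]mulr1. Qed.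

Section Coend.
Variables X Y Z : lmodType A.

(** As A is free on 1, morphisms from A to an internal hom amount to k-linear maps;
   in these terms the canonical map sends (f, g) to x |-> f o g(x). *)
Lemma coend_map1 (V : lmodType A) (f : {linear reg -> HM V Z})
    (g : {linear X -> HM Y V}) x y :
  ev (ev ((coend_map S (coend_mk (f : @mor (Mod A) _ _) g) : {linear reg -> HM X (HM Y Z)})
    (1 : A)) x : HM Y Z) y = ev (f (1 : A)) (ev (g x) y).
Proof.
rewrite -phi_G; congr (phi _ _ _ _).
exact: phi_imor.
Qed.

Lemma coend_surj (b : X -> Y -> Z) : @bilinear_fun k (res X) (res Y) (res Z) b ->
  exists (V : lmodType A) (F : homk (res V) (res Z)) (g : {linear X -> HM Y V}),
    forall x y, F (ev (g x) y) = b x y.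
Proof.
case=> b_l b_r.
have l : linear (fun x : res X => psi Y Z (mklin (b_r x))).
  move=> c x x'; rewrite -linearP; congr (psi _ _ _).
  by apply: lin_ext => y; exact: b_l.
pose z := psi X (HM Y Z) (mklin l).
have [_ /(_ (ract z)) [[V [f g]] E]] := S_assoc reg X Y Z.
exists V, (phi V Z ((f : {linear reg -> HM V Z}) (1 : A))), g => x y.
rewrite -coend_map1 [coend_map _ _]E ract1.
by rewrite /z psiK /= psiK.
Qed.

(** For fixed a, x and y, the element f (a g(x)(y)) depends only on the class of
   (f, g) in the coend, since the morphisms that are slid across the coend are
   A-linear. By injectivity of the canonical map it depends only on the values
   f (g(x)(y)). *)
Lemma coend_inj (V W : lmodType A) (F : homk (res V) (res Z)) (g : {linear X -> HM Y V})
    (F' : homk (res W) (res Z)) (g' : {linear X -> HM Y W}) :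
  (forall x y, F (ev (g x) y) = F' (ev (g' x) y)) ->
  forall (a : A) x y, F (a *: (ev (g x) y : V)) = F' (a *: (ev (g' x) y : W)).
Proof.
move=> E a x y.
pose p V (F : homk (res V) (res Z)) (g : {linear X -> HM Y V}) :
  coend_elt H reg X Y Z := coend_mk (ract (psi V Z F) : @mor (Mod A) _ _) g.
have : coend_eq (p V F g) (p W F' g').
  have [-> _] := S_assoc reg X Y Z; apply: lin_ext => b.
  rewrite [LHS]reg_linE [RHS]reg_linE; congr (_ *: _).
  apply: phi_inj; apply: lin_ext => x1; apply: phi_inj; apply: lin_ext => y1.
  by rewrite !coend_map1 !ract1 !psiK.
pose inv (p : coend_elt H reg X Y Z) : Z :=
  let: existT V (f, g) := p in
  ev ((f : {linear reg -> HM V Z}) (1 : A))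
    (a *: (ev ((g : {linear X -> HM Y V}) x) y : V)).
have pinv V0 F0 g0 : inv (p V0 F0 g0) = F0 (a *: (ev (g0 x) y : V0)).
  by rewrite /inv /p /= scale1r psiK.
move=> e; rewrite -!pinv; elim: {E pinv p} e => {F F' g g' V W} //.
  move=> V W v f g /=; rewrite phi_imor phi_imor; congr (phi _ _ _ _).
  exact: linearZ.
by move=> p q r _ -> _ ->.
Qed.
End Coend.

Definition unit_char (a : A) : k := theta (a *: u).
Local Notation eps := unit_char.
Lemma unit_charE a : a *: u = alg_map A (eps a) *: u.
Proof. by rewrite -[LHS]u_theta. Qed.
Lemma unit_char_linear : linear (eps : alg_mod A -> k^o).
Proof. by rewrite /unit_char => *; apply: (lin_app theta); multilin. Qed.
Lemma unit_char1 : eps 1 = 1.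
Proof. by rewrite /unit_char scale1r. Qed.
Lemma unit_charM a b : eps (a * b) = eps a * eps b.
Proof.
rewrite /unit_char -scalerA [in LHS](unit_charE b) scalerA -alg_central -scalerA mulrC.
exact: (linearZ_LR theta (eps b) (a *: u)).
Qed.
Lemma unit_char_map c : eps (alg_map A c) = c.
Proof.
have := linearZ_LR theta c u; rewrite theta_u => E.
by apply: etrans E _; exact: mulr1.
Qed.

Section Trivial.
Variable N : lmodType k.
Definition triv_act (a : A) (n : N) : N := eps a *: n.
Lemma triv_is_action : is_action triv_act.
Proof.
have epsD (a b : A) : eps (a + b) = eps a + eps b.
  by have := unit_char_linear 1 a b; rewrite !scale1r.
split=> [a b n|n|a m n|n a b]; rewrite /triv_act.
- by rewrite scalerA unit_charM.
- by rewrite unit_char1 scale1r.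
- exact: scalerDr.
- by rewrite epsD scalerDl.
Qed.
Definition triv_mod : lmodType A := act_mod triv_is_action.
Lemma res_triv_scale c (n : res triv_mod) : c *: n = c *: (n : N) :> N.
Proof. by rewrite -[c in RHS]unit_char_map. Qed.
End Trivial.

(** Surjectivity of the canonical map, applied to the pairing of X and Y into
   X (x) Y with trivial action, makes X (x) Y a k-linear retract of an A-module V
   such that pairing into V comes from an A-linear map X -> [Y, V]. *)
Lemma tensor_embedding (X Y : lmodType A) :
  exists (V : lmodType A) (p : {linear tensor (res X) (res Y) -> res V})
      (f : {linear res V -> tensor (res X) (res Y)}) (g : {linear X -> HM Y V}),
    (forall x y, ev (g x) y = p (tens (x : res X) (y : res Y))) /\
    (forall t, f (p t) = t).
Proof.
pose T := tensor (res X) (res Y).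
have b : @bilinear_fun k (res X) (res Y) (res (triv_mod T))
    (fun x y => tens (x : res X) (y : res Y) : T).
  have [h1 h2] := tens_bilinear (res X) (res Y).
  split=> [y c x x'|x c y y']; rewrite res_triv_scale; [exact: h1 | exact: h2].
have [V [F [g Fg]]] := coend_surj b.
have f_lin : linear (F : res V -> T).
  by move=> c v v'; rewrite linearP res_triv_scale.
have p_bil : @bilinear_fun k (res X) (res Y) (res V) (fun x y => ev (g x) y).
  split=> [y|x]; last exact: linearP.
  by apply: lin_homk; apply: lin_app; exact: (res_linear g).
pose f := mklin f_lin; pose p := tliftl p_bil.
have pE x y : p (tens x y) = ev (g x) y by exact: tliftlE.
have fp t : f (p t) = t.
  apply: (@tens_ext _ _ _ _ (lin_comp f p) (lin_id T)) => x y.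
  by rewrite lin_compE pE; exact: Fg.
by exists V, p, f, g; split=> // x y; rewrite pE.
Qed.

Section Comultiplication.
Variables (V : lmodType A) (p : {linear AA -> res V}) (f : {linear res V -> AA})
  (g : {linear reg -> HM reg V}).
Hypotheses (gE : forall x y : A, ev (g x) y = p (atens A A x y))
  (fp : forall t, f (p t) = t).

(** The action of a on 1 (x) 1, retracted from V to A (x) A. *)
Definition lift_comul (a : A) : tens_alg A A := f (a *: (p (atens A A 1 1) : V) : res V).
Local Notation Delta := lift_comul.

Lemma lift_comul_linear : linear (Delta : alg_mod A -> AA).
Proof. by apply: (lin_app f); multilin. Qed.

(** After composing with b |-> b x and b |-> b y one may take X = Y = A. Then h
   and g become comparable by the uniqueness statement coend_inj, and the action on
   the values of g at (1, 1) defines Delta. *)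
Lemma act_ev (X Y Z : lmodType A) (h : {linear X -> HM Y Z}) (a : A) (x : X) (y : Y) :
  a *: (ev (h x) y : Z) = \sw_(r, s <- Delta a) (ev (h (r *: x)) (s *: y) : res Z).
Proof.
pose h' : {linear reg -> HM reg Z} :=
  lin_comp (imor H (ract y) (lin_id Z) : {linear HM Y Z -> HM reg Z})
    (lin_comp h (ract x)).
have h'E (r s : A) : ev (h' r) s = ev (h (r *: x)) (s *: y) by exact: phi_imor.
have b : @bilinear_fun k (alg_mod A) (alg_mod A) (res Z) (fun r s => ev (h' r) s).
  split=> [s|r]; last exact: linearP.
  by apply: lin_homk; apply: lin_app; exact: (res_linear h').
have E : a *: (ev (h' (1 : A)) (1 : A) : Z) = tliftl b (Delta a).
  rewrite /lift_comul -gE.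
  refine (@coend_inj reg reg Z Z V (lin_id (res Z) : homk (res Z) (res Z)) h'
    (lin_comp (tliftl b) f : homk (res V) (res Z)) g _ a (1 : A) (1 : A)) => r s.
  transitivity (tliftl b (f (ev (g r) s))); last by [].
  by rewrite gE fp tliftlE.
rewrite h'E !scale1r in E; rewrite E; apply: eq_sw => r s.
exact: h'E.
Qed.

Lemma act_embedding a t : a *: (p t : V) = p (Delta a * (t : tens_alg A A)).
Proof.
have l1 : linear (fun t => a *: (p t : V) : res V) by multilin.
have l2 : linear (fun t : AA => p (Delta a * (t : tens_alg A A))) by multilin.
apply: (@tens_ext _ _ _ _ (mklin l1) (mklin l2)) => x y.
transitivity (a *: (ev (g x) y : V)); first by rewrite gE.
rewrite act_ev.
transitivity (p (Delta a * atens A A x y)); last by [].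
have l : linear (fun t : AA => p ((t : tens_alg A A) * atens A A x y)) by multilin.
rewrite -[Delta a in RHS]sw_id (sw_push _ _ l); apply: eq_sw => r s.
by rewrite gE [atens A A r s * _]tens_mulE.
Qed.

Lemma lift_comul1 : Delta 1 = 1.
Proof. by rewrite /lift_comul scale1r fp. Qed.
Lemma lift_comulM a b : Delta (a * b) = Delta a * Delta b.
Proof.
have e : Delta b * atens A A 1 1 = Delta b by exact: tens_mul1r.
by rewrite {1}/lift_comul -scalerA act_embedding e act_embedding fp.
Qed.

(** The counit laws express the A-linearity of j and of the inverse of i. *)
Lemma lift_counitl a : \sw_(x, y <- Delta a) (alg_map A (eps x) * y) = a.
Proof.
have := act_ev (sc_j S reg : {linear one -> HM reg reg}) a u (1 : A).
rewrite phi_j reg_scale1 => E; apply: etrans _ (esym E).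
refine (@eq_sw k _ _ (alg_mod A) _ _ _ _) => x y.
rewrite unit_charE linearZ.
have := linearZ_LR (phi reg reg) (eps x) ((sc_j S reg : {linear one -> HM reg reg}) u).
rewrite res_scaleE => ->; rewrite /= phi_j.
by rewrite reg_scale1.
Qed.

Lemma lift_counitr a : \sw_(x, y <- Delta a) (x * alg_map A (eps y)) = a.
Proof.
have [r [_ ri]] := S_right reg.
have iK (x : A) : ev ((r : {linear reg -> HM one reg}) x) u = x.
  by rewrite -phi_i -lin_compE [lin_comp _ _]ri.
have := act_ev (r : {linear reg -> HM one reg}) a (1 : A) u.
rewrite iK reg_scale1 => E; apply: etrans _ (esym E).
refine (@eq_sw k _ _ (alg_mod A) _ _ _ _) => x y.
rewrite unit_charE; have := linearZ_LR (phi one reg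
  ((r : {linear reg -> HM one reg}) (x *: (1 : reg)))) (eps y) u.
rewrite res_scaleE => ->; rewrite /= iK reg_scale1.
by rewrite alg_scaleE alg_central.
Qed.

Let g_act (a b : A) : a *: (g b : HM reg V) = g (a * b : A).
Proof. by rewrite -linearZ. Qed.

(** Both sides describe the action of a on the image of 1 (x) (1 (x) 1) in a
   module that contains A (x) V. One computation goes through [A, V] by means of
   Gamma, which is A-linear, and the other through V. *)
Lemma lift_coassoc a :
  \sw_(x, y <- Delta a) \sw_(x1, x2 <- Delta x)
     @tens k (alg_mod A) AA x1 (atens A A x2 y) =
  \sw_(x, y <- Delta a) \sw_(y1, y2 <- Delta y)
     @tens k (alg_mod A) AA x (atens A A y1 y2).
Proof.
have [V' [p' [f' [g' [g'E fp']]]]] := tensor_embedding reg V.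
pose L : {linear res V' -> tensor (alg_mod A) AA} :=
  lin_comp (tens_map (lin_id (alg_mod A)) f) f'.
have LE (x y z : A) : L (ev (g' x) (ev (g y) z : V)) =
      @tens k (alg_mod A) AA x (atens A A y z).
  by rewrite lin_compE g'E fp' [LHS]tens_mapE gE fp.
pose c : {linear reg -> HM (HM reg V) (HM reg V')} :=
  lin_comp (sc_G S reg V V' : {linear HM V V' -> HM (HM reg V) (HM reg V')}) g'.
have cE (x y z : A) : ev (ev (c x) (g y) : HM reg V') z = ev (g' x) (ev (g y) z : V).
  exact: phi_G.
pose w : HM reg V' := ev (c (1 : A)) (g (1 : A)).
have E1 : a *: (ev w (1 : A) : V') =
    \sw_(x, y <- Delta a) \sw_(x1, x2 <- Delta x)
      (ev (g' x1) (ev (g x2) y : V) : res V').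
  have -> := act_ev (lin_id (HM reg V')) a w (1 : A).
  apply: eq_sw => x y; rewrite lin_idE /w (act_ev c x (1 : A) (g (1 : A))).
  have l : linear (fun h : res (HM reg V') => ev h (y *: (1 : reg))).
    by apply: lin_homk; apply: lin_app.
  rewrite (sw_push _ _ l); apply: eq_sw => x1 x2.
  by rewrite g_act !reg_scale1 mulr1 cE.
have E2 : a *: (ev w (1 : A) : V') =
    \sw_(x, y <- Delta a) \sw_(y1, y2 <- Delta y)
      (ev (g' x) (ev (g y1) y2 : V) : res V').
  rewrite /w cE act_ev; apply: eq_sw => x y.
  rewrite act_ev (sw_push _ _ (linearP (phi V V' _))); apply: eq_sw => y1 y2.
  by rewrite !reg_scale1.
have := congr1 L (etrans (esym E1) E2).
rewrite !(sw_push _ _ (linearP L)) => E.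
apply: etrans (etrans E _); apply: eq_sw => x y;
  rewrite (sw_push _ _ (linearP L)); apply: eq_sw => z t; rewrite LE //.
Qed.

Lemma lift_comul_hom : alg_hom Delta.
Proof.
split; [|exact: lift_comul1|exact: lift_comulM].
by move=> c x y; rewrite lift_comul_linear [in RHS]tens_alg_scale.
Qed.
Lemma unit_char_hom : @alg_hom k A (base_alg k) eps.
Proof.
by split; [exact: unit_char_linear | exact: unit_char1 | exact: unit_charM].
Qed.

Definition lift_bialgebra : bialgebra A :=
  @Bialgebra k A eps Delta unit_char_hom lift_comul_hom lift_counitl
    lift_counitr lift_coassoc.
End Comultiplication.

Section Translation.
(** The gabi comultiplication: the action of a on b |-> 1 (x) b, taken at 1. *)
Definition lift_translation (a : A) : tens_alg A (op_alg A) :=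
  ev (a *: psi reg (free_mod A (op_alg A)) (mklin (@free_op_unit_linear k A))
    : HM _ _) (1 : A).
Local Notation delta := lift_translation.

(** This is the formula for the action on the values of the identity of an internal
   hom, evaluated on b |-> 1 (x) b. *)
Lemma lift_translation_linear :
  linear (delta : alg_mod A -> tensor (alg_mod A) (alg_mod (op_alg A))).
Proof.
move=> c x y; rewrite -res_free_scale /lift_translation.
set h := psi _ _ _.
have l : linear ((fun a : A =>
    ev (a *: (h : HM reg (free_mod A (op_alg A))) : HM _ _) (1 : A))
    : alg_mod A -> res (free_mod A (op_alg A))).
  by apply: lin_homk; apply: lin_app; multilin.
exact: l.
Qed.

(** The action on an internal hom is natural, so it is determined by the
   universal map b |-> 1 (x) b. *)
Lemma ev_act (Y Z : lmodType A) (h : HM Y Z) (a : A) (y : Y) :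
  ev (a *: h : HM Y Z) y = \sw_(p, q <- delta a) (p *: (ev h ((q : A) *: y) : Z) : res Z).
Proof.
have b : bilin (fun p q : A => p *: (ev h (q *: y) : Z) : res Z).
  by split=> ?; multilin.
pose Lf (t : free_mod A (op_alg A)) : Z :=
  \sw_(p, q <- t) (p *: (ev h ((q : A) *: y) : Z) : res Z).
have LE (p q : A) : Lf (atens A (op_alg A) p q) = p *: (ev h (q *: y) : Z).
  exact: sw_op_tens b.
have Lk : linear (Lf : tensor (alg_mod A) (alg_mod (op_alg A)) -> res Z).
  exact: tlift_linear (bilin_op b).
have LD s t : Lf (s + t) = Lf s + Lf t by exact: (linearD (mklin Lk)).
have L0 : Lf 0 = 0 by exact: (linear0 (mklin Lk)).
have Llin : linear Lf.
  move=> c s t; rewrite LD; congr (_ + _).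
  elim/tensor_ind: s => [p q|s s' hs hs'|].
  - by rewrite [X in Lf X]free_scaleE !LE scalerA.
  - by rewrite scalerDr !LD hs hs' scalerDr.
  - by rewrite !(scaler0, L0).
pose L := mklin Llin.
set ih := psi reg (free_mod A (op_alg A)) (mklin (@free_op_unit_linear k A)).
have E : (imor H (ract y) (lin_id Z) : {linear HM Y Z -> HM reg Z}) h =
    (imor H (lin_id reg) L : {linear HM reg (free_mod A (op_alg A)) -> HM reg Z}) ih.
  apply: phi_inj; apply: lin_ext => b0; rewrite !phi_imor /ih psiK.
  by rewrite [RHS]LE scale1r.
have := congr1 (fun h => ev (a *: (h : HM reg Z) : HM reg Z) (1 : A)) E.
by rewrite /= -!linearZ !phi_imor ract1; apply.
Qed.

Variables (V : lmodType A) (p : {linear AA -> res V}) (f : {linear res V -> AA})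
  (g : {linear reg -> HM reg V}).
Hypotheses (gE : forall x y : A, ev (g x) y = p (atens A A x y))
  (fp : forall t, f (p t) = t).
Local Notation B := (lift_bialgebra gE fp).

(** The A-linear map g satisfies g a = a g 1. At 1 this says that
   a (x) 1 = beta (delta a). *)
Lemma lift_translation_r : translation_r B delta.
Proof.
move=> a; rewrite -[RHS]fp -gE.
have -> : g (a : reg) = a *: (g (1 : A) : HM reg V).
  by rewrite -linearZ reg_scale1.
rewrite ev_act (sw_push _ _ (linearP f)); apply: eq_sw => x y.
rewrite reg_scale1 (act_ev gE fp) (sw_push _ _ (linearP f)); apply: eq_sw => r s.
by rewrite gE fp reg_scale1.
Qed.

Lemma lift_translation_l : translation_l B delta.
Proof.
move=> a; pose h := psi reg (free_mod A A) (mklin (@free_unit_linear k A)).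
have hE (b : A) : ev h b = atens A A 1 b by rewrite /h psiK.
have := act_ev gE fp (lin_id (HM reg (free_mod A A))) a h (1 : A).
rewrite lin_idE hE [X in X = _ -> _]free_scaleE mulr1 => ->.
apply: eq_sw => x y; rewrite lin_idE reg_scale1 ev_act; apply: eq_sw => r s.
by rewrite hE [RHS]free_scaleE mulr1.
Qed.
End Translation.

Theorem normal_lifted_translation :
  exists (B : bialgebra A) (d : A -> tens_alg A (op_alg A)),
  [/\ forall a, b_eps B a = theta (a *: u),
      linear (d : alg_mod A -> tensor (alg_mod A) (alg_mod (op_alg A))),
      translation_r B d, translation_l B d &
      forall (Y Z : lmodType A) (h : HM Y Z) (a : A) (y : Y),
        ev (a *: h : HM Y Z) y =
        \sw_(p, q <- d a) (p *: (ev h ((q : A) *: y) : Z) : res Z)].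
Proof.
have [V [p [f [g [gE fp]]]]] := tensor_embedding reg reg.
exists (lift_bialgebra gE fp), lift_translation; split=> //.
- exact: lift_translation_linear.
- exact: lift_translation_r.
- exact: lift_translation_l.
- exact: ev_act.
Qed.
End NormalLifted.

(** * The correspondence *)

Section Correspondence.
Variables (k : comPzRingType) (A : algebra k).
Local Notation AAop := (tensor (alg_mod A) (alg_mod (op_alg A))).

(** The relation underlying the bijection. It is functional in both directions,
   because each of the comultiplications of G and B is determined by the Galois
   map and its inverse. *)
Definition corresponds (G : gabi A) (B : bialgebra A) : Prop :=
  [/\ forall a, g_eps G a = b_eps B a, translation_r B (g_delta G)
    & translation_l B (g_delta G)].

Lemma g_delta_linear (G : gabi A) : linear (g_delta G : alg_mod A -> AAop).
Proof. exact: alg_hom_linear (g_delta_hom G). Qed.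

Lemma gabi_eq (G G' : gabi A) : g_eps G =1 g_eps G' -> g_delta G =1 g_delta G' -> G = G'.
Proof.
move=> /funext e /funext d.
case: G G' e d => e0 d0 h1 h2 h3 h4 h5 [e0' d0' h1' h2' h3' h4' h5'] /= e d.
case: _ / e in h1' h3' h4' *; case: _ / d in h2' h3' h4' h5' *.
by congr Gabi; apply: Prop_irrelevance.
Qed.

Lemma normal_gabi_bialgebra (G : gabi A) : normal (gabi_closed G) ->
  exists B, corresponds G B.
Proof.
case=> _ [S_r S_a].
have phi_l (X Y : lmodType A) :
    linear ((fun f => f) : res (ghom G X Y) -> homk (res X) (res Y)).
  by move=> c f g; rewrite res_ghom_scaleE.
have psi_l (X Y : lmodType A) :
    linear ((fun f => f) : homk (res X) (res Y) -> res (ghom G X Y)).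
  by move=> c f g; rewrite res_ghom_scaleE.
have theta_l : linear ((fun c => c) : res (gone G) -> k^o).
  by move=> c x y; rewrite res_gone_scale.
have u_theta (c : res (gone G)) : (c : k) *: ((1 : k) : res (gone G)) = c.
  by rewrite res_gone_scale; exact: mulr1.
have j1 (X : lmodType A) (x : X) : (1 : k) *: (x : res X) = x by exact: scale1r.
have [B [d [e d_lin T_r T_l E]]] := @normal_lifted_translation k A (gone G)
  (gabi_ihom G) (gabi_closed G) (fun X Y => mklin (@phi_l X Y))
  (fun X Y => mklin (@psi_l X Y)) (fun _ _ _ => erefl) (fun _ _ _ => erefl)
  (mklin theta_l) (1 : k) erefl u_theta (fun _ _ _ _ _ _ _ _ => erefl)
  (fun _ _ => erefl) j1 (fun _ _ _ _ _ _ => erefl) S_r S_a.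
have dE : g_delta G = d.
  apply: funext => a; pose h : homk (res (regular_mod A)) (res (free_mod A (op_alg A))) :=
    mklin (@free_op_unit_linear k A).
  have hE (t : tens_alg A (op_alg A)) :
      \sw_(p, q <- t) (p *: (h ((q : A) *: (1 : regular_mod A)) : free_mod A (op_alg A))
        : res (free_mod A (op_alg A))) = t.
    rewrite -[RHS]sw_id; apply: eq_sw => p q.
    have -> : (q : A) *: (1 : regular_mod A) = (q : A) by exact: mulr1.
    by apply: etrans (free_scaleE (C := op_alg A) _ _ _) _; rewrite mulr1.
  by rewrite -[LHS]hE -[RHS]hE; exact: (E _ _ h a (1 : A)).
exists B; split; rewrite ?dE // => a; rewrite e /=.
exact: esym (mulr1 (g_eps G a)).
Qed.

Lemma hopf_normal_gabi (B : bialgebra A) (S : A -> A) : is_antipode B S ->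
  exists G : gabi A, normal (gabi_closed G) /\ corresponds G B.
Proof.
case=> S_lin Sl Sr.
have d_lin := antipode_translation_linear B S_lin.
have T_r := right_antipode_translation S_lin Sr.
have T_l := left_antipode_translation S_lin Sl.
exists (translation_gabi d_lin T_r T_l); split; last by split.
exact: (@translation_gabi_normal k A B (translation_gabi d_lin T_r T_l)).
Qed.

Lemma corresponds_antipode (G : gabi A) (B : bialgebra A) : corresponds G B ->
  exists S, is_antipode B S.
Proof.
case=> _ T_r T_l; exists (translation_antipode B (g_delta G)).
exact: translation_antipodeP (g_delta_linear G) T_r T_l.
Qed.

Lemma corresponds_delta (G : gabi A) (B : bialgebra A) (S : A -> A) :
  corresponds G B -> is_antipode B S ->
  forall a, g_delta G a = \sw_(x, y <- b_delta B a) atens A (op_alg A) x (S y).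
Proof.
case=> _ T_r _ [S_lin Sl _].
exact: translation_unique (antipode_translation_linear B S_lin) T_r
  (left_antipode_translation S_lin Sl).
Qed.

Lemma corresponds_uniq_bialgebra (G : gabi A) (B B' : bialgebra A) :
  corresponds G B -> corresponds G B' -> B = B'.
Proof.
case=> e T_r _ [e' _ T_l']; apply: bialgebra_unique T_r T_l' _ => a.
by rewrite -e e'.
Qed.

Lemma corresponds_uniq_gabi (G G' : gabi A) (B : bialgebra A) :
  corresponds G B -> corresponds G' B -> G = G'.
Proof.
case=> e T_r _ [e' _ T_l']; apply: gabi_eq => [a|]; first by rewrite e e'.
exact: translation_unique (g_delta_linear G') T_r T_l'.
Qed.

Lemma normal_gabi_hopf : exists f : normal_gabi A -> hopf_structure A,
  bijective f /\ forall G, corresponds (sval G) (sval (f G)).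
Proof.
have toB (G : normal_gabi A) : exists B : hopf_structure A, corresponds (sval G) (sval B).
  have [B GB] := normal_gabi_bialgebra (svalP G).
  by exists (exist _ B (corresponds_antipode GB)).
have toG (B : hopf_structure A) : exists G : normal_gabi A, corresponds (sval G) (sval B).
  have [S BS] := svalP B; have [G [N GB]] := hopf_normal_gabi BS.
  by exists (exist _ G N).
have [f fP] := choice toB; have [g gP] := choice toG.
have sval_inj (T : Type) (P : T -> Prop) (x y : {t | P t}) : sval x = sval y -> x = y.
  case: x y => x px [y py] /= e; case: _ / e in py *.
  by congr exist; apply: Prop_irrelevance.
exists f; split=> //; exists g => [G|B]; apply: sval_inj.
  exact: corresponds_uniq_gabi (gP _) (fP _).
exact: corresponds_uniq_bialgebra (fP _) (gP _).
Qed.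

Lemma normal_lift_translation (one : lmodType A) (H : ihom_functor (Mod A))
    (S : @skew_closed (Mod A) one H) :
  normal S -> strictly_closed (forget A) S (kmod_closed k) ->
  exists (B : bialgebra A) (G : gabi A), corresponds G B.
Proof.
case=> _ [S_r S_a] [e1 [e [c_imor [c_i [c_j c_G]]]]].
pose phi (X Y : lmodType A) :
  {linear res (ihom H X Y : lmodType A) -> homk (res X) (res Y)} :=
  @eqm (Mod k) _ _ (e X Y).
pose psi (X Y : lmodType A) :
  {linear homk (res X) (res Y) -> res (ihom H X Y : lmodType A)} :=
  @eqm (Mod k) _ _ (esym (e X Y)).
pose theta : {linear res one -> k^o} := @eqm (Mod k) _ _ e1.
pose thetaV : {linear k^o -> res one} := @eqm (Mod k) _ _ (esym e1).
have phiK (X Y : lmodType A) (h : (ihom H X Y : lmodType A)) : psi X Y (phi X Y h) = h.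
  by rewrite -lin_compE [lin_comp _ _](eqmK (C := Mod k)).
have psiK (X Y : lmodType A) (f : homk (res X) (res Y)) : phi X Y (psi X Y f) = f.
  by rewrite -lin_compE [lin_comp _ _](eqm_symK (C := Mod k)).
have thetaK c : thetaV (theta c) = c.
  by rewrite -lin_compE [lin_comp _ _](eqmK (C := Mod k)).
have thetaVK c : theta (thetaV c) = c.
  by rewrite -lin_compE [lin_comp _ _](eqm_symK (C := Mod k)).
pose u : one := thetaV 1.
have u_theta (c : res one) : (theta c : k) *: (u : res one) = c.
  by rewrite -linearZ -[RHS]thetaK; congr (thetaV _); exact: mulr1.
have [B [d [e_eps d_lin T_r T_l _]]] :
    exists (B : bialgebra A) (d : A -> tens_alg A (op_alg A)),
  [/\ forall a, b_eps B a = theta (a *: u),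
      linear (d : alg_mod A -> AAop),
      translation_r B d, translation_l B d &
      forall (Y Z : lmodType A) (h : (ihom H Y Z : lmodType A)) (a : A) (y : Y),
        phi Y Z (a *: h) y =
        \sw_(p, q <- d a) (p *: (phi Y Z h ((q : A) *: y) : Z) : res Z)].
  apply: (@normal_lifted_translation k A one H S phi psi phiK psiK theta u
    (thetaVK 1) u_theta) => //.
  - move=> X X' Y Y' f g h x.
    exact: (congr1 (fun F : {linear res (ihom H X Y : lmodType A) ->
      homk (res X') (res Y')} => F h x) (c_imor _ _ _ _ f g)).
  - move=> X h.
    exact: (congr1 (fun F : {linear res (ihom H one X : lmodType A) -> res X} => F h)
      (c_i X)).
  - move=> X x.
    have E := congr1 (fun F : {linear res one -> homk (res X) (res X)} => F u x) (c_j X).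
    apply: etrans E _.
    transitivity ((theta u : k) *: (x : res X)); first by [].
    by rewrite thetaVK scale1r.
  - move=> X Y Z f h x.
    have E := congr1 (fun F : {linear res (ihom H Y Z : lmodType A) ->
      homk (homk (res X) (res Y)) (homk (res X) (res Z))} => F f (phi X Y h) x) (c_G X Y Z).
    by apply: etrans E; rewrite -[in LHS](phiK _ _ h).
exists B, (translation_gabi d_lin T_r T_l); by split.
Qed.
End Correspondence.

Theorem theorem5p12 (k : comPzRingType) (A : algebra k) :
  (exists f : normal_gabi A -> hopf_structure A,
     bijective f /\
     forall G : normal_gabi A,
       (forall a : A, b_eps (sval (f G)) a = g_eps (sval G) a) /\
       (forall S : A -> A, is_antipode (sval (f G)) S ->
          forall a : A, g_delta (sval G) a =
            \sw_(x, y <- b_delta (sval (f G)) a) atens A (op_alg A) x (S y)))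
  /\
  ((exists (one : Mod A) (H : ihom_functor (Mod A)) (S : skew_closed one H),
      normal S /\ strictly_closed (forget A) S (kmod_closed k))
   <->
   (exists (M : monoidal (Mod A)) (K : closed_monoidal M)
       (S : skew_closed (mone M) (adj_ihom K)),
      corresponding_closed S /\
      strict_monoidal (forget A) M (kmod_monoidal k) /\
      strictly_closed (forget A) S (kmod_closed k))).
Proof.
split.
  have [f [f_bij fP]] := normal_gabi_hopf A; exists f; split=> // G.
  have [e _ _] := fP G; split=> [a|S hS]; first by rewrite e.
  exact: corresponds_delta (fP G) hS.
split=> [[one [H [S [S_normal S_strict]]]] | [M [K [S [S_K [_ S_strict]]]]]]; last first.
  exists (mone M), (adj_ihom K), S; split=> //.
  exact: corresponding_closed_normal S_K.
have [B [G [e T_r T_l]]] := normal_lift_translation S_normal S_strict.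
exists (diag_monoidal e), (diag_closed_monoidal e T_r T_l), (diag_skew_closed e T_r T_l).
split; first exact: diag_corresponding.
by split; [exact: diag_strict_monoidal | exact: diag_strictly_closed].
Qed.
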